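(* Let $A$ be a finite subset of $(0,\infty]$, and let $\mathbb{X}=\bigoplus_{p\in A}\ell_p$, with the convention that $\ell_\infty$ means $c_0$ if $\infty\in A$. If $(\mathbf{x}_j)_{j\in J}$ is an unconditional basis of $\mathbb{X}$ (indexed by a countable set $J$), then there is a partition $(J_p)_{p\in A}$ of $J$ such that, for each $p\in A$, $(\mathbf{x}_j)_{j\in J_p}$ is a basis of $\ell_p$, in the sense that the closed linear span $[\mathbf{x}_j\colon j\in J_p]$ in $\mathbb{X}$ is isomorphic (linearly homeomorphic) to $\ell_p$.
   Context: Scalars are real or complex. A quasi-Banach space is a complete quasi-normed space, where a quasi-norm satisfies the axioms of a norm except that the triangle inequality is replaced by $\Vert x+y\Vert\le\kappa(\Vert x\Vert+\Vert y\Vert)$ for some constant $\kappa\ge 1$. For $0<p<\infty$, $\ell_p$ is the space of scalar sequences with $\Vert (a_n)\Vert=(\sum_n|a_n|^p)^{1/p}<\infty$; the symbol $\ell_\infty$ denotes $c_0$, the space of sequences tending to zero with the supremum norm. A finite direct sum $\bigoplus_{i\in F}\mathbb{X}_i$ of quasi-Banach spaces is the Cartesian product with quasi-norm $\Vert(x_i)_i\Vert=\sup_{i\in F}\Vert x_i\Vert$. A family $(\mathbf{x}_j)_{j\in J}$, $J$ countable, in a quasi-Banach space is an unconditional basic sequence if every $f$ in its closed linear span $[\mathbf{x}_j\colon j\in J]$ has a unique expansion $f=\sum_{j\in J}a_j\,\mathbf{x}_j$ with scalars $a_j$ and unconditional convergence (i.e. convergence to $f$ for every ordering of $J$). It is an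 unconditional basis of $\mathbb{X}$ if moreover its closed linear span is $\mathbb{X}$. *)

(* Defs.v *)
From HB Require Import structures.
From mathcomp Require Import all_boot all_order all_algebra finmap.
From mathcomp Require Import complex.
From mathcomp Require Import all_classical all_reals all_analysis.

Set Implicit Arguments.
Unset Strict Implicit.
Unset Printing Implicit Defensive.

Import Order.TTheory GRing.Theory Num.Theory.
Import numFieldTopology.Exports numFieldNormedType.Exports.

Local Open Scope classical_set_scope.
Local Open Scope ring_scope.

Variant scalar_kind := real_scalars | complex_scalars.

Definition scalar (R : realType) (k : scalar_kind) : numFieldType :=
  match k with real_scalars => R | complex_scalars => R[i] end.

(* The norm of the numFieldType R[i] takes its values in R[i]; quasi-norms are
   R-valued, hence this R-valued modulus. *)
Definition sabs (R : realType) (k : scalar_kind) : scalar R k -> R :=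
  match k with
  | real_scalars => fun a : R => `|a|
  | complex_scalars => fun a : R[i] => ComplexField.Normc.normc a
  end.

Section ScalarTheory.
Context {R : realType} {k : scalar_kind}.
Implicit Types a b : scalar R k.

Lemma sabs_ge0 a : 0 <= sabs a.
Proof. by case: k a => //= -[u v]; rewrite sqrtr_ge0. Qed.

Lemma sabs0 : sabs (0 : scalar R k) = 0.
Proof. by case: k => /=; [exact: normr0 | exact: ComplexField.Normc.normc0]. Qed.

Lemma sabs_eq0 a : sabs a = 0 -> a = 0.
Proof.
by case: k a => /= a; [exact: normr0_eq0 | exact: ComplexField.Normc.eq0_normc].
Qed.

Lemma sabsM a b : sabs (a * b) = sabs a * sabs b.
Proof.
by case: k a b => /= a b; [exact: normrM | exact: ComplexField.Normc.normcM].
Qed.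

Lemma sabs1 : sabs (1 : scalar R k) = 1.
Proof. by case: k => /=; [exact: normr1 | exact: ComplexField.Normc.normc1]. Qed.

Lemma sabsN1 : sabs (-1 : scalar R k) = 1.
Proof.
apply/eqP; rewrite -(@eqrXn2 _ 2) ?sabs_ge0// expr1n expr2 -sabsM.
by rewrite mulrN1 opprK sabs1.
Qed.

Lemma le_sabsD a b : sabs (a + b) <= sabs a + sabs b.
Proof. by case: k a b => /= a b; [exact: ler_normD | exact: le_normcD]. Qed.

End ScalarTheory.

HB.mixin Record isQuasiNormed (R : realType) (k : scalar_kind) V
    & GRing.Lmodule (scalar R k) V & Topological V := {
  qnorm : V -> R;
  qnorm_ge0 : forall x, 0 <= qnorm x;
  qnorm0_eq0 : forall x, qnorm x = 0 -> x = 0;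
  qnormZ : forall (a : scalar R k) x, qnorm (a *: x) = sabs a * qnorm x;
  qnormD : exists2 kappa, 1 <= kappa &
    forall x y, qnorm (x + y) <= kappa * (qnorm x + qnorm y);
  nbhs_qnorm : forall x : V,
    nbhs x = filter_from [set e | 0 < e] (fun e => [set y | qnorm (x - y) < e])
}.

#[short(type="quasiNormedType")]
HB.structure Definition QuasiNormed (R : realType) (k : scalar_kind) :=
  {V of GRing.Lmodule (scalar R k) V & Topological V & isQuasiNormed R k V}.

HB.factory Record Lmodule_isQuasiNormed (R : realType) (k : scalar_kind) V
    & GRing.Lmodule (scalar R k) V := {
  qnorm : V -> R;
  qnorm_ge0 : forall x, 0 <= qnorm x;
  qnorm0_eq0 : forall x, qnorm x = 0 -> x = 0;
  qnormZ : forall (a : scalar R k) x, qnorm (a *: x) = sabs a * qnorm x;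
  qnormD : exists2 kappa, 1 <= kappa &
    forall x y, qnorm (x + y) <= kappa * (qnorm x + qnorm y)
}.

HB.builders Context R k V & Lmodule_isQuasiNormed R k V.

Let qnbhs (x : V) : set_system V :=
  filter_from [set e | 0 < e] (fun e => [set y | qnorm (x - y) < e]).

HB.instance Definition _ := hasNbhs.Build V qnbhs.

Let qnorm0 : qnorm 0 = 0.
Proof. by rewrite -(scale0r 0) qnormZ sabs0 mul0r. Qed.

Let qnbhs_filter (x : V) : ProperFilter (nbhs x).
Proof.
apply: filter_from_proper => [|e /= e0]; last by exists x; rewrite /= subrr qnorm0.
apply: filter_from_filter; first by exists 1 => /=.
move=> e f /= e0 f0; exists (Num.min e f) => /=; first by rewrite lt_min e0.
by move=> y /=; rewrite lt_min => /andP[].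
Qed.

Let qnbhs_singleton (x : V) (B : set V) : nbhs x B -> B x.
Proof. by move=> [e /= e0]; apply; rewrite /= subrr qnorm0. Qed.

Let qnbhs_nbhs (x : V) (B : set V) : nbhs x B -> nbhs x (nbhs^~ B).
Proof.
have [c c1 qD] := qnormD; have c0 : 0 < c := lt_le_trans ltr01 c1.
move=> [e /= e0 eB]; exists (e / (c * 2)) => /=; first by rewrite divr_gt0 ?mulr_gt0.
move=> y /= xy; exists (e / (c * 2)) => /=; first by rewrite divr_gt0 ?mulr_gt0.
move=> z /= yz; apply: eB => /=; rewrite -(subrKA y).
apply: (le_lt_trans (qD _ _)); rewrite mulrC -ltr_pdivlMr//.
apply: (lt_le_trans (ltrD xy yz)).
by rewrite invfM mulrA -splitr.
Qed.

HB.instance Definition _ :=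
  Nbhs_isNbhsTopological.Build V qnbhs_filter qnbhs_singleton qnbhs_nbhs.

HB.instance Definition _ := isQuasiNormed.Build R k V
  qnorm_ge0 qnorm0_eq0 qnormZ qnormD (fun=> erefl).

HB.end.

Definition exponent (R : realType) := {p : \bar R | (0 < p)%E}.

HB.instance Definition _ (R : realType) := Choice.on (exponent R).

Section Sequences.
Context {R : realType} {k : scalar_kind}.
Implicit Types (p : exponent R) (r : R) (a b : nat -> (scalar R k)^o).

Definition in_ell p : {pred nat -> (scalar R k)^o} := fun a => `[<
  match val p with
  | r%:E => (\sum_(n <oo) (sabs (a n) `^ r)%:E < +oo)%E
  | _ => sabs (a n) @[n --> \oo] --> (0 : R) (* p = +oo gives c_0 *)
  end >].

Definition ell_norm p a : R :=
  match val p with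
  | r%:E => fine (\sum_(n <oo) (sabs (a n) `^ r)%:E)%E `^ r^-1
  | _ => sup (range (fun n => sabs (a n)))
  end.

Let S r a : \bar R := (\sum_(n <oo) (sabs (a n) `^ r)%:E)%E.

Let S_ge0 r a : (0 <= S r a)%E.
Proof. by apply: nneseries_ge0 => n _ _; rewrite lee_fin powR_ge0. Qed.

Let S0 r : 0 < r -> S r 0 = 0%E.
Proof.
move=> r0; apply: eseries0 => n _ _.
by rewrite sabs0 powR0// gt_eqF.
Qed.

Let SZ r (c : scalar R k) a : S r (c *: a)%R = ((sabs c `^ r)%:E * S r a)%E.
Proof.
rewrite /S -nneseriesZl; last by move=> n _; rewrite lee_fin powR_ge0.
apply: eq_eseriesr => n _; rewrite -EFinM -powRM ?sabs_ge0//.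
by rewrite -sabsM.
Qed.

Let powRD_le r (x y : R) : 0 < r -> 0 <= x -> 0 <= y ->
  (x + y) `^ r <= 2 `^ r * (x `^ r + y `^ r).
Proof.
move=> r0; wlog xy : x y / x <= y => [H x0 y0|x0 y0].
  by case: (leP x y) => [|/ltW] ?; [|rewrite addrC [X in _ * X]addrC]; exact: H.
apply: (@le_trans _ _ ((2 * y) `^ r)).
  apply: ge0_ler_powR; rewrite ?nnegrE ?addr_ge0 ?mulr_ge0//; first exact: ltW.
  by rewrite mulr_natl mulr2n lerD2r.
by rewrite powRM// ler_wpM2l ?powR_ge0// lerDr powR_ge0.
Qed.

Let SD r a b : 0 < r -> (S r (a + b)%R <= (2 `^ r)%:E * (S r a + S r b))%E.
Proof.
move=> r0; rewrite /S -nneseriesD; do ?by move=> n _ _; rewrite lee_fin powR_ge0.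
rewrite -nneseriesZl; last by move=> n _; rewrite -EFinD lee_fin addr_ge0 ?powR_ge0.
apply: lee_nneseries => n *; first by rewrite lee_fin powR_ge0.
rewrite -EFinD -EFinM lee_fin; apply: le_trans (powRD_le r0 _ _); rewrite ?sabs_ge0//.
by rewrite ge0_ler_powR ?nnegrE ?addr_ge0 ?sabs_ge0 ?le_sabsD// ltW.
Qed.

Let S_eq0 r a : 0 < r -> S r a = 0%E -> a = 0.
Proof.
move=> r0 Sa0; apply/funext => n; apply: sabs_eq0; apply: (@powR_eq0_eq0 _ _ r).
apply/eqP; rewrite eq_le powR_ge0 andbT -lee_fin -[leRHS]/(0%E) -Sa0.
rewrite /S (@nneseriesD1 _ _ n)//; last by move=> m _; rewrite lee_fin powR_ge0.
by rewrite leeDl// nneseries_ge0// => m _ _; rewrite lee_fin powR_ge0.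
Qed.

Let c0_ub a : sabs (a n) @[n --> \oo] --> (0 : R) ->
  has_ubound (range (fun n => sabs (a n))).
Proof. by move=> a0; apply: (cvg_has_sup (cvgP _ a0)).2. Qed.

Let c0_le_sup a n : sabs (a n) @[n --> \oo] --> (0 : R) ->
  sabs (a n) <= sup (range (fun n => sabs (a n))).
Proof. by move=> /c0_ub ub; apply: ub_le_sup => //; exists n. Qed.

Fact in_ell_closed p : subsemimod_closed (in_ell p).
Proof.
case: p => [[r| |] p0]; last by [].
- have r0 : 0 < r by rewrite -lte_fin.
  split; first split.
  + by apply/asboolP; rewrite /= -/(S r 0) S0// ltry.
  + move=> a b /asboolP Sa /asboolP Sb; apply/asboolP => /=.
    apply: le_lt_trans (SD a b r0) _.
    by rewrite lte_mul_pinfty ?lee_fin ?powR_ge0// lte_add_pinfty.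
  + move=> c a /asboolP Sa; apply/asboolP; rewrite /= -/(S r (c *: a)) SZ.
    by rewrite lte_mul_pinfty ?lee_fin ?powR_ge0.
- split; first split.
  + apply/asboolP => /=; under eq_fun do rewrite sabs0; exact: cvg_cst.
  + move=> a b /asboolP Sa /asboolP Sb; apply/asboolP => /=.
    apply: (@squeeze_cvgr _ _ _ _ (fun=> 0) (fun n => sabs (a n) + sabs (b n))).
    * by near=> n; rewrite sabs_ge0 le_sabsD.
    * exact: cvg_cst.
    * by rewrite -[0]addr0; exact: cvgD.
  + move=> c a /asboolP Sa; apply/asboolP => /=.
    under eq_fun do rewrite sabsM.
    by rewrite -(mulr0 (sabs c)); apply: cvgMr.
Unshelve. all: by end_near. Qed.

HB.instance Definition _ p := GRing.isSubmodClosed.Build _ _ (in_ell p)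
  (in_ell_closed p).

Fact ell_norm_ge0 p a : 0 <= ell_norm p a.
Proof.
case: p => [[r| |] p0] //=; rewrite /ell_norm/= ?powR_ge0//.
have [ub|/sup_out ->//] := pselect (has_sup (range (fun n => sabs (a n)))).
apply: le_trans (sabs_ge0 (a 0%N)) _.
by apply: ub_le_sup; [exact: ub.2|exists 0%N].
Qed.

Fact ell_norm0_eq0 p a : a \in in_ell p -> ell_norm p a = 0 -> a = 0.
Proof.
case: p => [[r| |] p0] /asboolP //=; rewrite /ell_norm/=.
- have r0 : 0 < r by rewrite -lte_fin.
  rewrite -/(S r a) => Sa /powR_eq0_eq0 fS0; apply: (S_eq0 r0).
  by rewrite -[LHS]fineK ?fS0// ge0_fin_numE.
- move=> a0 s0; apply/funext => n; apply: sabs_eq0; apply/eqP.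
  by rewrite eq_le sabs_ge0 andbT -s0 c0_le_sup.
Qed.

Fact ell_normZ p (c : scalar R k) a : a \in in_ell p ->
  ell_norm p (c *: a) = sabs c * ell_norm p a.
Proof.
case: p => [[r| |] p0] /asboolP //=; rewrite /ell_norm/=.
- have r0 : 0 < r by rewrite -lte_fin.
  rewrite -!/(S r _) => Sa; rewrite SZ fineM//; last by rewrite ge0_fin_numE.
  rewrite powRM ?powR_ge0 ?fine_ge0//=.
  by rewrite -powRrM divff ?gt_eqF// powRr1 ?sabs_ge0.
- have le_sup (d : scalar R k) b : sabs (b n) @[n --> \oo] --> (0 : R) ->
      sup (range (fun n => sabs ((d *: b) n))) <=
      sabs d * sup (range (fun n => sabs (b n))).
    move=> b0; apply: ge_sup; first by exists (sabs ((d *: b) 0%N)), 0%N.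
    by move=> _ [n _ <-]; rewrite sabsM ler_wpM2l ?sabs_ge0// c0_le_sup.
  move=> a0; apply/eqP; rewrite eq_le le_sup//=.
  have [->|c0] := eqVneq c 0.
    rewrite sabs0 mul0r; have := @ell_norm_ge0 (exist _ +oo%E p0) (0 *: a).
    exact.
  have c_gt0 : 0 < sabs c.
    by rewrite lt_neqAle sabs_ge0 andbT eq_sym; apply: contra_neq c0 => /sabs_eq0.
  rewrite -ler_pdivlMl// -[in leLHS](scale1r a) -(mulVf c0) -scalerA.
  have -> : (sabs c)^-1 = sabs c^-1.
    by apply: (mulfI (lt0r_neq0 c_gt0)); rewrite mulfV ?gt_eqF// -sabsM mulfV// sabs1.
  apply: le_sup.
  by have /asboolP := (in_ell_closed (exist _ +oo%E p0)).2 c a (asboolT a0).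
Qed.

Fact ell_normD p : exists2 kappa, 1 <= kappa & forall a b,
  a \in in_ell p -> b \in in_ell p ->
  ell_norm p (a + b) <= kappa * (ell_norm p a + ell_norm p b).
Proof.
case: p => [[r| |] p0] //=; rewrite /ell_norm/=.
- have r0 : 0 < r by rewrite -lte_fin.
  have t1 : 1 <= 2 `^ r^-1 :> R.
    by rewrite -[leLHS](powRr0 2) ler_powR ?invr_ge0 ?ltW// ltr1n.
  exists (2 * 2 `^ r^-1); first by rewrite mulr_ege1// ler1n.
  move=> a b /asboolP/= Sa /asboolP/= Sb; rewrite -!/(S r _) in Sa Sb *.
  have fa : S r a \is a fin_num by rewrite ge0_fin_numE.
  have fb : S r b \is a fin_num by rewrite ge0_fin_numE.
  rewrite -mulrA; have [sa sb] := (fine_ge0 (S_ge0 r a), fine_ge0 (S_ge0 r b)).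
  apply: (@le_trans _ _ ((2 `^ r * (fine (S r a) + fine (S r b))) `^ r^-1)).
    apply: ge0_ler_powR; rewrite ?nnegrE ?fine_ge0//; first by rewrite invr_ge0 ltW.
      by rewrite mulr_ge0 ?powR_ge0 ?addr_ge0.
    rewrite -fineD// -[X in X * _]/(fine (2 `^ r)%:E) -fineM ?fin_numD ?fa ?fb//.
    apply: fine_le; [|by rewrite fin_numM ?fin_numD ?fa ?fb|exact: SD].
    rewrite ge0_fin_numE//; apply: le_lt_trans (SD a b r0) _.
    by rewrite lte_mul_pinfty ?lee_fin ?powR_ge0// lte_add_pinfty.
  rewrite powRM ?powR_ge0 ?addr_ge0// -powRrM divff ?gt_eqF// powRr1//.
  by rewrite ler_wpM2l// powRD_le// invr_gt0.
- exists 1 => // a b /asboolP/= a0 /asboolP/= b0; rewrite mul1r.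
  apply: ge_sup; first by exists (sabs ((a + b) 0%N)), 0%N.
  move=> _ [n _ <-]; apply: le_trans (le_sabsD _ _) _.
  by rewrite lerD// c0_le_sup.
Qed.

End Sequences.

Record ell (R : realType) (k : scalar_kind) (p : exponent R) := Ell {
  ell_seq :> nat -> (scalar R k)^o;
  ell_seqP : ell_seq \in in_ell p
}.

Arguments ell {R} k p.

HB.instance Definition _ R k p := [isSub for @ell_seq R k p].
HB.instance Definition _ R k p := [Choice of @ell R k p by <:].
HB.instance Definition _ R k p := [SubChoice_isSubZmodule of @ell R k p by <:].
HB.instance Definition _ R k p := [SubZmodule_isSubLmodule of @ell R k p by <:].

Section EllQuasiNormed.
Context {R : realType} {k : scalar_kind} (p : exponent R).
Implicit Types x y : ell k p.

Let N x := ell_norm p x.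

Let N_eq0 x : N x = 0 -> x = 0.
Proof. by move=> N0; apply: val_inj; exact: ell_norm0_eq0 (ell_seqP x) N0. Qed.

Let NZ (c : scalar R k) x : N (c *: x) = sabs c * N x.
Proof. exact: ell_normZ (ell_seqP x). Qed.

Let ND : exists2 kappa, 1 <= kappa &
  forall x y, N (x + y) <= kappa * (N x + N y).
Proof.
have [kappa k1 D] := @ell_normD R k p.
by exists kappa => // x y; apply: D; exact: ell_seqP.
Qed.

HB.instance Definition _ := Lmodule_isQuasiNormed.Build R k (ell k p)
  (fun x => ell_norm_ge0 p x) N_eq0 NZ ND.

End EllQuasiNormed.

Definition dsum (R : realType) (k : scalar_kind) (I : finType)
  (V : I -> quasiNormedType R k) : Type := forall i, V i.

Section DirectSum.
Context {R : realType} {k : scalar_kind} {I : finType}.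
Variable V : I -> quasiNormedType R k.
Local Notation X := (dsum V).
Implicit Types x y z : X.

HB.instance Definition _ := gen_eqMixin X.
HB.instance Definition _ := gen_choiceMixin X.

Let add x y : X := fun i => x i + y i.
Let opp x : X := fun i => - x i.
Let zero : X := fun i => 0.
Let scale (a : scalar R k) x : X := fun i => a *: x i.

Let addA : associative add.
Proof. by move=> x y z; apply/functional_extensionality_dep => i; exact: addrA. Qed.
Let addC : commutative add.
Proof. by move=> x y; apply/functional_extensionality_dep => i; exact: addrC. Qed.
Let add0 : left_id zero add.
Proof. by move=> x; apply/functional_extensionality_dep => i; exact: add0r. Qed.
Let addN : left_inverse zero opp add.
Proof. by move=> x; apply/functional_extensionality_dep => i; exact: addNr. Qed.

HB.instance Definition _ := GRing.isZmodule.Build X addA addC add0 addN.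

Let scaleA a b x : scale a (scale b x) = scale (a * b) x.
Proof. by apply/functional_extensionality_dep => i; exact: scalerA. Qed.
Let scale1 : left_id 1 scale.
Proof. by move=> x; apply/functional_extensionality_dep => i; exact: scale1r. Qed.
Let scaleDr : right_distributive scale +%R.
Proof. by move=> a x y; apply/functional_extensionality_dep => i; exact: scalerDr. Qed.
Let scaleDl x : {morph scale^~ x : a b / a + b}.
Proof. by move=> a b; apply/functional_extensionality_dep => i; exact: scalerDl. Qed.

HB.instance Definition _ := GRing.Zmodule_isLmodule.Build (scalar R k) X
  scaleA scale1 scaleDr scaleDl.

Let N x : R := \big[Num.max/0]_(i : I) qnorm (x i).

Let N_ge0 x : 0 <= N x.
Proof. exact: bigmax_ge_id. Qed.

Let N_eq0 x : N x = 0 -> x = 0.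
Proof.
move=> N0; apply/functional_extensionality_dep => i; apply: qnorm0_eq0.
by apply/eqP; rewrite eq_le qnorm_ge0 andbT -N0 (le_bigmax _ (fun i => qnorm (x i))).
Qed.

Let NZ (a : scalar R k) x : N (a *: x) = sabs a * N x.
Proof.
rewrite /N; elim/big_ind2 : _ => [|u1 u2 v1 v2 -> ->|i _]; first by rewrite mulr0.
- by rewrite maxr_pMr ?sabs_ge0.
- exact: qnormZ.
Qed.

Let ND : exists2 kappa, 1 <= kappa &
  forall x y, N (x + y) <= kappa * (N x + N y).
Proof.
have /choice[c cP] : forall i, exists c : R, 1 <= c /\ forall u v : V i,
    qnorm (u + v) <= c * (qnorm u + qnorm v).
  by move=> i; have [c c1 cD] := @qnormD R k (V i); exists c.
exists (\big[Num.max/1]_(i : I) c i); first exact: bigmax_ge_id.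
have m0 : 0 <= \big[Num.max/1]_(i : I) c i by rewrite (le_trans ler01)// bigmax_ge_id.
move=> x y; apply: bigmax_le => [|i _]; first by rewrite mulr_ge0// addr_ge0.
apply: le_trans ((cP i).2 _ _) _; apply: ler_pM.
- exact: le_trans ler01 (cP i).1.
- by rewrite addr_ge0 ?qnorm_ge0.
- exact: le_bigmax.
- by rewrite lerD// ?(le_bigmax _ (fun i => qnorm (x i))) ?(le_bigmax _ (fun i => qnorm (y i))).
Qed.

HB.instance Definition _ := Lmodule_isQuasiNormed.Build R k X N_ge0 N_eq0 NZ ND.

End DirectSum.

Section Bases.
Context {R : realType} {k : scalar_kind}.
Implicit Types V W : quasiNormedType R k.

Definition linear_span V (S : set V) : set V :=
  [set f | exists (n : nat) (a : 'I_n -> scalar R k) (v : 'I_n -> V),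
    (forall i, S (v i)) /\ f = \sum_(i < n) a i *: v i].

Definition closed_span V (S : set V) : set V := closure (linear_span S).

(* An ordering of J as a sequence; it is padded with None after the last
   element when J is finite. *)
Definition ordering (J : Type) (e : nat -> option J) : Prop :=
  (forall j, exists! n, e n = Some j) /\
  (forall n, e n = None -> e n.+1 = None).

Definition unconditional_sum (J : Type) V (u : J -> V) (f : V) : Prop :=
  forall e : nat -> option J, ordering e ->
    (\sum_(n < m) oapp u 0 (e n)) @[m --> \oo] --> f.

Definition unconditional_basic_sequence (J : countType) V (x : J -> V) : Prop :=
  forall f, closed_span (range x) f ->
    exists! a : J -> scalar R k, unconditional_sum (fun j => a j *: x j) f.

Definition unconditional_basis (J : countType) V (x : J -> V) : Prop :=
  unconditional_basic_sequence x /\ closed_span (range x) = setT.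

Definition isomorphic_to_subspace V W (S : set W) : Prop :=
  exists (T : {linear V -> W}) (T' : W -> V),
    [/\ cancel T T', range T = S, continuous T & {within S, continuous T'}].

End Bases.

Arguments isomorphic_to_subspace {R k} V {W} S.

(* Main.v *)
(** Write P_p for the coordinate projections of the direct sum and E_a for the
    multiplier f |-> sum_i a_i x_i^*(f) x_i attached to a bounded scalar sequence a;
    uniform boundedness makes the E_a uniformly bounded.  Put d_p(i) = x_i^*(P_p x_i).
    As sum_p d_p(i) = 1, every i lies in some J_p with |d_p(i)| >= 1/#|A|; let E_p be
    the multiplier of the indicator of J_p, and Y_p its range.

    - A gliding hump gives that E_b P_p E_a P_q is small for p < q and a, b supported far
      out.  For p <> q, averaging E_b P_q E_(w e) P_p E_e P_q over signs e yields
      E_b P_q E_(w d_p) P_q; a Khinchine-type estimate for Rademacher chaos of order two,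
      valid in l_q for all q > 0, then shows that P_q E_p P_q is small on far tails.
    - Consequently E_p (1 - P_p) is nilpotent up to a small error on tails (it is
      triangular for the order of exponents), so that P_p has a bounded left inverse
      on a tail of Y_p, and Y_p embeds in l_p as a complemented subspace.
    - By pigeonhole, E_p nearly fixes suitable differences of unit vectors of l_p, whence
      l_p embeds in Y_p as a complemented subspace.
    - Pelczynski's decomposition method concludes that Y_p, the closed span of the x_j
      with j in J_p, is isomorphic to l_p.

    All estimates are run with the quasi-norm itself: a sum of n terms costs powers of its
    constant kap, which is harmless in geometric series and in fixed finite sums. *)

Require Import Defs.
From HB Require Import structures.
From mathcomp Require Import all_boot all_order all_algebra finmap.
From mathcomp Require Import complex.
From mathcomp Require Import all_classical all_reals all_analysis.
From mathcomp Require Import lra ring.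

Set Implicit Arguments.
Unset Strict Implicit.
Unset Printing Implicit Defensive.

Import Order.TTheory GRing.Theory Num.Theory.
Import numFieldTopology.Exports numFieldNormedType.Exports.

Local Open Scope classical_set_scope.
Local Open Scope ring_scope.

(* Otherwise [scalar] denotes GRing's linear forms. *)
Import Defs.

(** * Real and complex scalars *)

(** Two difficulties shape the argument. Exponents below 1 leave neither convexity nor duality:
    weakly null sequences are replaced by differences of vectors selected by pigeonhole on finitely
    many coefficients, complements are exhibited by explicit maps, and the chaos inequality is
    proved for the exponent of each summand. Moreover, a basis vector need not be close to a single
    summand: passages from a smaller exponent to a larger one need not be small, and only the
    reverse passages are negligible on tails. A round trip between two different summands always
    contains one of the latter. This is why the diagonal $d_p$ is reached through an expression
    quadratic in the signs, and why the error $E_p(1-P_p)$ is merely triangular, hence handled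
    through its powers. The resulting smallness serves twice: with label $p$ and component $q$ it
    embeds $Y_p$ in $\ell_p$; with the roles exchanged, and together with $\sum_q E_q=1$, it makes
    $P_pE_pP_p$ almost the identity on suitable vectors, which yields the copy of $\ell_p$ in
    $Y_p$. *)

Lemma sqrtr_le_normD (R : rcfType) (x y : R) : Num.sqrt (x ^+ 2 + y ^+ 2) <= `|x| + `|y|.
Proof.
rewrite -ler_sqr ?nnegrE ?sqrtr_ge0 ?addr_ge0// sqr_sqrtr ?addr_ge0 ?sqr_ge0//.
by rewrite sqrrD !real_normK ?num_real// lerD2r lerDl mulrn_wge0 ?mulr_ge0.
Qed.

Section Scalars.
Context {R : realType} {k : scalar_kind}.
Implicit Types (a b : scalar R k) (r : R).

Definition rscal : R -> scalar R k :=
  match k with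
  | real_scalars => fun r => r
  | complex_scalars => fun r => (r%:C)%C
  end.

Lemma sabs_rscal r : sabs (rscal r) = `|r|.
Proof.
rewrite /rscal; case: k => //=.
by rewrite expr0n /= addr0 sqrtr_sqr.
Qed.

Lemma rscalM r s : rscal (r * s) = rscal r * rscal s.
Proof. by rewrite /rscal; case: k => //=; rewrite rmorphM. Qed.

Lemma rscal1 : rscal 1 = 1.
Proof. by rewrite /rscal; case: k. Qed.

Lemma sabsN a : sabs (- a) = sabs a.
Proof. by rewrite -mulN1r sabsM sabsN1 mul1r. Qed.

Lemma sabsV a : a != 0 -> sabs a^-1 = (sabs a)^-1.
Proof.
move=> a0; have sa0 : sabs a != 0 by apply: contra_neq a0 => /sabs_eq0.
by apply: (mulfI sa0); rewrite -sabsM !divff// sabs1.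
Qed.

Definition sre : scalar R k -> R :=
  match k with
  | real_scalars => fun a : R => a
  | complex_scalars => fun a : R[i] => complex.Re a
  end.

Definition sim : scalar R k -> R :=
  match k with
  | real_scalars => fun a : R => 0
  | complex_scalars => fun a : R[i] => complex.Im a
  end.

Definition smk : R -> R -> scalar R k :=
  match k with
  | real_scalars => fun u v => u
  | complex_scalars => fun u v => (u +i* v)%C
  end.

Lemma sreD a b : sre (a + b) = sre a + sre b.
Proof. by rewrite /sre; case: k a b => //= -[? ?] [? ?]. Qed.

Lemma simD a b : sim (a + b) = sim a + sim b.
Proof. by rewrite /sim; case: k a b => /= [? ?|[? ?] [? ?]//]; rewrite addr0. Qed.

Lemma sreN a : sre (- a) = - sre a.
Proof. by rewrite /sre; case: k a => //= -[? ?]. Qed.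

Lemma simN a : sim (- a) = - sim a.
Proof. by rewrite /sim; case: k a => /= [?|[? ?]//]; rewrite oppr0. Qed.

Lemma sre0 : sre 0 = 0. Proof. by rewrite /sre; case: k. Qed.
Lemma sim0 : sim 0 = 0. Proof. by rewrite /sim; case: k. Qed.

Lemma sre_sum (I : Type) (s : seq I) (F : I -> scalar R k) :
  sre (\sum_(i <- s) F i) = \sum_(i <- s) sre (F i).
Proof. by elim/big_rec2 : _ => [|i y z _ <-]; rewrite ?sre0 ?sreD. Qed.

Lemma sim_sum (I : Type) (s : seq I) (F : I -> scalar R k) :
  sim (\sum_(i <- s) F i) = \sum_(i <- s) sim (F i).
Proof. by elim/big_rec2 : _ => [|i y z _ <-]; rewrite ?sim0 ?simD. Qed.

Lemma sreM r a : sre (rscal r * a) = r * sre a.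
Proof.
by rewrite /sre /rscal; case: k a => //= -[u v] /=; rewrite mul0r subr0.
Qed.

Lemma simM r a : sim (rscal r * a) = r * sim a.
Proof.
rewrite /sim /rscal; case: k a => /= [?|[u v] /=]; first by rewrite mulr0.
by rewrite mul0r addr0.
Qed.

Lemma sre_le a : `|sre a| <= sabs a.
Proof.
rewrite /sre; case: k a => //= -[u v] /=.
by rewrite -sqrtr_sqr ler_wsqrtr// lerDl sqr_ge0.
Qed.

Lemma sim_le a : `|sim a| <= sabs a.
Proof.
rewrite /sim; case: k a => /= [a|[u v] /=]; first by rewrite normr0.
by rewrite -sqrtr_sqr ler_wsqrtr// lerDr sqr_ge0.
Qed.

Lemma sabs_le_smk a u v : sabs (a - smk u v) <= `|sre a - u| + `|sim a - v|.
Proof.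
rewrite /sre /sim /smk; case: k a => /= [a|[a b] /=]; first by rewrite lerDl.
exact: sqrtr_le_normD.
Qed.

End Scalars.
Arguments rscal {R k}.
Arguments smk {R k}.

Lemma real_disc_net (R : realType) (eta : R) : 0 < eta ->
  exists G : seq R, forall a, `|a| <= 1 -> exists2 g, g \in G & `|a - g| <= eta.
Proof.
move=> eta0; pose n := (Num.truncn (2 / eta)).
exists [seq i%:R * eta - 1 | i <- iota 0 n.+1] => a; rewrite ler_norml => /andP[a1 a2].
have a0 : 0 <= (a + 1) / eta by rewrite divr_ge0 ?(ltW eta0)//; lra.
have /andP[i1 i2] := truncn_itv a0; set i := Num.truncn _ in i1 i2.
exists (i%:R * eta - 1).
  apply/mapP; exists i => //; rewrite mem_iota/= add0n ltnS truncn_ge_nat ?divr_ge0 ?(ltW eta0)//.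
  by apply: le_trans i1 _; rewrite ler_pM2r ?invr_gt0//; lra.
move: i1 i2; rewrite ler_pdivlMr// ltr_pdivrMr// -natr1 mulrDl mul1r => i1 i2.
by rewrite ler_norml; apply/andP; split; lra.
Qed.

Section ScalarNet.
Context {R : realType} {k : scalar_kind}.

Lemma disc_net (eta : R) : 0 < eta -> exists G : seq (scalar R k),
  forall a, sabs a <= 1 -> exists2 g, g \in G & sabs (a - g) <= eta.
Proof.
move=> eta0; have [|G GP] := @real_disc_net R (eta / 2); first by rewrite divr_gt0.
exists [seq smk u v | u <- G, v <- G] => a a1.
have [u uG ua] := GP _ (le_trans (sre_le a) a1).
have [v vG va] := GP _ (le_trans (sim_le a) a1).
exists (smk u v); first exact: allpairs_f.
by apply: le_trans (sabs_le_smk _ _ _) _; rewrite [leRHS]splitr lerD.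
Qed.

Lemma real_cauchy (u : nat -> R) :
  (forall e, 0 < e -> exists N, forall m n, (N <= m)%N -> (N <= n)%N -> `|u m - u n| <= e) ->
  exists l, forall e, 0 < e -> exists N, forall n, (N <= n)%N -> `|u n - l| <= e.
Proof.
move=> uC; have : cvgn u.
  apply/cauchy_cvgP/cauchy_exP => e e0; have [|N NP] := uC (e / 2); first exact: divr_gt0.
  exists (u N); exists N => // n Nn; apply: le_lt_trans (NP N n (leqnn _) Nn) _.
  by rewrite ltr_pdivrMr// ltr_pMr// ltr1n.
move=> /cvgrPdist_le ul; exists (limn u) => e e0; have [N _ NP] := ul e e0.
by exists N => n Nn; rewrite distrC; exact: NP.
Qed.

Lemma scalar_cauchy (u : nat -> scalar R k) :
  (forall e, 0 < e -> exists N, forall m n, (N <= m)%N -> (N <= n)%N ->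
    sabs (u m - u n) <= e) ->
  exists l, forall e, 0 < e -> exists N, forall n, (N <= n)%N -> sabs (u n - l) <= e.
Proof.
move=> uC.
have [|x xP] := @real_cauchy (fun n => sre (u n)).
  move=> e /uC[N NP]; exists N => m n Nm Nn; apply: le_trans (NP m n Nm Nn).
  by rewrite -sreN -sreD sre_le.
have [|y yP] := @real_cauchy (fun n => sim (u n)).
  move=> e /uC[N NP]; exists N => m n Nm Nn; apply: le_trans (NP m n Nm Nn).
  by rewrite -simN -simD sim_le.
exists (smk x y) => e e0.
have [|N1 N1P] := xP (e / 2); first by rewrite divr_gt0.
have [|N2 N2P] := yP (e / 2); first by rewrite divr_gt0.
exists (maxn N1 N2) => n; rewrite geq_max => /andP[n1 n2].
by apply: le_trans (sabs_le_smk _ _ _) _; rewrite [leRHS]splitr lerD ?N1P ?N2P.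
Qed.

End ScalarNet.

(** * Quasi-normed spaces and Neumann series *)

Section QuasiNorm.
Context {R : realType} {k : scalar_kind}.
Implicit Types (V W : quasiNormedType R k).

Definition kap V : R := s2val (cid2 (@qnormD R k V)).

Lemma kap_ge1 V : 1 <= kap V.
Proof. by rewrite /kap; case: cid2. Qed.

Lemma kap_gt0 V : 0 < kap V.
Proof. exact: lt_le_trans ltr01 (kap_ge1 V). Qed.

Lemma kap_ge0 V : 0 <= kap V.
Proof. exact: ltW (kap_gt0 V). Qed.

Lemma qnormDk V (x y : V) : qnorm (x + y) <= kap V * (qnorm x + qnorm y).
Proof. by rewrite /kap; case: cid2. Qed.

Lemma half_kap V (e : R) : kap V * (e / (kap V * 2) + e / (kap V * 2)) = e.
Proof.
by have := lt0r_neq0 (kap_gt0 V); set c := kap V => c0; field.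
Qed.

Lemma qnorm00 V : qnorm (0 : V) = 0.
Proof. by rewrite -(scale0r (0 : V)) qnormZ sabs0 mul0r. Qed.

Lemma qnormN V (x : V) : qnorm (- x) = qnorm x.
Proof. by rewrite -scaleN1r qnormZ sabsN1 mul1r. Qed.

Lemma qnormC V (x y : V) : qnorm (x - y) = qnorm (y - x).
Proof. by rewrite -qnormN opprB. Qed.

Lemma qnormBk V (x y : V) : qnorm (x - y) <= kap V * (qnorm x + qnorm y).
Proof. by rewrite -(qnormN y); exact: qnormDk. Qed.

Lemma qnorm_tri V (z x y : V) : qnorm (x - y) <= kap V * (qnorm (x - z) + qnorm (z - y)).
Proof. by rewrite -(subrKA z); exact: qnormDk. Qed.

Lemma qnorm_le0 V (x : V) : (forall e, 0 < e -> qnorm x <= e) -> x = 0.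
Proof.
move=> xe; apply: qnorm0_eq0; apply/eqP; rewrite eq_le qnorm_ge0 andbT.
by apply/ler_addgt0Pr => e e0; rewrite add0r xe.
Qed.

(** Splitting off the first term at each step charges the i-th term with the power [i.+1] of
    [kap V]. Terms decaying with ratio at most 1/(2 [kap V]) thus remain summable, however many
    there are. *)
Lemma qnorm_sum_geo V (f : nat -> V) n :
  qnorm (\sum_(i < n) f i) <= \sum_(i < n) kap V ^+ i.+1 * qnorm (f i).
Proof.
elim: n f => [|n IH] f; first by rewrite !big_ord0 qnorm00.
rewrite !big_ord_recl expr1 (le_trans (qnormDk _ _))// mulrDr lerD2l.
rewrite (le_trans (ler_wpM2l (kap_ge0 V) (IH (fun i => f i.+1))))// mulr_sumr.
by apply: ler_sum => i _; rewrite mulrA -exprS.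
Qed.

Lemma qnorm_sum_seq V (I : Type) (s : seq I) (P : pred I) (f : I -> V) :
  qnorm (\sum_(i <- s | P i) f i) <= kap V ^+ size s * \sum_(i <- s | P i) qnorm (f i).
Proof.
elim: s => [|i s IH]; first by rewrite !big_nil qnorm00 mulr0.
have S0 : 0 <= \sum_(j <- s | P j) qnorm (f j) by apply: sumr_ge0 => j _; exact: qnorm_ge0.
have k1 := kap_ge1 V; have k0 := kap_ge0 V.
rewrite !big_cons; case: ifP => _ /=; last first.
  apply: le_trans IH _; rewrite exprS -mulrA ler_peMl// mulr_ge0// exprn_ge0//.
rewrite (le_trans (qnormDk _ _))// exprS -mulrA ler_wpM2l// mulrDr lerD//.
by rewrite ler_peMl ?qnorm_ge0// exprn_ege1.
Qed.

Lemma qnorm_sum_le V (I : Type) (s : seq I) (P : pred I) (f : I -> V) (c : R) :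
  0 <= c -> (forall i, P i -> qnorm (f i) <= c) ->
  qnorm (\sum_(i <- s | P i) f i) <= kap V ^+ size s * (size s)%:R * c.
Proof.
move=> c0 fc; apply: le_trans (qnorm_sum_seq _ _ _) _.
rewrite -mulrA ler_wpM2l ?exprn_ge0 ?kap_ge0//.
elim: s => [|i s IH]; first by rewrite big_nil mul0r.
rewrite big_cons /= -natr1 mulrDl mul1r [leRHS]addrC; case: ifP => Pi; first by rewrite lerD// fc.
by rewrite (le_trans IH)// lerDr.
Qed.

Definition qcvg V (u : nat -> V) (l : V) :=
  forall e, 0 < e -> exists N, forall n, (N <= n)%N -> qnorm (u n - l) <= e.

Definition qcauchy V (u : nat -> V) :=
  forall e, 0 < e -> exists N, forall m n, (N <= m)%N -> (N <= n)%N -> qnorm (u m - u n) <= e.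

Definition qcomplete V := forall u : nat -> V, qcauchy u -> exists l, qcvg u l.

Lemma qcvg_unique V (u : nat -> V) l l' : qcvg u l -> qcvg u l' -> l = l'.
Proof.
move=> ul ul'; apply/subr0_eq/qnorm_le0 => e e0.
have k0 := kap_gt0 V; have ek : 0 < e / (kap V * 2) by rewrite divr_gt0 ?mulr_gt0.
have [N NP] := ul _ ek; have [N' NP'] := ul' _ ek.
have n1 := NP _ (leq_maxl N N'); have n2 := NP' _ (leq_maxr N N').
apply: le_trans (qnorm_tri (u (maxn N N')) _ _) _; rewrite qnormC.
apply: le_trans (ler_wpM2l (ltW k0) (lerD n1 n2)) _.
by rewrite half_kap.
Qed.

Lemma qcvg_cst V (l : V) : qcvg (fun=> l) l.
Proof. by move=> e e0; exists 0%N => n _; rewrite subrr qnorm00 ltW. Qed.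

Lemma qcvg_ext V (u v : nat -> V) l : (forall n, u n = v n) -> qcvg u l -> qcvg v l.
Proof. by move=> /funext->. Qed.

Lemma qcvgD V (u v : nat -> V) l m : qcvg u l -> qcvg v m -> qcvg (fun n => u n + v n) (l + m).
Proof.
move=> ul vm e e0; have k0 := kap_gt0 V.
have ek : 0 < e / (kap V * 2) by rewrite divr_gt0 ?mulr_gt0.
have [N NP] := ul _ ek; have [N' NP'] := vm _ ek.
exists (maxn N N') => n; rewrite geq_max => /andP[/NP n1 /NP' n2].
rewrite opprD addrACA (le_trans (qnormDk _ _))// (le_trans (ler_wpM2l (ltW k0) (lerD n1 n2)))//.
by rewrite half_kap.
Qed.

(** A quasi-norm need not be continuous: a bound on the terms passes to the limit only with an extra
    factor [kap V]. *)
Lemma qcvg_le V (u : nat -> V) l c :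
  (forall n, qnorm (u n) <= c) -> qcvg u l -> qnorm l <= kap V * c.
Proof.
move=> uc ul; apply/ler_addgt0Pr => e e0; have k0 := kap_gt0 V.
have [N NP] := ul (e / kap V) (divr_gt0 e0 k0).
rewrite -[l](subrK (u N)) addrC (le_trans (qnormDk _ _))//.
rewrite -[in leRHS](divfK (lt0r_neq0 k0) e) [_ * kap V]mulrC -mulrDr ler_wpM2l ?(ltW k0)//.
by rewrite lerD// qnormC; exact: NP.
Qed.

Lemma qcvg_cauchy V (u : nat -> V) l : qcvg u l -> qcauchy u.
Proof.
move=> ul e e0; have k0 := kap_gt0 V.
have ek : 0 < e / (kap V * 2) by rewrite divr_gt0 ?mulr_gt0.
have [N NP] := ul _ ek; exists N => m n /NP n1 /NP; rewrite qnormC => n2.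
apply: le_trans (qnorm_tri l _ _) _; apply: le_trans (ler_wpM2l (ltW k0) (lerD n1 n2)) _.
by rewrite half_kap.
Qed.

End QuasiNorm.

Section LinearMaps.
Context {R : realType} {k : scalar_kind} {V W : quasiNormedType R k} (T : V -> W).
Hypothesis lT : linear T.

Lemma lin_D u v : T (u + v) = T u + T v.
Proof. by rewrite -(scale1r u) lT !scale1r. Qed.

Lemma lin_0 : T 0 = 0.
Proof. by apply: (addrI (T 0)); rewrite -lin_D !addr0. Qed.

Lemma lin_Z a u : T (a *: u) = a *: T u.
Proof. by rewrite -[a *: u]addr0 lT lin_0 addr0. Qed.

Lemma lin_N u : T (- u) = - T u.
Proof. by rewrite -scaleN1r lin_Z scaleN1r. Qed.

Lemma lin_B u v : T (u - v) = T u - T v.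
Proof. by rewrite lin_D lin_N. Qed.

Lemma lin_sum (I : Type) (s : seq I) (P : pred I) (f : I -> V) :
  T (\sum_(i <- s | P i) f i) = \sum_(i <- s | P i) T (f i).
Proof.
by elim/big_rec2 : _ => [|i y z _ <-]; rewrite ?lin_0 ?lin_D.
Qed.

Lemma qcvg_lin K (u : nat -> V) l : (forall v, qnorm (T v) <= K * qnorm v) ->
  qcvg u l -> qcvg (fun n => T (u n)) (T l).
Proof.
move=> TK ul e e0; have K1 : 0 < Num.max K 1 by rewrite lt_max ltr01 orbT.
have [N NP] := ul (e / Num.max K 1) (divr_gt0 e0 K1).
exists N => n /NP un; rewrite -lin_B (le_trans (TK _))//.
apply: (@le_trans _ _ (Num.max K 1 * qnorm (u n - l))).
  by rewrite ler_wpM2r ?qnorm_ge0// le_max lexx.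
by rewrite mulrC -ler_pdivlMr.
Qed.

End LinearMaps.

Section Neumann.
Context {R : realType} {k : scalar_kind} {V : quasiNormedType R k}.
Hypothesis cV : qcomplete V.

Lemma sum_half_le (n : nat) : \sum_(i < n) (2^-1 : R) ^+ i <= 2.
Proof.
suff: \sum_(i < n) (2^-1 : R) ^+ i = 2 - 2 * 2^-1 ^+ n.
  by move=> ->; rewrite gerBl mulr_ge0// exprn_ge0.
elim: n => [|n IH]; first by rewrite big_ord0 expr0 mulr1 subrr.
rewrite big_ord_recr /= IH exprS; lra.
Qed.

Lemma qnorm_geo (f : nat -> V) (C t : R) n : 0 <= C -> 0 <= t -> kap V * t <= 2^-1 ->
  (forall i, qnorm (f i) <= C * t ^+ i) -> qnorm (\sum_(i < n) f i) <= 2 * kap V * C.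
Proof.
move=> C0 t0 kt fC; have k0 := kap_ge0 V.
apply: le_trans (qnorm_sum_geo _ _) _.
apply: (@le_trans _ _ (\sum_(i < n) kap V * C * (2^-1) ^+ i)).
  apply: ler_sum => i _; apply: le_trans (ler_wpM2l (exprn_ge0 _ k0) (fC i)) _.
  rewrite exprS mulrCA -!mulrA mulrCA ler_wpM2l// ler_wpM2l//.
  by rewrite -exprMn lerXn2r ?nnegrE ?mulr_ge0.
rewrite -mulr_sumr -[2 * _ * C]mulrA [leRHS]mulrC ler_wpM2l ?mulr_ge0//.
exact: sum_half_le.
Qed.

(** In the tail estimate, one factor [kap V] comes from [qnorm_geo] and the other from passing to
    the limit. *)
Lemma qcvg_geo (f : nat -> V) (C t : R) : 0 <= C -> 0 <= t -> kap V * t <= 2^-1 ->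
  (forall i, qnorm (f i) <= C * t ^+ i) ->
  exists2 l, qcvg (fun n => \sum_(i < n) f i) l &
    forall n, qnorm (\sum_(i < n) f i - l) <= 2 * kap V ^+ 2 * C * t ^+ n.
Proof.
move=> C0 t0 kt fC; have k0 := kap_gt0 V; have k1 := kap_ge1 V.
have t1 : t <= 2^-1.
  by apply: le_trans kt; rewrite ler_peMl.
have tail n m : qnorm (\sum_(i < n + m) f i - \sum_(i < n) f i) <= 2 * kap V * C * t ^+ n.
  rewrite -(big_mkord xpredT) /index_iota (big_cat_nat _ (leq_addr m n))//= big_mkord addrAC subrr add0r.
  rewrite -{1}[n]add0n big_addn addKn big_mkord -[leRHS]mulrA.
  apply: (@qnorm_geo (fun i => f (i + n)%N) (C * t ^+ n) t) => //; first by rewrite mulr_ge0 ?exprn_ge0.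
  by move=> i; rewrite -mulrA -exprD addnC.
have small e : 0 < e -> exists N, forall n, (N <= n)%N -> 2 * kap V * C * t ^+ n <= e.
  move=> e0; have : (2 * kap V * C * 2^-1 ^+ n) @[n --> \oo] --> (2 * kap V * C * 0 : R).
    apply: cvgMr; apply: cvg_expr; rewrite ger0_norm ?invr_ge0//.
    by rewrite invf_lt1 ?ltr1n.
  rewrite mulr0 => /cvgrPdist_le/(_ e e0)[N _ NP]; exists N => n /NP.
  rewrite sub0r normrN ger0_norm; last by rewrite !mulr_ge0 ?exprn_ge0 ?invr_ge0 ?(ltW k0).
  apply: le_trans; rewrite ler_wpM2l ?mulr_ge0 ?(ltW k0)//.
  by rewrite lerXn2r ?nnegrE ?invr_ge0.
have qc : qcauchy (fun n => \sum_(i < n) f i).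
  move=> e e0; have [|N NP] := small (e / (kap V * 2)); first by rewrite divr_gt0 ?mulr_gt0.
  exists N => m n Nm Nn; apply: le_trans (qnorm_tri (\sum_(i < N) f i) _ _) _.
  have m1 := tail N (m - N)%N; have n1 := tail N (n - N)%N.
  rewrite subnKC// in m1; rewrite subnKC// qnormC in n1.
  have m2 := le_trans m1 (NP N (leqnn _)); have n2 := le_trans n1 (NP N (leqnn _)).
  by apply: le_trans (ler_wpM2l (ltW k0) (lerD m2 n2)) _; rewrite half_kap.
have [l lP] := cV qc.
exists l => // n.
have -> : \sum_(i < n) f i - l = - (l - \sum_(i < n) f i) by rewrite opprB.
rewrite qnormN.
have : qcvg (fun m => \sum_(i < n + m) f i - \sum_(i < n) f i) (l - \sum_(i < n) f i).
  apply: qcvgD; last exact: qcvg_cst.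
  move=> e /lP[N NP]; exists N => m Nm; apply: NP; exact: leq_trans Nm (leq_addl _ _).
move=> /(qcvg_le (tail n))/le_trans; apply.
by rewrite expr2 !mulrA [kap V * 2]mulrC.
Qed.

(** The assumption [kap V * t <= 2^-1] stands in for t < 1 and pays for the growing constants of
    [qnorm_sum_geo]. Only a left inverse of 1 - U is recorded: it is what recovering a vector from
    its image requires. *)
Lemma neumann (U : V -> V) (t : R) : linear U -> 0 <= t -> kap V * t <= 2^-1 ->
  (forall f, qnorm (U f) <= t * qnorm f) ->
  exists S : V -> V, [/\ linear S, forall f, qnorm (S f) <= 2 * kap V ^+ 2 * qnorm f &
    forall f, S (f - U f) = f].
Proof.
move=> lU t0 kt Ut.
have lUi i : linear (iter i U).
  by elim: i => //= i IH a u v /=; rewrite IH lU.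
have Ui f i : qnorm (iter i U f) <= qnorm f * t ^+ i.
  elim: i => [|i IH]; first by rewrite expr0 mulr1.
  by rewrite /= (le_trans (Ut _))// exprS mulrCA ler_wpM2l.
have /choice[S SP] : forall f, exists l, qcvg (fun n => \sum_(i < n) iter i U f) l /\
    qnorm l <= 2 * kap V ^+ 2 * qnorm f.
  move=> f; have [l lP l0] := qcvg_geo (qnorm_ge0 f) t0 kt (Ui f).
  by exists l; split => //; have := l0 0%N; rewrite big_ord0 sub0r qnormN expr0 mulr1.
exists S; split => [a u v|f|f]; last 2 first.
- exact: (SP f).2.
- apply: qcvg_unique (SP _).1 _.
  apply: (@qcvg_ext _ _ _ (fun n => f - iter n U f)).
    move=> n; elim: n => [|n IH]; first by rewrite big_ord0 subrr.
    by rewrite big_ord_recr /= -IH (lin_B (lUi n)) -iterSr addrA subrK.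
  rewrite -[X in qcvg _ X]subr0; apply: qcvgD; first exact: qcvg_cst.
  have [l lP _] := qcvg_geo (qnorm_ge0 f) t0 kt (Ui f).
  move=> e /(qcvg_cauchy lP)[N NP]; exists N => n Nn.
  have := NP n.+1 n (leqW Nn) Nn; rewrite big_ord_recr/= addrAC subrr add0r.
  by rewrite oppr0 subr0 qnormN.
- apply: qcvg_unique (SP _).1 _.
  apply: (@qcvg_ext _ _ _ (fun n => a *: (\sum_(i < n) iter i U u) + \sum_(i < n) iter i U v)).
    by move=> n; rewrite scaler_sumr -big_split; apply: eq_bigr => i _; rewrite lUi.
  apply: qcvgD (SP _).1; apply: (@qcvg_lin _ _ _ _ ( *:%R a) _ (sabs a)) (SP _).1.
    by move=> b x y; rewrite scalerDr !scalerA mulrC.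
  by move=> x; rewrite qnormZ.
Qed.

End Neumann.

(** * Unconditional sums *)

Local Notation cpickle := choice.pickle.

Section NetSums.
Context {R : realType} {k : scalar_kind} {V : quasiNormedType R k}.
Implicit Types (u : nat -> V) (f : V).

(* Convergence along finite index sets, equivalent to convergence for all orderings;
   a family indexed by a countType is spread over nat through pickle, with zeros at
   the unused indices. *)
Definition usum u f := forall e : R, 0 < e -> exists N, forall (P : pred nat) M,
  (forall i, (i < N)%N -> P i) -> (N <= M)%N -> qnorm (\sum_(i < M | P i) u i - f) <= e.

Definition spread (T : Type) (J : countType) (z : T) (u : J -> T) (i : nat) : T :=
  oapp u z (pickle_inv i).

Lemma sum_spread (J : countType) (u : J -> V) (s : seq J) (P : pred nat) M :
  uniq s -> (forall j, j \in s -> (cpickle j < M)%N) ->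
  (forall j, (cpickle j < M)%N -> P (cpickle j) = (j \in s)) ->
  \sum_(i < M | P i) spread 0 u i = \sum_(j <- s) u j.
Proof.
move=> us sM Ps; rewrite -(big_mkord P) -big_filter.
rewrite -big_pmap; apply: perm_big; apply: uniq_perm => //.
  apply: (pmap_uniq (@pickle_invK J)); apply: filter_uniq; exact: iota_uniq.
move=> j; rewrite mem_pmap; apply/mapP/idP => [[i +]|js].
  rewrite mem_filter mem_index_iota /= => /andP[Pi iM] /esym ij.
  have ip : cpickle j = i by have := @pickle_invK J i; rewrite ij.
  by rewrite -Ps ip.
exists (cpickle j); last by rewrite pickleK_inv.
by rewrite mem_filter mem_index_iota /= sM// Ps ?sM// js.
Qed.

Lemma cvg_qcvg (u : nat -> V) f : u @ \oo --> f <-> qcvg u f.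
Proof.
split=> [uf e e0|uf B].
  have /uf[N _ NP] : nbhs f [set y | qnorm (f - y) < e] by rewrite nbhs_qnorm; exists e.
  by exists N => n /NP /= ?; rewrite qnormC ltW.
rewrite nbhs_qnorm => -[e /= e0 eB].
have [|N NP] := uf (e / 2); first exact: divr_gt0.
exists N => // n /= /NP un; apply: eB => /=; rewrite qnormC (le_lt_trans un)//.
by rewrite ltr_pdivrMr// ltr_pMr// ltr1n.
Qed.

Lemma usum_unconditional (J : countType) (u : J -> V) f :
  usum (spread 0 u) f -> unconditional_sum u f.
Proof.
move=> uf e [e1 e2]; apply/cvg_qcvg => r /uf[N NP].
have /choice[g gP] : forall j, exists n, e n = Some j /\ forall m, e m = Some j -> n = m.
  by move=> j; have [n [? ?]] := e1 j; exists n.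
have eK : ocancel e g.
  by move=> n; case en : (e n) => [j|//] /=; exact: (gP j).2.
pose h i := oapp g 0%N (pickle_inv i : option J).
exists (\max_(i < N) (h i).+1) => m hm.
pose s := pmap e (index_iota 0 m).
have us : uniq s by rewrite (pmap_uniq eK)// iota_uniq.
pose M := maxn N (\max_(j <- s) (cpickle j).+1).
have sM j : j \in s -> (cpickle j < M)%N.
  by move=> js; rewrite leq_max; apply/orP; right; exact: (@leq_bigmax_seq _ _ xpredT (fun j : J => (cpickle j).+1)).
pose P i := (i < N)%N || oapp (mem s) false (pickle_inv i : option J).
have Ps j : (cpickle j < M)%N -> P (cpickle j) = (j \in s).
  move=> _; rewrite /P pickleK_inv /=; case: ltnP => //= jN; apply/esym.
  rewrite mem_pmap; apply/mapP; exists (g j); last by rewrite (gP j).1.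
  rewrite mem_index_iota /=; apply: leq_trans hm.
  have := @leq_bigmax _ (fun i : 'I_N => (h i).+1) (Ordinal jN).
  by rewrite /h /= pickleK_inv.
have := NP P M _ (leq_maxl _ _); rewrite (sum_spread u us sM Ps) /s big_pmap.
rewrite big_mkord; apply.
by move=> i iN; rewrite /P iN.
Qed.

(* A net of finite sums failing to converge yields finite sets with bad sums, and
   an ordering whose partial sums run through them. *)
Lemma unconditional_usum (J : countType) (u : J -> V) f :
  unconditional_sum u f -> usum (spread 0 u) f.
Proof.
move=> uf; apply: contrapT => /existsNP[r /not_implyP[r0 /forallNP bad]].
have /choice[G GP] : forall N, exists PM : (pred nat) * nat,
    [/\ (forall i, (i < N)%N -> PM.1 i), (N <= PM.2)%N &
     r < qnorm (\sum_(i < PM.2 | PM.1 i) spread 0 u i - f)].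
  move=> N; have /existsNP[P /existsNP[M /not_implyP[PN /not_implyP[NM /negP]]]] := bad N.
  by rewrite -ltNge => ?; exists (P, M).
pose real i := isSome (pickle_inv i : option J).
(* A state is the list of the indices enumerated so far, with a bound above them. The next bad set
   contains everything below that bound, so the extended list enumerates exactly its real indices
   ([LSE]). *)
pose new (st : seq nat * nat) :=
  [seq i <- index_iota 0 (G st.2).2 | [&& (G st.2).1 i, real i & i \notin st.1]].
pose st n := iter n (fun st => (st.1 ++ new st, maxn st.2.+1 (G st.2).2)) ([::] : seq nat, 0%N).
pose L n := (st n).1; pose B n := (st n).2.
have LS n : L n.+1 = L n ++ [seq i <- index_iota 0 (G (B n)).2 |
    [&& (G (B n)).1 i, real i & i \notin L n]] by [].
have BS n : B n.+1 = maxn (B n).+1 (G (B n)).2 by [].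
have L0 : L 0%N = [::] by [].
clearbody L B; clear st new.
have Bge n : (n <= B n)%N.
  by elim: n => // n IH; rewrite BS leq_max ltnS IH.
have LB n i : i \in L n -> (i < B n)%N.
  elim: n i => [|n IH] i; [by rewrite L0|rewrite LS BS mem_cat => /orP[/IH iB|]].
    by rewrite leq_max ltnS ltnW.
  by rewrite mem_filter mem_index_iota => /andP[_ /andP[_ iM]]; rewrite leq_max iM orbT.
have Lreal n i : i \in L n -> real i.
  elim: n i => [|n IH] i; [by rewrite L0|rewrite LS mem_cat => /orP[/IH//|]].
  by rewrite mem_filter => /andP[/and3P[]].
have Luniq n : uniq (L n).
  elim: n => [|n IH]; [by rewrite L0|rewrite LS cat_uniq IH filter_uniq ?iota_uniq// andbT].
  by apply/hasPn => i; rewrite mem_filter => /andP[/and3P[]].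
have LSE n i : (i \in L n.+1) = [&& (G (B n)).1 i, real i & (i < (G (B n)).2)%N].
  have [G1 G2 _] := GP (B n).
  rewrite LS mem_cat mem_filter mem_index_iota /=.
  have [iL|iL] /= := boolP (i \in L n); last by rewrite andbT andbA.
  by rewrite (Lreal _ _ iL) (G1 _ (LB _ _ iL)) (leq_trans (LB _ _ iL) G2).
have Lpre n m : (n <= m)%N -> exists t, L m = L n ++ t.
  elim: m => [|m IH]; first by rewrite leqn0 => /eqP->; exists [::]; rewrite cats0.
  rewrite leq_eqVlt => /predU1P[->|/IH[t Lt]]; first by exists [::]; rewrite cats0.
  by rewrite LS Lt -catA; eexists.
(* If J is finite the lists stop growing; positions that no list reaches receive [None], as the
   padding in [ordering] demands. *)
pose inL n := `[< exists q, (n < size (L q))%N >].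
have /choice[K KP] : forall n, exists q, inL n -> (n < size (L q))%N.
  by move=> n; have [/asboolP[q nk]|_] := boolP (inL n); [exists q|exists 0%N].
pose e n : option J := if inL n then pickle_inv (nth 0%N (L (K n)) n) else None.
have nthL q l n : (n < size (L q))%N -> (n < size (L l))%N -> nth 0%N (L q) n = nth 0%N (L l) n.
  move=> nk nl; have [kl|/ltnW lk] := leqP q l.
    by have [t ->] := Lpre _ _ kl; rewrite nth_cat nk.
  by have [t ->] := Lpre _ _ lk; rewrite nth_cat nl.
have eE q n : (n < size (L q))%N -> e n = pickle_inv (nth 0%N (L q) n).
  move=> nk; have nI : inL n by apply/asboolP; exists q.
  by rewrite /e nI (nthL _ q) // KP.
have oe : ordering e.
  split=> [j|n].
    have jL : cpickle j \in L (cpickle j).+2.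
      have [G1 G2 _] := GP (B (cpickle j).+1).
      have jB := Bge (cpickle j).+1.
      by rewrite LSE G1 // /real pickleK_inv (leq_trans jB).
    exists (index (cpickle j) (L (cpickle j).+2)); split.
      by rewrite (eE (cpickle j).+2) ?index_mem// nth_index// pickleK_inv.
    move=> n en; have nI : inL n by move: en; rewrite /e; case: (inL n).
    have nK := KP n nI; have := eE _ _ nK; rewrite en => /esym ij.
    have ip : cpickle j = nth 0%N (L (K n)) n.
      by have := @pickle_invK J (nth 0%N (L (K n)) n); rewrite ij.
    have jK : cpickle j \in L (maxn (K n) (cpickle j).+2).
      by have [t ->] := Lpre _ _ (leq_maxr (K n) (cpickle j).+2); rewrite mem_cat jL.
    have [t Lt] := Lpre _ _ (leq_maxl (K n) (cpickle j).+2).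
    have [t' Lt'] := Lpre _ _ (leq_maxr (K n) (cpickle j).+2).
    have -> : index (cpickle j) (L (cpickle j).+2) = index (cpickle j) (L (maxn (K n) (cpickle j).+2)).
      by rewrite Lt' index_cat jL.
    by rewrite Lt ip index_cat mem_nth// index_uniq.
  move=> en; apply: contrapT => eS.
  have SI : inL n.+1 by move: eS; rewrite /e; case: (inL n.+1).
  have nK := ltnW (KP _ SI); have := Lreal _ _ (mem_nth 0%N nK).
  by rewrite /real -(eE _ _ nK) en.
have sumL q m : m = size (L q.+1) -> \sum_(n < m) oapp u 0 (e n) =
    \sum_(i < (G (B q)).2 | (G (B q)).1 i) spread 0 u i.
  move=> ->; transitivity (\sum_(n < size (L q.+1)) spread 0 u (nth 0%N (L q.+1) n)).
    by apply: eq_bigr => n _; rewrite (eE q.+1).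
  have -> : \sum_(n < size (L q.+1)) spread 0 u (nth 0%N (L q.+1) n) = \sum_(i <- L q.+1) spread 0 u i.
    by rewrite [RHS](big_nth 0%N) big_mkord.
  rewrite -(big_mkord (G (B q)).1) -big_filter.
  rewrite [RHS](bigID real)/= [X in _ = _ + X]big1 ?addr0; last first.
    by move=> i; rewrite /real /spread; case: pickle_inv.
  rewrite -[RHS]big_filter; apply: perm_big; apply: uniq_perm => //.
    by rewrite !filter_uniq// iota_uniq.
  by move=> i; rewrite LSE !mem_filter mem_index_iota /= andbCA.
have /cvg_qcvg/(_ r r0)[m0 m0P] := uf e oe.
(* A list of length at least [m0] would give a bad partial sum past [m0]. Hence the lengths are
   bounded by [m0]; from the largest length [m] on, [e] is [None], so the sum up to [m0] is still a
   bad one. *)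
have badL q : (m0 <= size (L q.+1))%N -> False.
  move=> /m0P; rewrite (sumL q)//; have [_ _ ] := GP (B q).
  by move=> /lt_le_trans/[apply]; rewrite ltxx.
have bnd : forall m, `[< exists q, size (L q.+1) = m >] -> (m <= m0)%N.
  by move=> m /asboolP[q <-]; rewrite leqNgt; apply/negP => /ltnW/badL.
have ex0 : exists m, `[< exists q, size (L q.+1) = m >].
  by exists (size (L 1)); apply/asboolP; exists 0%N.
have [m /asboolP[q km] mmax] := ex_maxnP ex0 bnd.
have mm0 : (m <= m0)%N by apply: bnd; apply/asboolP; exists q.
have := m0P m0 (leqnn _).
rewrite -(big_mkord xpredT (fun n => oapp u 0 (e n))) (big_cat_nat _ mm0)//= big_mkord (sumL q)//.
rewrite [X in _ + X - _](_ : _ = 0) ?addr0.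
  by have [_ _] := GP (B q); move=> /lt_le_trans/[apply]; rewrite ltxx.
rewrite big_nat_cond big1// => n /andP[/andP[mn _] _]; rewrite /e; case: ifPn => // nI.
have [t Lt] := Lpre _ _ (leqnSn (K n)).
have : (size (L (K n).+1) <= m)%N by apply: mmax; apply/asboolP; exists (K n).
rewrite Lt size_cat => /(leq_trans (leq_addr _ _)) Km.
by have := leq_trans (KP n nI) (leq_trans Km mn); rewrite ltnn.
Qed.

End NetSums.

(** * Uniform boundedness of partial sums *)

Section Baire.
Context {R : realType} {k : scalar_kind} {V : quasiNormedType R k}.
Hypothesis cV : qcomplete V.

Lemma kap_half : kap V * (2 * kap V)^-1 <= 2^-1 :> R.
Proof. by rewrite invfM mulrCA mulfV ?mulr1// gt_eqF// kap_gt0. Qed.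

Lemma telescope_ord (F : nat -> V) n m :
  \sum_(i < m) (F (n + i).+1 - F (n + i)%N) = F (n + m)%N - F n.
Proof.
elim: m => [|m IH]; first by rewrite big_ord0 addn0 subrr.
by rewrite big_ord_recr /= IH addnS addrC addrA subrK.
Qed.

(** Baire category by hand: were every [Z n] nowhere dense, balls with radii shrinking by 1/(2
    [kap V]) would lead to a limit outside all of them. The conclusion says that the closure of some
    [Z n] contains a ball. *)
Lemma qbaire (Z : nat -> set V) : (forall f, exists n, Z n f) ->
  exists n f0 (r : R), 0 < r /\ forall g, qnorm (g - f0) <= r ->
    forall e : R, 0 < e -> exists2 z, Z n z & qnorm (g - z) <= e.
Proof.
have k0 := kap_gt0 V; have k2 : 0 < 2 * kap V by rewrite mulr_gt0.
move=> Zcov; apply: contrapT => nobaire.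
(* The distance kept from the set is exactly the bound [Fln] on how far the limit may drift from the
   new centre. *)
have /choice[G GP] : forall s : nat * (V * R), exists t : V * R, 0 < s.2.2 ->
    [/\ qnorm (t.1 - s.2.1) <= s.2.2, 0 < t.2, t.2 <= s.2.2 * (2 * kap V)^-1 &
     forall z, Z s.1 z -> kap V * (2 * kap V * t.2) < qnorm (t.1 - z)].
  move=> [n [f0 r]] /=; have [r0|r0] := ltP 0 r; last by exists (f0, r).
  have : exists g, qnorm (g - f0) <= r /\ exists2 e : R, 0 < e & forall z, Z n z -> e < qnorm (g - z).
    apply: contrapT => /forallNP H; apply: nobaire; exists n, f0, r; split => // g gr e e0.
    apply: contrapT => Hz; apply: (H g); split => //; exists e => // z Zz.
    by rewrite ltNge; apply/negP => ze; apply: Hz; exists z.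
  move=> [g [gr [e e0 ge]]].
  exists (g, Num.min (r * (2 * kap V)^-1) (e / (kap V * (2 * kap V)))) => _ /=; split => //.
  - by rewrite lt_min !divr_gt0// mulr_gt0.
  - by rewrite ge_min lexx.
  - move=> z /ge; apply: le_lt_trans; rewrite mulrA mulrC -ler_pdivlMr ?mulr_gt0//.
    by rewrite ge_min lexx orbT.
pose st := fix st n := if n is m.+1 then G (m, st m) else (0 : V, 1 : R).
have stS n : st n.+1 = G (n, st n) by [].
pose F n := (st n).1; pose r n := (st n).2.
have r0 n : 0 < r n by elim: n => [|n IH]; rewrite /r//= ; have [] := GP (n, st n) IH.
have rS n m : r (n + m)%N <= r n * (2 * kap V)^-1 ^+ m.
  elim: m => [|m IH]; first by rewrite addn0 expr0 mulr1.
  rewrite addnS; have [_ _ h _] := GP ((n + m)%N, st (n + m)%N) (r0 _); apply: le_trans h _.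
  by rewrite exprSr mulrA /= ler_wpM2r// invr_ge0 ltW.
have Fd n m : qnorm (F (n + m).+1 - F (n + m)%N) <= r n * (2 * kap V)^-1 ^+ m.
  have [h _ _ _] := GP ((n + m)%N, st (n + m)%N) (r0 _); exact: le_trans h (rS n m).
have i0 : 0 <= (2 * kap V)^-1 by rewrite invr_ge0 ltW.
have [l lP _] := qcvg_geo cV (ltW (r0 0%N)) i0 kap_half (Fd 0%N).
have Fl : qcvg F (l + F 0%N).
  apply: qcvg_ext (qcvgD lP (qcvg_cst (F 0%N))) => n.
  by rewrite telescope_ord add0n subrK.
have Fln n : qnorm (F n - (l + F 0%N)) <= kap V * (2 * kap V * r n).
  have : qcvg (fun m => F (n + m)%N - F n) (l + F 0%N - F n).
    apply: qcvgD; last exact: qcvg_cst.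
    by move=> e /Fl[N NP]; exists N => m Nm; apply: NP; exact: leq_trans Nm (leq_addl _ _).
  rewrite qnormC => /qcvg_le; apply => m; rewrite -telescope_ord.
  exact: (@qnorm_geo _ _ _ (fun i => F (n + i).+1 - F (n + i)%N) _ _ _ (ltW (r0 n)) i0 kap_half).
have [n Zn] := Zcov (l + F 0%N).
have [_ _ _ /(_ _ Zn)] := GP (n, st n) (r0 n).
by move=> /lt_le_trans/(_ (Fln n.+1)); rewrite ltxx.
Qed.

End Baire.

Section UniformBoundedness.
Context {R : realType} {k : scalar_kind} {V : quasiNormedType R k}.
Hypothesis cV : qcomplete V.
Variables (x : nat -> V) (real : pred nat).
Hypothesis x0 : forall i, ~~ real i -> x i = 0.
Hypothesis expansion : forall f, exists c : nat -> scalar R k,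
  (forall i, ~~ real i -> c i = 0) /\ usum (fun i => c i *: x i) f.
Hypothesis expansion_unique : forall f (c c' : nat -> scalar R k),
  (forall i, ~~ real i -> c i = 0) -> (forall i, ~~ real i -> c' i = 0) ->
  usum (fun i => c i *: x i) f -> usum (fun i => c' i *: x i) f -> c = c'.

Definition coef (f : V) : nat -> scalar R k := projT1 (cid (expansion f)).

Lemma coef_dummy f i : ~~ real i -> coef f i = 0.
Proof. by rewrite /coef; case: cid => c /= [+ _]; apply. Qed.

Lemma coef_usum f : usum (fun i => coef f i *: x i) f.
Proof. by rewrite /coef; case: cid => c /= []. Qed.

Lemma coefE f (c : nat -> scalar R k) : (forall i, ~~ real i -> c i = 0) ->
  usum (fun i => c i *: x i) f -> coef f = c.
Proof.
by move=> c0 cf; apply: expansion_unique (coef_usum f) cf => // i; exact: coef_dummy.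
Qed.

Lemma usumD (u v : nat -> V) f g : usum u f -> usum v g -> usum (fun i => u i + v i) (f + g).
Proof.
move=> uf vg e e0; have k0 := kap_gt0 V.
have ek : 0 < e / (kap V * 2) by rewrite divr_gt0 ?mulr_gt0.
have [N NP] := uf _ ek; have [N' NP'] := vg _ ek.
exists (maxn N N') => P M PN; rewrite geq_max => /andP[n1 n2].
rewrite big_split/= opprD addrACA (le_trans (qnormDk _ _))// -[leRHS](half_kap V).
rewrite ler_wpM2l ?(ltW k0)// lerD//; [apply: NP|apply: NP'] => // i iN; apply: PN.
  by rewrite leq_max iN.
by rewrite leq_max iN orbT.
Qed.

Lemma usumZ (a : scalar R k) (u : nat -> V) f : usum u f -> usum (fun i => a *: u i) (a *: f).
Proof.
move=> uf e e0; have a1 : 0 < sabs a + 1 by rewrite ltr_wpDl ?sabs_ge0.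
have [N NP] := uf _ (divr_gt0 e0 a1); exists N => P M PN NM.
rewrite -scaler_sumr -scalerBr qnormZ (le_trans (ler_wpM2l (sabs_ge0 a) (NP P M PN NM)))//.
by rewrite mulrA ler_pdivrMr// mulrC ler_wpM2l ?(ltW e0)// lerDl.
Qed.

Lemma coef_lin a f g i : coef (a *: f + g) i = a * coef f i + coef g i.
Proof.
have -> : coef (a *: f + g) = fun i => a * coef f i + coef g i; last by [].
apply: coefE => [j rj|]; first by rewrite !coef_dummy// mulr0 addr0.
have -> : (fun j => (a * coef f j + coef g j) *: x j) =
    fun j => a *: (coef f j *: x j) + coef g j *: x j.
  by apply/funext => j; rewrite scalerDl scalerA.
by apply: usumD; [apply: usumZ|]; exact: coef_usum.
Qed.

Lemma coef_delta i j : real j -> coef (x j) i = (i == j)%:R.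
Proof.
move=> rj; have -> : coef (x j) = fun i => (i == j)%:R; last by [].
apply: coefE => [l rl|].
  by case: eqVneq rl => // ->; rewrite rj.
move=> e e0; exists j.+1 => P M PN jM; rewrite (bigD1 (Ordinal jM)) ?PN//= eqxx scale1r.
rewrite big1 ?addr0 ?subrr ?qnorm00 ?ltW// => l /andP[_ lj].
by rewrite -[_ == j]/(l == Ordinal jM) (negbTE lj) scale0r.
Qed.

Definition psum (P : pred nat) M (f : V) : V := \sum_(i < M | P i) coef f i *: x i.

Lemma psum_lin P M : linear (psum P M).
Proof.
move=> a f g; rewrite /psum scaler_sumr -big_split; apply: eq_bigr => i _.
by rewrite coef_lin scalerDl scalerA.
Qed.

(** A sum containing all indices below [N] is within 1 of [f], and any partial sum is such a sum
    minus a sum over a subset of the first [N] indices; the latter are bounded together. *)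
Lemma psum_bounded f : exists n, forall P M, qnorm (psum P M f) <= n%:R.
Proof.
have k0 := kap_ge0 V; have [N NP] := coef_usum f ltr01.
pose B := kap V ^+ size (index_enum 'I_N) * \sum_(i < N) qnorm (coef f i *: x i).
have B0 : 0 <= B by rewrite mulr_ge0 ?exprn_ge0// sumr_ge0// => i _; exact: qnorm_ge0.
have sN (Q : pred nat) : qnorm (psum Q N f) <= B.
  apply: le_trans (qnorm_sum_seq _ _ _) _; rewrite ler_wpM2l ?exprn_ge0//.
  by rewrite big_mkcond ler_sum// => i _; case: ifP => // _; exact: qnorm_ge0.
have bnd0 : 0 <= kap V * (kap V * (1 + qnorm f) + B).
  by rewrite mulr_ge0// addr_ge0// mulr_ge0// addr_ge0// qnorm_ge0.
exists (Num.bound (kap V * (kap V * (1 + qnorm f) + B))) => P M.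
apply: le_trans (ltW (archi_boundP bnd0)).
(* [P'] adjoins to [P] all indices below [N], and [Q] selects those that were really added. *)
pose P' i := (i < N)%N || (P i && (i < M)%N); pose M' := maxn N M.
pose Q i := ~~ (P i && (i < M)%N).
have -> : psum P M f = psum P' M' f - psum Q N f.
  apply/eqP; rewrite eq_sym subr_eq; apply/eqP.
  rewrite /psum (big_ord_widen_cond _ P (fun i => coef f i *: x i) (leq_maxr N M)).
  rewrite (big_ord_widen_cond _ Q (fun i => coef f i *: x i) (leq_maxl N M)).
  rewrite (bigID (fun i : 'I_M' => P i && (i < M)%N))/=; congr (_ + _); apply: eq_bigl => i.
    by rewrite /P'; case: (P i && _); rewrite ?orbT ?andbF.
  by rewrite /P' /Q; case: (P i && _); rewrite ?orbF ?andbT ?andbF.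
apply: le_trans (qnormBk _ _) _; rewrite ler_wpM2l// lerD//.
rewrite -[psum _ _ _](subrK f) (le_trans (qnormDk _ _))// ler_wpM2l// lerD2r.
by apply: NP; [move=> l lN; rewrite /P' lN|exact: leq_maxl].
Qed.

Let Z n : set V := [set f | forall P M, qnorm (psum P M f) <= n%:R].

(** Differences move the ball given by [qbaire] to the origin, and homogeneity scales it. Continuity
    of [psum] is not yet known, so the bound is only available for approximants [z] of [g]. *)
Lemma approx_bounded : exists2 C : R, 0 <= C & forall g e, 0 < e -> exists2 z,
  qnorm (g - z) <= e & forall P M, qnorm (psum P M z) <= C * qnorm g.
Proof.
have k0 := kap_gt0 V.
have [n [f0 [r [r0 rP]]]] := qbaire cV (psum_bounded : forall f, exists n, Z n f).
have near0 g e : qnorm g <= r -> 0 < e -> exists2 z,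
    qnorm (g - z) <= e & forall P M, qnorm (psum P M z) <= kap V * (n%:R + n%:R).
  move=> gr e0; have ek : 0 < e / (kap V * 2) by rewrite divr_gt0 ?mulr_gt0.
  have [|z1 Z1 z1P] := rP (g + f0) _ _ ek; first by rewrite addrK.
  have [|z2 Z2 z2P] := rP f0 _ _ ek; first by rewrite subrr qnorm00 ltW.
  exists (z1 - z2) => [|P M].
    have -> : g - (z1 - z2) = (g + f0 - z1) - (f0 - z2).
      by rewrite !opprB (addrAC g) -[RHS]addrA [f0 + _]addrC subrK addrA addrAC.
    rewrite (le_trans (qnormBk _ _))// -[leRHS](half_kap V) ler_wpM2l ?(ltW k0)//.
    exact: lerD.
  rewrite (lin_B (psum_lin P M)) (le_trans (qnormBk _ _))// ler_wpM2l ?(ltW k0)//.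
  by rewrite lerD ?Z1 ?Z2.
exists (kap V * (n%:R + n%:R) / r); first by rewrite divr_ge0 ?(ltW r0)// mulr_ge0 ?(ltW k0).
move=> g e e0; have [g0|g0] := eqVneq (qnorm g) 0.
  exists 0 => [|P M]; first by rewrite subr0 g0 ltW.
  by rewrite (lin_0 (psum_lin P M)) qnorm00 g0 mulr0.
have gp : 0 < qnorm g by rewrite lt_neqAle eq_sym g0 qnorm_ge0.
pose s := r / qnorm g; have sp : 0 < s by rewrite divr_gt0.
have [||z z1 z2] := near0 (rscal s *: g) (s * e).
- by rewrite qnormZ sabs_rscal gtr0_norm// /s divfK.
- by rewrite mulr_gt0.
have sV : rscal s^-1 * rscal s = 1 :> scalar R k by rewrite -rscalM mulVf ?gt_eqF// rscal1.
exists (rscal s^-1 *: z) => [|P M].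
  have -> : g - rscal s^-1 *: z = rscal s^-1 *: (rscal s *: g - z).
    by rewrite scalerBr scalerA sV scale1r.
  by rewrite qnormZ sabs_rscal gtr0_norm ?invr_gt0// mulrC ler_pdivrMr// mulrC.
rewrite (lin_Z (psum_lin P M)) qnormZ sabs_rscal gtr0_norm ?invr_gt0// invf_div mulrC.
by rewrite -mulrA [r^-1 * _]mulrC ler_wpM2r ?z2// divr_ge0 ?(ltW r0)// ltW.
Qed.

Lemma qcvg_scale (s : nat -> scalar R k) (v : V) : qcauchy (fun n => s n *: v) -> exists a,
  qcvg (fun n => s n *: v) (a *: v).
Proof.
move=> sC; have [v0|v0] := eqVneq v 0.
  by exists 0; rewrite v0 scale0r; apply: (qcvg_ext _ (qcvg_cst 0)) => n; rewrite scaler0.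
have vp : 0 < qnorm v.
  by rewrite lt_neqAle qnorm_ge0 andbT eq_sym; apply: contra_neq v0 => /qnorm0_eq0.
have [|a aP] := @scalar_cauchy _ _ s.
  move=> e e0; have [|N NP] := sC (e * qnorm v); first by rewrite mulr_gt0.
  by exists N => m n Nm Nn; have := NP m n Nm Nn; rewrite -scalerBl qnormZ ler_pM2r.
exists a => e e0; have [|N NP] := aP (e / qnorm v); first by rewrite divr_gt0.
by exists N => n /NP; rewrite -scalerBl qnormZ -ler_pdivlMr.
Qed.

Lemma qcvg_sum (M : nat) (P : pred nat) (u : nat -> nat -> V) (l : nat -> V) :
  (forall i, qcvg (u i) (l i)) -> qcvg (fun n => \sum_(i < M | P i) u i n) (\sum_(i < M | P i) l i).
Proof.
move=> ul; elim: M => [|M IH].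
  by rewrite big_ord0; apply: (qcvg_ext _ (qcvg_cst 0)) => n; rewrite big_ord0.
have [PM|PM] := boolP (P M).
  rewrite big_mkcond big_ord_recr /= PM -big_mkcond/=.
  apply: (@qcvg_ext _ _ _ (fun n => \sum_(i < M | P i) u i n + u M n)); last exact: qcvgD.
  by move=> n; rewrite [RHS]big_mkcond big_ord_recr /= PM -big_mkcond.
rewrite big_mkcond big_ord_recr /= (negbTE PM) -big_mkcond/= addr0.
apply: qcvg_ext IH => n.
by rewrite [RHS]big_mkcond big_ord_recr /= (negbTE PM) -big_mkcond addr0.
Qed.

(** As in the open mapping theorem, [f] is written as a series of approximants with geometric
    errors. Their partial sums converge at a rate uniform in [P] and [M], so the limits are the
    partial sums of an expansion of [f], and uniqueness identifies its coefficients with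
    [coef f]. *)
Lemma psum_le : exists2 K : R, 0 <= K & forall P M f, qnorm (psum P M f) <= K * qnorm f.
Proof.
have [C C0 CP] := approx_bounded; have k0 := kap_gt0 V.
pose t : R := (2 * kap V)^-1; have t0 : 0 < t by rewrite invr_gt0 mulr_gt0.
have kt : kap V * t <= 2^-1 by exact: kap_half.
have t1 : t <= 2^-1 by apply: le_trans kt; rewrite ler_peMl ?kap_ge1// ltW.
exists (kap V * (2 * kap V * C)); first by rewrite !mulr_ge0// ltW.
move=> P M f; have [f0|f0] := eqVneq (qnorm f) 0.
  by rewrite (qnorm0_eq0 _ f0) (lin_0 (psum_lin P M)) qnorm00 mulr0.
have fp : 0 < qnorm f by rewrite lt_neqAle eq_sym f0 qnorm_ge0.
have /choice[A AP] : forall s : nat * V, exists z,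
    qnorm (s.2 - z) <= qnorm f * t ^+ s.1.+1 /\ forall P M, qnorm (psum P M z) <= C * qnorm s.2.
  move=> s; have [|z z1 z2] := CP s.2 (qnorm f * t ^+ s.1.+1).
    by rewrite mulr_gt0 ?exprn_gt0.
  by exists z.
pose r := fix r n := if n is m.+1 then r m - A (m, r m) else f.
pose z n := A (n, r n).
have rn n : qnorm (r n) <= qnorm f * t ^+ n.
  by case: n => [|n]; [rewrite expr0 mulr1|exact: (AP (n, r n)).1].
have zn P' M' n : qnorm (psum P' M' (z n)) <= C * qnorm f * t ^+ n.
  by apply: le_trans ((AP (n, r n)).2 _ _) _; rewrite -mulrA ler_wpM2l ?rn.
have rE n : f - \sum_(i < n) z i = r n.
  elim: n => [|n IH]; first by rewrite big_ord0 subr0.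
  by rewrite big_ord_recr /= opprD addrA IH.
have Cf0 : 0 <= C * qnorm f by rewrite mulr_ge0// ltW.
have sumz P' M' n : psum P' M' (\sum_(i < n) z i) = \sum_(i < n) psum P' M' (z i).
  exact: (lin_sum (psum_lin P' M')).
(* The i-th term of an expansion is itself a partial sum, [psum (pred1 i) i.+1], so the uniform
   estimates apply to it. *)
have /choice[a aP] : forall i, exists a, qcvg (fun n => coef (\sum_(j < n) z j) i *: x i) (a *: x i).
  move=> i; apply: qcvg_scale.
  have [l lP _] := qcvg_geo cV Cf0 (ltW t0) kt (zn (pred1 i) i.+1).
  have -> : (fun n => coef (\sum_(j < n) z j) i *: x i) = (fun n => \sum_(j < n) psum (pred1 i) i.+1 (z j)).
    by apply/funext => n; rewrite -sumz /psum (big_pred1 ord_max).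
  exact: qcvg_cauchy lP.
pose b i := if real i then a i else 0.
have bx i : b i *: x i = a i *: x i by rewrite /b; case: ifPn => // /x0->; rewrite !scaler0.
have lim P' M' : qcvg (fun n => psum P' M' (\sum_(j < n) z j)) (\sum_(i < M' | P' i) b i *: x i).
  apply: (@qcvg_sum M' P' (fun i n => coef (\sum_(j < n) z j) i *: x i) (fun i => b i *: x i)) => i.
  by rewrite bx.
have tail P' M' n : qnorm (psum P' M' (\sum_(j < n) z j) - \sum_(i < M' | P' i) b i *: x i) <=
    2 * kap V ^+ 2 * (C * qnorm f) * t ^+ n.
  have [l lP ln] := qcvg_geo cV Cf0 (ltW t0) kt (zn P' M').
  have -> : \sum_(i < M' | P' i) b i *: x i = l; last by rewrite sumz.
  by apply: qcvg_unique (lim _ _) _; apply: qcvg_ext lP => m; rewrite sumz.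
have fb : coef f = b.
  apply: coefE => [i ri|]; first by rewrite /b (negbTE ri).
  move=> e e0.
  pose e1 := e / (kap V * 2); have e1p : 0 < e1 by rewrite divr_gt0 ?mulr_gt0.
  pose e2 := e1 / (kap V * 2); have e2p : 0 < e2 by rewrite divr_gt0// mulr_gt0.
  have [n nP] : exists n, (2 * kap V ^+ 2 * (C * qnorm f) + qnorm f) * t ^+ n <= Num.min e1 e2.
    have m0 : 0 < Num.min e1 e2 by rewrite lt_min e1p e2p.
    have : (2 * kap V ^+ 2 * (C * qnorm f) + qnorm f) * t ^+ n @[n --> \oo] -->
        (2 * kap V ^+ 2 * (C * qnorm f) + qnorm f) * 0.
      apply: cvgMr; apply: cvg_expr; rewrite ger0_norm ?(ltW t0)//.
      by apply: le_lt_trans t1 _; rewrite invf_lt1 ?ltr1n.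
    rewrite mulr0 => /cvgrPdist_le/(_ _ m0)[N _ /(_ N (leqnn N))].
    by rewrite sub0r normrN => /(le_trans (ler_norm _)); exists N.
  have n1 : 2 * kap V ^+ 2 * (C * qnorm f) * t ^+ n <= e1.
    apply: le_trans (_ : _ <= Num.min e1 e2) _; last by rewrite ge_min lexx.
    by apply: le_trans nP; rewrite ler_wpM2r ?exprn_ge0 ?(ltW t0)// lerDl ltW.
  have n2 : qnorm f * t ^+ n <= e2.
    apply: le_trans (_ : _ <= Num.min e1 e2) _; last by rewrite ge_min lexx orbT.
    apply: le_trans nP; rewrite ler_wpM2r ?exprn_ge0 ?(ltW t0)// lerDr.
    by rewrite !mulr_ge0 ?exprn_ge0 ?(ltW k0)// ltW.
  have [N NP] := coef_usum (\sum_(j < n) z j) e2p.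
  exists N => P' M' PN NM; rewrite -[leRHS](half_kap V) -/e1.
  apply: le_trans (qnorm_tri (psum P' M' (\sum_(j < n) z j)) _ _) _.
  rewrite ler_wpM2l ?(ltW k0)// lerD//; first by rewrite qnormC (le_trans (tail _ _ _)).
  rewrite -[leRHS](half_kap V) -/e2.
  apply: le_trans (qnorm_tri (\sum_(j < n) z j) _ _) _.
  rewrite ler_wpM2l ?(ltW k0)// lerD//; first exact: NP.
  by rewrite qnormC rE (le_trans (rn n)).
rewrite /psum fb -!mulrA; apply: qcvg_le (lim P M) => n.
rewrite sumz !mulrA -[2 * _ * _ * _]mulrA; exact: qnorm_geo Cf0 (ltW t0) kt (zn P M).
Qed.

End UniformBoundedness.

(** * Multipliers of an unconditional basis *)

Definition sball (R : realType) (k : scalar_kind) (a : nat -> scalar R k) :=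
  forall i, sabs (a i) <= 1.

Section MultiplierBound.
Context {R : realType} {k : scalar_kind} {V : quasiNormedType R k}.

(* With s the supremum over all admissible a, rounding a to a finite net G of
   mesh 1/(2 kap) gives s <= kap (C_G B + s / (2 kap)), hence s <= 2 kap C_G B. *)
Lemma multiplier_bound : exists2 C : R, 0 <= C & forall (u : nat -> V) N (B : R),
  (forall P : pred nat, qnorm (\sum_(i < N | P i) u i) <= B) ->
  forall a : nat -> scalar R k, sball a -> qnorm (\sum_(i < N) a i *: u i) <= C * B.
Proof.
have k0 := kap_gt0 V; pose eta : R := (2 * kap V)^-1.
have eta0 : 0 < eta by rewrite invr_gt0 mulr_gt0.
have [G GP] := @disc_net R k _ eta0.
pose CG := kap V ^+ size (undup G) * \sum_(g <- undup G) sabs g.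
have CG0 : 0 <= CG.
  by rewrite mulr_ge0 ?exprn_ge0 ?(ltW k0)// sumr_ge0// => g _; exact: sabs_ge0.
exists (2 * kap V * CG); first by apply: mulr_ge0 => //; rewrite mulr_ge0// ltW.
move=> u N B uB.
pose S := [set r : R | exists2 a : nat -> scalar R k, sball a & r = qnorm (\sum_(i < N) a i *: u i)].
have hS : has_sup S.
  split; first by exists (qnorm (\sum_(i < N) (0 : scalar R k) *: u i)), (fun=> 0) => // i; rewrite sabs0.
  exists (kap V ^+ size (index_enum 'I_N) * \sum_(i < N) qnorm (u i)) => _ [a a1 ->].
  apply: le_trans (qnorm_sum_seq _ _ _) _; rewrite ler_wpM2l ?exprn_ge0 ?(ltW k0)//.
  by apply: ler_sum => i _; rewrite qnormZ ler_piMl ?qnorm_ge0.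
have step a : sball a -> qnorm (\sum_(i < N) a i *: u i) <= kap V * (CG * B + eta * sup S).
  move=> a1.
  have /choice[g gP] : forall i, exists h, h \in undup G /\ sabs (a i - h) <= eta.
    by move=> i; have [h hG ah] := GP _ (a1 i); exists h; rewrite mem_undup.
  have -> : \sum_(i < N) a i *: u i = \sum_(i < N) g i *: u i + \sum_(i < N) (a i - g i) *: u i.
    by rewrite -big_split; apply: eq_bigr => i _ /=; rewrite -scalerDl addrC subrK.
  rewrite (le_trans (qnormDk _ _))// ler_wpM2l ?(ltW k0)// lerD//.
    have -> : \sum_(i < N) g i *: u i = \sum_(h <- undup G) h *: \sum_(i < N | g i == h) u i.
      transitivity (\sum_(i < N) \sum_(h <- undup G | g i == h) h *: u i).
        apply: eq_bigr => i _; rewrite big_mkcond (bigD1_seq (g i)) ?(gP i).1 ?undup_uniq//= eqxx.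
        by rewrite big1 ?addr0// => h; rewrite eq_sym => /negbTE->.
      by rewrite (exchange_big_dep xpredT)//=; apply: eq_bigr => h _; rewrite scaler_sumr.
    apply: le_trans (qnorm_sum_seq _ _ _) _; rewrite -mulrA ler_wpM2l ?exprn_ge0 ?(ltW k0)//.
    rewrite mulr_suml; apply: ler_sum => h _; rewrite qnormZ ler_wpM2l ?sabs_ge0//.
    exact: (uB (fun i => g i == h)).
  pose a' i := rscal eta^-1 * (a i - g i).
  have -> : \sum_(i < N) (a i - g i) *: u i = rscal eta *: \sum_(i < N) a' i *: u i.
    rewrite scaler_sumr; apply: eq_bigr => i _; rewrite scalerA /a' mulrA -rscalM mulfV ?gt_eqF//.
    by rewrite rscal1 mul1r.
  rewrite qnormZ sabs_rscal gtr0_norm// ler_wpM2l ?(ltW eta0)//.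
  apply: ub_le_sup => //; first exact: hS.2.
  have ei0 : 0 < eta^-1 by rewrite invr_gt0.
  exists a' => // i; rewrite /a' sabsM sabs_rscal (gtr0_norm ei0).
  by rewrite ler_pdivrMl// mulr1 (gP i).2.
have supS : sup S <= 2 * kap V * CG * B.
  have : sup S <= kap V * (CG * B + eta * sup S).
    by apply: ge_sup; [exact: hS.1|move=> _ [a a1 ->]; exact: step].
  have -> : kap V * (CG * B + eta * sup S) = kap V * (CG * B) + sup S / 2.
    by rewrite /eta; field; rewrite gt_eqF.
  by rewrite -!mulrA; set X := kap V * _; set Y := sup S; lra.
move=> a a1; apply: le_trans supS; apply: ub_le_sup; first exact: hS.2.
by exists a.
Qed.

End MultiplierBound.

(* Multiplier calculus of a basis indexed by nat; [msreal] excludes the dummy indices,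
   where the basis is padded with zeros. *)
Record multsys (R : realType) (k : scalar_kind) (V : quasiNormedType R k) := MultSys {
  msx : nat -> V;
  msc : V -> nat -> scalar R k;
  msE : (nat -> scalar R k) -> V -> V;
  msK : R;
  msreal : pred nat;
  msK_ge1 : 1 <= msK;
  msc_lin : forall a f g i, msc (a *: f + g) i = a * msc f i + msc g i;
  msc_le : forall f i, sabs (msc f i) * qnorm (msx i) <= msK * qnorm f;
  msc_delta : forall i j, msc (msx j) i = ((i == j) && msreal j)%:R;
  msc_dummy : forall f i, ~~ msreal i -> msc f i = 0;
  msE_lin : forall a, linear (msE a);
  msE_le : forall a f, qnorm (msE a f) <= msK * qnorm f;
  msE_mul : forall a b f, sball a -> sball b -> msE a (msE b f) = msE (fun i => a i * b i) f;
  msE_one : forall f, msE (fun=> 1) f = f;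
  msE_add : forall a b f, sball a -> sball b -> sball (fun i => a i + b i) ->
    msE (fun i => a i + b i) f = msE a f + msE b f;
  msE_tail : forall f e, 0 < e -> exists N, forall a, sball a ->
    (forall i, (i < N)%N -> a i = 0) -> qnorm (msE a f) <= e;
  msE_fin : forall a N f, sball a -> (forall i, (N <= i)%N -> a i = 0) ->
    msE a f = \sum_(i < N) a i *: (msc f i *: msx i)
}.

Section Multipliers.
Context {R : realType} {k : scalar_kind} {V : quasiNormedType R k}.
Hypothesis cV : qcomplete V.
Variables (x : nat -> V) (real : pred nat).
Hypothesis x0 : forall i, ~~ real i -> x i = 0.
Hypothesis expansion : forall f, exists c : nat -> scalar R k,
  (forall i, ~~ real i -> c i = 0) /\ usum (fun i => c i *: x i) f.
Hypothesis expansion_unique : forall f (c c' : nat -> scalar R k),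
  (forall i, ~~ real i -> c i = 0) -> (forall i, ~~ real i -> c' i = 0) ->
  usum (fun i => c i *: x i) f -> usum (fun i => c' i *: x i) f -> c = c'.

Let c := coef expansion.
Let S N f : V := \sum_(i < N) c f i *: x i.
Let T (a : nat -> scalar R k) n f : V := \sum_(i < n) a i *: (c f i *: x i).

Let cD a f g i : c (a *: f + g) i = a * c f i + c g i.
Proof. exact: coef_lin. Qed.

Let c0 i : c 0 i = 0.
Proof. by have := cD 1 0 0 i; rewrite scaler0 addr0 mul1r => /(congr1 (fun y => y - c 0 i)); rewrite addrK subrr => <-. Qed.

Let cB f g i : c (f - g) i = c f i - c g i.
Proof. by rewrite addrC -scaleN1r cD mulN1r addrC. Qed.

Let c_sum n (F : nat -> V) i : c (\sum_(j < n) F j) i = \sum_(j < n) c (F j) i.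
Proof.
elim: n => [|n IH]; first by rewrite !big_ord0 c0.
by rewrite !big_ord_recr /= -IH -[X in X + F n]scale1r cD mul1r.
Qed.

Let c_delta i j : c (x j) i = ((i == j) && real j)%:R.
Proof.
have [rj|rj] := boolP (real j); first by rewrite andbT /c coef_delta.
by rewrite x0// c0 andbF.
Qed.

Let cT a n f i : (i < n)%N -> c (T a n f) i = a i * c f i.
Proof.
move=> ni; rewrite /T (c_sum _ (fun j => a j *: (c f j *: x j))) (bigD1 (Ordinal ni))//= big1.
  rewrite addr0 scalerA -[_ *: x i]addr0 cD c0 addr0 c_delta eqxx /=.
  have [_|ri] := boolP (real i); first by rewrite mulr1.
  by rewrite /c (coef_dummy expansion f ri) !mulr0.
move=> j /negP ji; rewrite scalerA -[_ *: x j]addr0 cD c0 addr0 c_delta.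
by case: eqP => [ij|_]; rewrite ?mulr0//; case: ji; apply/eqP/val_inj; rewrite /= ij.
Qed.

Let cS N f i : (N <= i)%N -> c (S N f) i = 0.
Proof.
move=> Ni; rewrite /S (c_sum _ (fun j => c f j *: x j)) big1// => j _.
rewrite -[_ *: x j]addr0 cD c0 addr0 c_delta.
by case: eqP => [ij|_]; rewrite ?mulr0//; have := ltn_ord j; rewrite -ij ltnNge Ni.
Qed.

Let S_cvg f e : 0 < e -> exists N, forall n, (N <= n)%N -> qnorm (f - S n f) <= e.
Proof.
move=> /(coef_usum expansion f)[N NP]; exists N => n Nn.
by rewrite qnormC; have := NP xpredT n (fun _ _ => isT) Nn.
Qed.

(** [E a f] is the limit of the finite sums [T a n f]; these are Cauchy because a symbol vanishing
    below [N] sees only [f - S N f]. Multiplicativity requires the coefficients of [E a f], whence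
    [Ecoef]. *)
Lemma multsys_of_basis : exists s : multsys V, msx s = x /\ msreal s = real.
Proof.
have k0 := kap_gt0 V; have k1 := kap_ge1 V.
have [K0 K00 K0P] := psum_le cV x0 expansion expansion_unique.
have [C C0 CP] := @multiplier_bound R k V.
pose K := C * K0; have Kp : 0 <= K by rewrite mulr_ge0.
have TK a n f : sball a -> qnorm (T a n f) <= K * qnorm f.
  move=> a1; rewrite /K -mulrA; apply: (CP (fun i => c f i *: x i)) => // P.
  exact: K0P.
have Ttail a n N f : sball a -> (forall i, (i < N)%N -> a i = 0) -> qnorm (T a n f) <= K * qnorm (f - S N f).
  move=> a1 aN; have -> : T a n f = T a n (f - S N f); last exact: TK.
  apply: eq_bigr => i _; have [iN|Ni] := ltnP i N; first by rewrite aN// !scale0r.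
  by rewrite cB cS// subr0.
have Tdiff a n m f : (n <= m)%N -> T a m f - T a n f = T (fun i => if (i < n)%N then 0 else a i) m f.
  move=> nm; rewrite /T -(subnKC nm) !big_split_ord /= addrAC subrr add0r.
  rewrite [X in _ = X + _]big1 ?add0r => [|i _]; last by rewrite ltn_ord scale0r.
  by apply: eq_bigr => i _; rewrite ltnNge leq_addr.
have Tcauchy a f : sball a -> qcauchy (fun n => T a n f).
  move=> a1 e e0; have K1 : 0 < K + 1 by rewrite ltr_wpDl.
  have [N NP] := S_cvg f (divr_gt0 e0 K1).
  have main m n : (N <= n)%N -> (n <= m)%N -> qnorm (T a m f - T a n f) <= e.
    move=> Nn nm; rewrite Tdiff//; apply: le_trans (Ttail _ _ n _ _ _) _.
    - by move=> i; case: ifP; rewrite ?sabs0.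
    - by move=> i ->.
    apply: le_trans (ler_wpM2l Kp (NP _ Nn)) _; rewrite mulrA ler_pdivrMr// mulrC.
    by rewrite ler_wpM2l ?(ltW e0)// lerDl.
  exists N => m n Nm Nn; have [nm|/ltnW mn] := leqP n m; first exact: main.
  by rewrite qnormC; exact: main.
have /choice[E0 E0P] : forall af : (nat -> scalar R k) * V, exists g, sball af.1 -> qcvg (fun n => T af.1 n af.2) g.
  move=> [a f] /=; have [a1|na] := pselect (sball a); last by exists 0.
  by have [g gP] := cV (Tcauchy a f a1); exists g.
(* Outside the unit ball of symbols the operator is set to 0, so that linearity and the norm bound
   hold for every symbol. *)
pose E a f := if pselect (sball a) then E0 (a, f) else 0.
have EP a f : sball a -> qcvg (fun n => T a n f) (E a f).
  by move=> a1; rewrite /E; case: pselect => //= _; apply: (E0P (a, f)).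
have Ele a f : qnorm (E a f) <= kap V * (K * qnorm f).
  have [a1|na] := pselect (sball a).
    by apply: qcvg_le (EP a f a1) => n; exact: TK.
  by rewrite /E; case: pselect => //= _; rewrite qnorm00 !mulr_ge0 ?(ltW k0) ?qnorm_ge0.
pose K' := Num.max 1 (Num.max K0 (kap V * K)).
have K'1 : 1 <= K' by rewrite le_max lexx.
have K'0 : K0 <= K' by rewrite !le_max lexx !orbT.
have K'E : kap V * K <= K' by rewrite !le_max lexx !orbT.
have c_le f i : sabs (c f i) * qnorm (x i) <= K' * qnorm f.
  rewrite -qnormZ; apply: (@le_trans _ _ (K0 * qnorm f)); last by rewrite ler_wpM2r ?qnorm_ge0.
  by have := K0P (pred1 i) i.+1 f; rewrite /psum (big_pred1 ord_max).
have Ecoef a f i : sball a -> c (E a f) i = a i * c f i.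
  move=> a1; have [ri|ri] := boolP (real i); last first.
    by rewrite /c !(coef_dummy expansion _ ri) mulr0.
  have xi : 0 < qnorm (x i).
    rewrite lt_neqAle qnorm_ge0 andbT eq_sym; apply/eqP => /qnorm0_eq0 xi0.
    have := c_delta i i; rewrite xi0 c0 eqxx ri => /eqP.
    by rewrite eq_sym oner_eq0.
  apply/subr0_eq/sabs_eq0/eqP; rewrite eq_le sabs_ge0 andbT.
  apply/ler_addgt0Pr => e e0; rewrite add0r -(ler_pM2r xi).
  have e1 : 0 < e * qnorm (x i) / K' by rewrite divr_gt0 ?mulr_gt0// (lt_le_trans ltr01).
  have [N NP] := EP a f a1 _ e1.
  have Ni := NP (maxn N i.+1) (leq_maxl _ _).
  rewrite -(@cT a (maxn N i.+1)) ?leq_maxr// -cB (le_trans (c_le _ _))//.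
  by rewrite mulrC -ler_pdivlMr ?(lt_le_trans ltr01)// qnormC.
have Elin a : linear (E a).
  move=> b f g; have [a1|na] := pselect (sball a); last first.
    by rewrite /E; case: pselect => //= _; rewrite scaler0 addr0.
  apply: qcvg_unique (EP _ _ a1) _.
  apply: (@qcvg_ext _ _ _ (fun n => b *: T a n f + T a n g)).
    move=> n; rewrite /T scaler_sumr -big_split; apply: eq_bigr => i _ /=.
    by rewrite cD scalerDl scalerDr !scalerA mulrCA mulrA.
  apply: qcvgD (EP _ _ a1); apply: (@qcvg_lin _ _ _ _ ( *:%R b) _ (sabs b)) (EP _ _ a1).
    by move=> s u v; rewrite scalerDr !scalerA mulrC.
  by move=> u; rewrite qnormZ.
have sb1 : sball (fun=> 1 : scalar R k) by move=> i; rewrite sabs1.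
have Ele' a f : qnorm (E a f) <= K' * qnorm f.
  by rewrite (le_trans (Ele a f))// mulrA ler_wpM2r ?qnorm_ge0.
have Emul a b f : sball a -> sball b -> E a (E b f) = E (fun i => a i * b i) f.
  move=> a1 b1; have ab1 : sball (fun i => a i * b i).
    by move=> i; rewrite sabsM -[leRHS]mulr1 ler_pM ?sabs_ge0.
  apply: qcvg_unique (EP _ _ a1) _; apply: qcvg_ext (EP _ _ ab1) => n.
  by apply: eq_bigr => i _; rewrite Ecoef// !scalerA mulrA.
have Eone f : E (fun=> 1) f = f.
  apply: qcvg_unique (EP _ _ sb1) _.
  move=> e e0; have [N NP] := S_cvg f e0; exists N => n /NP; rewrite qnormC.
  by rewrite /T; under eq_bigr do rewrite scale1r.
have Eadd a b f : sball a -> sball b -> sball (fun i => a i + b i) ->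
    E (fun i => a i + b i) f = E a f + E b f.
  move=> a1 b1 ab1; apply: qcvg_unique (EP _ _ ab1) _.
  apply: qcvg_ext (qcvgD (EP _ _ a1) (EP _ _ b1)) => n.
  by rewrite /T -big_split; apply: eq_bigr => i _; rewrite scalerDl.
have Etail f e : 0 < e -> exists N, forall a, sball a -> (forall i, (i < N)%N -> a i = 0) ->
    qnorm (E a f) <= e.
  move=> e0; have K1 : 0 < kap V * (K + 1) by rewrite mulr_gt0// ltr_wpDl.
  have [N NP] := S_cvg f (divr_gt0 e0 K1); exists N => a a1 aN.
  have h n : qnorm (T a n f) <= K * qnorm (f - S N f) by exact: Ttail.
  apply: le_trans (qcvg_le h (EP a f a1)) _.
  rewrite mulrA; apply: (@le_trans _ _ (kap V * (K + 1) * qnorm (f - S N f))).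
    by rewrite ler_wpM2r ?qnorm_ge0// ler_wpM2l ?(ltW k0)// lerDl.
  by rewrite mulrC -ler_pdivlMr// NP.
have Efin a N f : sball a -> (forall i, (N <= i)%N -> a i = 0) ->
    E a f = \sum_(i < N) a i *: (c f i *: x i).
  move=> a1 aN; apply: qcvg_unique (EP _ _ a1) _.
  move=> e e0; exists N => n Nn; rewrite -/(T a N f) Tdiff// [T _ _ _]big1 ?qnorm00 ?(ltW e0)//.
  by move=> i _ /=; case: (ltnP i N) => [_|/aN ->]; rewrite scale0r.
have cdum f i : ~~ real i -> c f i = 0 by exact: coef_dummy.
by exists (MultSys K'1 cD c_le c_delta cdum Elin Ele' Emul Eone Eadd Etail Efin).
Qed.

End Multipliers.

(** * The spaces l_p *)

Section EllBasics.
Context {R : realType} {k : scalar_kind} (p : exponent R).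
Implicit Types (a b : nat -> (scalar R k)^o) (u v : ell k p).

Lemma exponentP : (exists2 r, 0 < r & val p = r%:E) \/ val p = +oo%E.
Proof. by case: p => -[r| |] //= p0; [left; exists r|right]. Qed.

Definition psec r M a : R := \sum_(m < M) sabs (a m) `^ r.

Lemma psec_ge0 r M a : 0 <= psec r M a.
Proof. by apply: sumr_ge0 => m _; exact: powR_ge0. Qed.

Lemma psec_le r M M' a : (M <= M')%N -> psec r M a <= psec r M' a.
Proof.
move=> MM; rewrite /psec -(subnKC MM) big_split_ord /= lerDl.
by apply: sumr_ge0 => m _; exact: powR_ge0.
Qed.

Lemma nneseries_leP (w : nat -> R) c : (forall n, 0 <= w n) ->
  (\sum_(n <oo) (w n)%:E <= c%:E)%E <-> forall M, \sum_(m < M) w m <= c.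
Proof.
move=> w0; have w0E n : xpredT n -> (0 <= (w n)%:E)%E by rewrite lee_fin.
split=> [wc M|wc].
  rewrite -lee_fin -sumEFin; apply: le_trans wc.
  by rewrite -(big_mkord xpredT (fun m => (w m)%:E)); apply: nneseries_lim_ge => *; rewrite lee_fin.
apply: lime_le; first by apply: is_cvg_nneseries => n _ _; exact: w0E.
by near=> M; rewrite big_mkord sumEFin lee_fin.
Unshelve. all: by end_near. Qed.

Lemma in_ell_fin r a : val p = r%:E ->
  a \in in_ell p <-> exists c, forall M, psec r M a <= c.
Proof.
move=> pr; have S0 : (0 <= \sum_(n <oo) (sabs (a n) `^ r)%:E)%E.
  by apply: nneseries_ge0 => n _ _; rewrite lee_fin powR_ge0.
have w0 n : 0 <= sabs (a n) `^ r by exact: powR_ge0.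
split=> [/asboolP|[c ac]]; last first.
  by apply/asboolP; rewrite pr; apply: le_lt_trans (ltry c); apply/(nneseries_leP c w0).
rewrite pr => aS; exists (fine (\sum_(n <oo) (sabs (a n) `^ r)%:E)%E).
by apply/(nneseries_leP _ w0); rewrite fineK// ge0_fin_numE.
Qed.

Lemma qnorm_fin r u : val p = r%:E -> 0 < r ->
  qnorm u `^ r = fine (\sum_(n <oo) (sabs (u n) `^ r)%:E)%E.
Proof.
move=> pr r0; rewrite -[qnorm u]/(ell_norm p u) /ell_norm pr -powRrM mulVf ?gt_eqF// powRr1//.
by apply: fine_ge0; apply: nneseries_ge0 => n _ _; rewrite lee_fin powR_ge0.
Qed.

(** Through this equivalence, estimates for a finite exponent reduce to finite sums of powers. *)
Lemma qnorm_powP r u c : val p = r%:E -> 0 < r ->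
  qnorm u `^ r <= c <-> forall M, psec r M u <= c.
Proof.
move=> pr r0; rewrite (qnorm_fin u pr r0).
have w0 n : 0 <= sabs (u n) `^ r by exact: powR_ge0.
have uf : (\sum_(n <oo) (sabs (u n) `^ r)%:E)%E \is a fin_num.
  have := ell_seqP u => /asboolP; rewrite pr => uS; rewrite ge0_fin_numE//.
  by apply: nneseries_ge0 => n _ _; rewrite lee_fin powR_ge0.
rewrite -(nneseries_leP c w0) -{2}(fineK uf) lee_fin; split => //.
Qed.

Lemma psec_qnorm r u M : val p = r%:E -> 0 < r -> psec r M u <= qnorm u `^ r.
Proof. by move=> pr r0; have /(qnorm_powP u (qnorm u `^ r) pr r0) := lexx (qnorm u `^ r). Qed.

Lemma powR_le_root r (x y : R) : 0 < r -> 0 <= x -> 0 <= y -> (x `^ r <= y `^ r) = (x <= y).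
Proof.
move=> r0 x0 y0; apply/idP/idP => [|xy].
  by apply: contraTT; rewrite -!ltNge => yx; rewrite gt0_ltr_powR.
by rewrite ge0_ler_powR ?nnegrE// ltW.
Qed.

Lemma qnorm_finP r u c : val p = r%:E -> 0 < r -> 0 <= c ->
  qnorm u <= c <-> forall M, psec r M u <= c `^ r.
Proof.
by move=> pr r0 c0; rewrite -(powR_le_root r0 (qnorm_ge0 u) c0); exact: qnorm_powP.
Qed.

Lemma in_ell_inf a : val p = +oo%E -> a \in in_ell p <->
  forall e, 0 < e -> exists N, forall n, (N <= n)%N -> sabs (a n) <= e.
Proof.
move=> pi; split=> [/asboolP|aP]; last first.
  apply/asboolP; rewrite pi; apply/cvgrPdist_le => e /aP[N NP].
  by exists N => // n /= /NP; rewrite sub0r normrN ger0_norm ?sabs_ge0.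
rewrite pi => /cvgrPdist_le aP e /aP[N _ NP]; exists N => n /NP.
by rewrite sub0r normrN ger0_norm ?sabs_ge0.
Qed.

Lemma qnorm_infP u c : val p = +oo%E -> 0 <= c ->
  qnorm u <= c <-> forall n, sabs (u n) <= c.
Proof.
move=> pi c0; rewrite -[qnorm u]/(ell_norm p u) /ell_norm pi.
have /asboolP := ell_seqP u; rewrite pi => uc.
have ub : has_ubound (range (fun n => sabs (u n))) by exact: (cvg_has_sup (cvgP _ uc)).2.
split=> [uc' n|uc']; first by apply: le_trans uc'; apply: ub_le_sup => //; exists n.
apply: ge_sup; first by exists (sabs (u 0%N)), 0%N.
by move=> _ [n _ <-].
Qed.

Lemma coord_le u n : sabs (u n) <= qnorm u.
Proof.
have [[r r0 pr]|pi] := exponentP; last exact: ((qnorm_infP u pi (qnorm_ge0 u)).1 (lexx _) n).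
rewrite -(powR_le_root r0) ?sabs_ge0 ?qnorm_ge0//.
apply: le_trans (psec_qnorm u n.+1 pr r0); rewrite /psec big_ord_recr /= lerDr.
exact: psec_ge0.
Qed.

Lemma in_ell_dom a b : b \in in_ell p -> (forall n, sabs (a n) <= sabs (b n)) -> a \in in_ell p.
Proof.
move=> bp ab; have [[r r0 pr]|pi] := exponentP.
  have [c bc] := (in_ell_fin b pr).1 bp; apply/(in_ell_fin a pr); exists c => M.
  apply: le_trans (bc M); apply: ler_sum => m _.
  by rewrite powR_le_root ?sabs_ge0.
apply/(in_ell_inf a pi) => e /((in_ell_inf b pi).1 bp)[N NP]; exists N => n /NP.
exact: le_trans.
Qed.

Lemma qnorm_dom u v c : 0 <= c -> (forall n, sabs (u n) <= c * sabs (v n)) -> qnorm u <= c * qnorm v.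
Proof.
move=> c0 uv; have cv0 : 0 <= c * qnorm v by rewrite mulr_ge0 ?qnorm_ge0.
have [[r r0 pr]|pi] := exponentP; last first.
  apply/(qnorm_infP _ pi cv0) => n; apply: le_trans (uv n) _.
  by rewrite ler_wpM2l ?coord_le.
apply/(qnorm_finP _ pr r0 cv0) => M; rewrite powRM ?qnorm_ge0//.
apply: (@le_trans _ _ (c `^ r * psec r M v)); last by rewrite ler_wpM2l ?powR_ge0 ?psec_qnorm.
rewrite mulr_sumr; apply: ler_sum => m _.
by rewrite -powRM ?sabs_ge0// powR_le_root ?sabs_ge0 ?mulr_ge0 ?sabs_ge0.
Qed.

Lemma sum_trunc_le M M' (F : nat -> R) : (forall m, 0 <= F m) ->
  \sum_(m < M') (if (m < M)%N then F m else 0) <= \sum_(m < M) F m.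
Proof.
move=> F0; have [MM|/ltnW MM] := leqP M M'.
  by rewrite -big_mkcond -(big_ord_widen _ F MM).
apply: (@le_trans _ _ (\sum_(m < M') F m)).
  by apply: ler_sum => m _; case: ifP.
by rewrite -(subnKC MM) big_split_ord /= lerDl sumr_ge0.
Qed.

Fact trunc_in_ell M a : (fun m => if (m < M)%N then a m else 0) \in in_ell p.
Proof.
have [[r r0 pr]|pi] := exponentP; last first.
  by apply/(in_ell_inf _ pi) => e e0; exists M => n Mn; rewrite ltnNge Mn /= sabs0 ltW.
apply/(in_ell_fin _ pr); exists (psec r M a) => M'.
apply: le_trans (sum_trunc_le M M' (fun m => powR_ge0 (sabs (a m)) r)).
by apply: ler_sum => m _; case: ifP => // _; rewrite sabs0 powR0// gt_eqF.
Qed.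

Definition trunc M a : ell k p := Ell (trunc_in_ell M a).

Lemma truncE M a n : trunc M a n = if (n < M)%N then a n else 0.
Proof. by []. Qed.

Lemma ellD u v n : (u + v) n = u n + v n.
Proof. by []. Qed.

Lemma ellB u v n : (u - v) n = u n - v n.
Proof. by []. Qed.

Lemma ellZ (c : scalar R k) u n : (c *: u) n = c * u n.
Proof. by []. Qed.

Lemma ellP u v : (forall n, u n = v n) -> u = v.
Proof. by move=> uv; apply: val_inj; apply/funext. Qed.

Lemma qnorm_truncP u c : qnorm u <= c <-> forall M, qnorm (trunc M u) <= c.
Proof.
split=> [uc M|uc].
  apply: le_trans uc; rewrite -[leRHS]mul1r; apply: qnorm_dom => // n /=.
  by rewrite mul1r; case: ifP; rewrite ?sabs0 ?sabs_ge0.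
have c0 : 0 <= c by apply: le_trans (uc 0%N); exact: qnorm_ge0.
have [[r r0 pr]|pi] := exponentP; last first.
  apply/(qnorm_infP _ pi c0) => n; apply: le_trans (uc n.+1).
  by have := coord_le (trunc n.+1 u) n; rewrite /= ltnSn.
apply/(qnorm_finP _ pr r0 c0) => M.
have := (qnorm_finP (trunc M u) pr r0 c0).1 (uc M) M; apply: le_trans.
by apply: ler_sum => m _ /=; rewrite ltn_ord.
Qed.

(** Since [a] is not yet known to lie in the space, its distance to [u] is measured on truncations.
    A finite exponent needs a single [u] at bounded distance; for c_0 the distance has to be
    arbitrarily small. *)
Lemma in_ell_closure a : (forall e, 0 < e -> exists u, forall M, qnorm (trunc M (fun n => a n - u n)) <= e) ->
  a \in in_ell p.
Proof.
move=> aP; have [[r r0 pr]|pi] := exponentP; last first.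
  apply/(in_ell_inf _ pi) => e e0; have [|u uP] := aP (e / 2); first exact: divr_gt0.
  have [|N NP] := (in_ell_inf u pi).1 (ell_seqP u) (e / 2); first exact: divr_gt0.
  exists N => n Nn; rewrite -[a n](subrK (u n)) (le_trans (le_sabsD _ _))// [leRHS]splitr lerD ?NP//.
  by apply: le_trans (uP n.+1); have := coord_le (trunc n.+1 (fun n => a n - u n)) n; rewrite /= ltnSn.
have [u uP] := aP 1 ltr01.
have b_in : (fun n => a n - u n) \in in_ell p.
  apply/(in_ell_fin _ pr); exists (1 `^ r) => M.
  have := (qnorm_finP (trunc M (fun n => a n - u n)) pr r0 ler01).1 (uP M) M.
  by apply: le_trans; apply: ler_sum => m _ /=; rewrite ltn_ord.
have := (in_ell_closed p).1.2 _ _ b_in (ell_seqP u).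
by rewrite (_ : _ + _ = a)//; apply/funext => n; exact: subrK.
Qed.

Definition unitv m : ell k p := trunc m.+1 (fun n => (n == m)%:R).

Lemma unitvE m n : unitv m n = (n == m)%:R.
Proof. by rewrite /= ltnS; case: leqP => // mn; rewrite gtn_eqF. Qed.

Lemma qnorm_unitv m : qnorm (unitv m) <= 1.
Proof.
have [[r r0 pr]|pi] := exponentP; last first.
  by apply/(qnorm_infP _ pi ler01) => n; rewrite unitvE; case: eqP; rewrite ?sabs1 ?sabs0.
apply/(qnorm_finP _ pr r0 ler01) => M; rewrite powR1.
rewrite /psec; under eq_bigr do rewrite unitvE.
have [mM|Mm] := ltnP m M.
  rewrite (bigD1 (Ordinal mM))//= eqxx sabs1 powR1 big1 ?addr0// => n nm.
  by rewrite -[_ == m]/(n == Ordinal mM) (negbTE nm) sabs0 powR0// gt_eqF.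
rewrite big1// => n _; rewrite ltn_eqF ?sabs0 ?powR0 ?gt_eqF//.
exact: leq_trans (ltn_ord n) Mm.
Qed.

Lemma trunc_sum M a : trunc M a = \sum_(m < M) a m *: unitv m.
Proof.
elim: M => [|M IH].
  by rewrite big_ord0; apply: ellP => n.
rewrite big_ord_recr /= -IH; apply: ellP => n.
rewrite -[RHS]/(trunc M a n + a M * unitv M n) unitvE /= ltnS leq_eqVlt.
by case: eqVneq => [->|nM]; rewrite /= ?ltnn ?mulr1 ?mulr0 ?add0r ?addr0.
Qed.

Lemma qnorm_trunc_le M a c : 0 <= c -> (forall m, (m < M)%N -> sabs (a m) <= c) ->
  qnorm (trunc M a) <= kap (ell k p : quasiNormedType R k) ^+ size (index_enum 'I_M) *
    (size (index_enum 'I_M))%:R * c.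
Proof.
move=> c0 ac; rewrite trunc_sum; apply: qnorm_sum_le => // m _.
rewrite qnormZ -[leRHS]mulr1 ler_pM ?sabs_ge0 ?qnorm_ge0 ?qnorm_unitv//.
exact: ac.
Qed.

Lemma trunc_cvg u : qcvg (fun M => trunc M u) u.
Proof.
move=> e e0; have [[r r0 pr]|pi] := exponentP; last first.
  have [N NP] := (in_ell_inf u pi).1 (ell_seqP u) _ e0; exists N => M NM.
  apply/(qnorm_infP _ pi (ltW e0)) => n; rewrite -[_ n]/(trunc M u n - u n) /=.
  case: ltnP => [_|Mn]; first by rewrite subrr sabs0 ltW.
  by rewrite sub0r sabsN NP// (leq_trans NM).
have er0 : 0 < e `^ r by rewrite powR_gt0.
have [N NP] : exists N, qnorm u `^ r - e `^ r <= psec r N u.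
  apply: contrapT => /forallNP H.
  have : qnorm u `^ r <= qnorm u `^ r - e `^ r.
    apply/(qnorm_powP _ _ pr r0) => M; apply/ltW.
    by have /negP := H M; rewrite -ltNge.
  by rewrite lerBrDr gerDl leNgt er0.
exists N => M NM; apply/(qnorm_finP _ pr r0 (ltW e0)) => L.
have pE L' : psec r L' (trunc M u - u) = \sum_(m < L') (if (m < M)%N then 0 else sabs (u m) `^ r).
  apply: eq_bigr => m _; rewrite -[(_ - _ : ell k p) _]/(trunc M u m - u m) /=.
  by case: ifP => _; rewrite ?subrr ?sabs0 ?powR0 ?gt_eqF// sub0r sabsN.
apply: (@le_trans _ _ (psec r (maxn L N) u - psec r N u)); last first.
  by rewrite lerBlDr -lerBlDl (le_trans _ NP)// lerB// psec_qnorm.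
apply: le_trans (psec_le _ _ (leq_maxl L N)) _.
rewrite pE /psec -(subnKC (leq_maxr L N)) !big_split_ord /= [X in _ <= X - _]addrC addrK.
rewrite big1 ?add0r => [|i _]; last by rewrite (leq_trans (ltn_ord i) NM).
by apply: ler_sum => i _; case: ifP => // _; exact: powR_ge0.
Qed.

Lemma ell_complete : qcomplete (ell k p : quasiNormedType R k).
Proof.
move=> u uC; set V := (ell k p : quasiNormedType R k).
have /choice[l lP] : forall n, exists l, forall e, 0 < e -> exists N, forall i, (N <= i)%N -> sabs (u i n - l) <= e.
  move=> n; apply: (@scalar_cauchy _ _ (fun i => u i n)) => e /uC[N NP]; exists N => i j Ni Nj.
  exact: le_trans (coord_le (u i - u j) n) (NP i j Ni Nj).
have k0 := kap_gt0 V.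
have key e : 0 < e -> exists N, forall i M, (N <= i)%N -> qnorm (trunc M (fun n => u i n - l n)) <= e.
  move=> e0; have ek : 0 < e / (kap V * 2) by rewrite divr_gt0 ?mulr_gt0.
  have [N NP] := uC _ ek; exists N => i M Ni.
  pose cM := kap V ^+ size (index_enum 'I_M) * (size (index_enum 'I_M))%:R.
  have cM0 : 0 <= cM by apply: mulr_ge0; rewrite ?exprn_ge0 ?(ltW k0) ?ler0n.
  have cM1 : 0 < cM + 1 by rewrite ltr_wpDl.
  (* The index [j] is chosen after the truncation [M] and absorbs the constant [cM] of pointwise
     convergence; [N] comes from the Cauchy property alone and does not depend on [M]. *)
  have [j [Nj jP]] : exists j, (N <= j)%N /\ forall m, (m < M)%N -> sabs (u j m - l m) <= e / (kap V * 2) / (cM + 1).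
    have /choice[J JP] := fun n => lP n _ (divr_gt0 ek cM1).
    exists (maxn N (\max_(m < M) J m)); split=> [|m mM]; first exact: leq_maxl.
    apply: JP; apply: leq_trans (leq_maxr _ _); exact: (leq_bigmax (Ordinal mM)).
  have -> : trunc M (fun n => u i n - l n) = trunc M (u i - u j) + trunc M (fun n => u j n - l n).
    apply: ellP => n; rewrite ellD !truncE ellB; case: ifP => _; last by rewrite addr0.
    by rewrite addrA subrK.
  rewrite (le_trans (qnormDk _ _))// -[leRHS](half_kap V) ler_wpM2l ?(ltW k0)// lerD//.
    exact: ((qnorm_truncP (u i - u j) _).1 (NP i j Ni Nj)).
  have ec0 : 0 <= e / (kap V * 2) / (cM + 1) by rewrite divr_ge0 ?(ltW ek)// ltW.
  apply: le_trans (qnorm_trunc_le ec0 jP) _.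
  rewrite -/cM mulrA ler_pdivrMr// [leLHS]mulrC ler_wpM2l ?(ltW ek)// lerDl.
  exact: ler01.
have l_in : (l : nat -> (scalar R k)^o) \in in_ell p.
  apply: in_ell_closure => e /key[N NP]; exists (u N) => M.
  rewrite -qnormN; apply: le_trans (NP N M (leqnn _)); rewrite le_eqVlt; apply/orP; left; apply/eqP.
  congr (qnorm _); apply: ellP => n; rewrite -[LHS]/(- (trunc M (fun n => l n - u N n) n)) /=.
  by case: ifP => _; rewrite ?oppr0 ?opprB.
exists (Ell l_in) => e /key[N NP]; exists N => i Ni.
by apply/(qnorm_truncP (u i - Ell l_in) e) => M; exact: NP.
Qed.

End EllBasics.
Arguments unitv {R k} p m.
Arguments trunc {R k} p M a.

(** * Partial reindexing of sequences *)

Lemma uniq_sub_ler_sum (R : numDomainType) (I : eqType) (s t : seq I) (F : I -> R) :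
  uniq s -> uniq t -> {subset s <= t} -> (forall i, 0 <= F i) ->
  \sum_(i <- s) F i <= \sum_(i <- t) F i.
Proof.
move=> us ut st F0; rewrite [leRHS](bigID (mem s))/= -[X in _ <= X + _]big_filter.
rewrite [X in _ <= X + _](perm_big s) ?lerDl ?sumr_ge0//.
apply: uniq_perm; rewrite ?filter_uniq// => i; rewrite mem_filter /=.
by case: (boolP (i \in s)) => // /st.
Qed.

(** Partial injections cover shifts, subsequences and columns of a double sequence at once; with the
    value 0 where they are undefined, they act as contractions on every $\ell_p$. *)
Definition pinj (f : nat -> option nat) :=
  forall m m' n, f m = Some n -> f m' = Some n -> m = m'.

Section Reindex.
Context {R : realType} {k : scalar_kind} (p : exponent R).
Implicit Types (u v : ell k p).
Variables (f : nat -> option nat).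
Hypothesis f_inj : pinj f.

Lemma pinj_inv : exists g, ocancel f g.
Proof.
have /choice[g gP] : forall n, exists m, forall m', f m' = Some n -> m' = m.
  move=> n; have [[m fm]|nm] := pselect (exists m, f m = Some n).
    by exists m => m' fm'; exact: f_inj fm' fm.
  by exists 0%N => m' fm'; case: nm; exists m'.
by exists g => m; case fm : (f m) => [n|//] /=; exact/esym/gP.
Qed.

Lemma sum_reindex_le (F : nat -> R) M : (forall n, 0 <= F n) ->
  exists L, \sum_(m < M) oapp F 0 (f m) <= \sum_(n < L) F n.
Proof.
move=> F0; have [g gK] := pinj_inv; pose s := pmap f (index_iota 0 M).
exists (\max_(n <- s) n.+1).
have -> : \sum_(m < M) oapp F 0 (f m) = \sum_(n <- s) F n by rewrite /s big_pmap big_mkord.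
rewrite -(big_mkord xpredT F); apply: uniq_sub_ler_sum => //.
- by rewrite (pmap_uniq gK)// iota_uniq.
- exact: iota_uniq.
move=> n ns; rewrite mem_index_iota /=.
exact: (@leq_bigmax_seq _ _ xpredT (fun n => n.+1)).
Qed.

Definition reseq (a : nat -> (scalar R k)^o) (m : nat) : (scalar R k)^o := oapp a 0 (f m).

Lemma psec_reseq r a M : 0 < r -> psec r M (reseq a) = \sum_(m < M) oapp (fun n => sabs (a n) `^ r) 0 (f m).
Proof.
move=> r0; apply: eq_bigr => m _; rewrite /reseq; case: (f m) => //=.
by rewrite sabs0 powR0// gt_eqF.
Qed.

Fact reseq_in_ell a : a \in in_ell p -> reseq a \in in_ell p.
Proof.
move=> ap; have [[r r0 pr]|pi] := exponentP p.
  have [c ac] := (in_ell_fin a pr).1 ap; apply/(in_ell_fin _ pr); exists c => M.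
  rewrite psec_reseq//; have [L] := sum_reindex_le M (fun n => powR_ge0 (sabs (a n)) r).
  by move=> /le_trans; apply; exact: ac.
apply/(in_ell_inf _ pi) => e e0; have [N NP] := (in_ell_inf a pi).1 ap _ e0.
have [g gK] := pinj_inv.
exists (\max_(n < N) (g n).+1) => m Nm; rewrite /reseq.
case fm : (f m) => [n|] /=; last by rewrite sabs0 ltW.
have [nN|/NP//] := ltnP n N.
have := @leq_bigmax _ (fun i : 'I_N => (g i).+1) (Ordinal nN) => /=.
have gn : g n = m by have := gK m; rewrite fm.
by move=> /leq_trans/(_ Nm); rewrite gn ltnn.
Qed.

Definition reix u : ell k p := Ell (reseq_in_ell (ell_seqP u)).

Lemma reixE u m : reix u m = oapp u 0 (f m).
Proof. by []. Qed.

Lemma reix_lin : linear reix.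
Proof.
move=> a u v; apply: ellP => m; rewrite ellD ellZ !reixE.
by case: (f m) => //=; rewrite mulr0 addr0.
Qed.

Lemma qnorm_reix u : qnorm (reix u) <= qnorm u.
Proof.
have u0 := qnorm_ge0 u; have [[r r0 pr]|pi] := exponentP p; last first.
  apply/(qnorm_infP _ pi u0) => m; rewrite reixE; case: (f m) => [n|] /=; rewrite ?sabs0//.
  exact: coord_le.
apply/(qnorm_finP _ pr r0 u0) => M; rewrite psec_reseq//.
have [L] := sum_reindex_le M (fun n => powR_ge0 (sabs (u n)) r).
by move=> /le_trans; apply; exact: psec_qnorm.
Qed.

End Reindex.

(** * Norms of sums of almost disjoint vectors *)

Section PowerEstimates.
Context {R : realType}.

(** With t defined by $(1+t)^r=1+e$, either $y\le tx$ and the first term suffices, or $x<y/t$ and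
    the second does with $C=(1+1/t)^r$. No convexity is involved, so r may be below 1. *)
Lemma powR_addle (r e : R) : 0 < r -> 0 < e -> exists2 C, 0 <= C &
  forall x y, 0 <= x -> 0 <= y -> (x + y) `^ r <= (1 + e) * x `^ r + C * y `^ r.
Proof.
move=> r0 e0; have e1 : 0 < 1 + e by rewrite addr_gt0.
pose t := (1 + e) `^ r^-1 - 1.
have t0 : 0 < t.
  have one : 1 = 1 `^ r^-1 :> R by rewrite powR1.
  by rewrite subr_gt0 [ltLHS]one gt0_ltr_powR ?invr_gt0 ?nnegrE ?(ltW e1)// ltrDl.
exists ((1 + t^-1) `^ r) => [|x y x0 y0]; first exact: powR_ge0.
have [yx|xy] := leP y (t * x).
  apply: (@le_trans _ _ ((1 + e) * x `^ r)); last by rewrite lerDl mulr_ge0 ?powR_ge0.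
  have -> : (1 + e) * x `^ r = ((1 + e) `^ r^-1 * x) `^ r.
    by rewrite powRM ?powR_ge0// -powRrM mulVf ?gt_eqF// powRr1// ltW.
  rewrite powR_le_root ?addr_ge0 ?mulr_ge0 ?powR_ge0//.
  have -> : (1 + e) `^ r^-1 = 1 + t by rewrite /t [RHS]addrC subrK.
  by rewrite mulrDl mul1r lerD2l.
apply: (@le_trans _ _ ((1 + t^-1) `^ r * y `^ r)); last first.
  by rewrite lerDr mulr_ge0 ?powR_ge0// ltW.
have ti : 0 <= t^-1 by rewrite invr_ge0 ltW.
rewrite -powRM ?addr_ge0// powR_le_root ?mulr_ge0 ?addr_ge0//.
by rewrite mulrDl mul1r addrC lerD2l ler_pdivlMl// ltW.
Qed.

Lemma powR_small (r d : R) : 0 < r -> 0 < d -> exists2 x, 0 < x & x `^ r <= d.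
Proof.
move=> r0 d0; exists (d `^ r^-1); first exact: powR_gt0.
by rewrite -powRrM mulVf ?gt_eqF// powRr1// ltW.
Qed.

End PowerEstimates.

Section AlmostDisjoint.
Context {R : realType} {k : scalar_kind}.

Definition null (p : exponent R) M (eta : R) (v : ell k p) :=
  forall n, (n < M)%N -> sabs (v n) <= eta.

Lemma tail_small (p : exponent R) r (w : ell k p) d : val p = r%:E -> 0 < r -> 0 < d ->
  exists M, qnorm w `^ r - psec r M w <= d.
Proof.
move=> pr r0 d0; apply: contrapT => /forallNP H.
have : qnorm w `^ r <= qnorm w `^ r - d.
  apply/(qnorm_powP _ _ pr r0) => M; apply/ltW.
  by have /negP := H M; rewrite -ltNge ltrBrDr -ltrBrDl.
by rewrite lerBrDr gerDl leNgt d0.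
Qed.

Lemma sum_mixed_le (p : exponent R) r (w : ell k p) M b (beta : R) L :
  val p = r%:E -> 0 < r -> 0 <= beta ->
  (forall n, (n < M)%N -> b n <= beta) ->
  \sum_(n < L) (if (n < M)%N then b n else sabs (w n) `^ r) <=
  M%:R * beta + (qnorm w `^ r - psec r M w).
Proof.
move=> pr r0 b0 bb.
apply: (@le_trans _ _ (\sum_(n < maxn L M) (if (n < M)%N then Num.max 0 (b n) else sabs (w n) `^ r))).
  rewrite -(subnKC (leq_maxl L M)) big_split_ord /=.
  rewrite -[leLHS]addr0 lerD ?sumr_ge0// => [|n _].
    by apply: ler_sum => n _; case: ifP => // _; rewrite le_max lexx orbT.
  by case: ifP => _; rewrite ?powR_ge0// le_max lexx.
rewrite -(subnKC (leq_maxr L M)) big_split_ord /= lerD//.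
  rewrite -[M in leRHS]card_ord -sum1_card natr_sum mulr_suml.
  apply: ler_sum => n _; rewrite ltn_ord mul1r ge_max b0 bb//.
rewrite lerBrDr addrC; apply: le_trans (psec_qnorm w (maxn L M) pr r0).
rewrite /psec -[in leRHS](subnKC (leq_maxr L M)) [leRHS]big_split_ord /= lerD2l.
by apply: ler_sum => n _; rewrite ltnNge leq_addr.
Qed.

(** Up to a small tail, [v] lives on its first [M] coordinates, where [v'] is tiny, so the s-th
    powers of the norms almost add. In c_0 the norm of the sum is nearly the larger of the two
    norms, so every s is allowed. *)
Lemma bl_upper (p : exponent R) s (v : ell k p) e : 0 < s -> val p = s%:E \/ val p = +oo%E ->
  0 < e -> exists M, exists2 eta, 0 < eta & forall v', null M eta v' ->
  qnorm (v + v') `^ s <= (1 + e) * (qnorm v `^ s + qnorm v' `^ s) + e.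
Proof.
move=> s0 ps e0; have [C C0 CP] := powR_addle s0 e0.
have e1 : 0 < 1 + e by rewrite addr_gt0.
have d0 : 0 < e / (C + 1) by rewrite divr_gt0// ltr_wpDl.
case: ps => [ps|pi]; last first.
  have [eta eta0 etaP] := powR_small s0 d0.
  have [M MP] := (in_ell_inf v pi).1 (ell_seqP v) _ eta0.
  exists M, eta => // v' v'M; pose mx := Num.max (qnorm v) (qnorm v').
  have mx0 : 0 <= mx by rewrite le_max qnorm_ge0.
  have nv : qnorm (v + v') <= mx + eta.
    apply/(qnorm_infP _ pi); first by rewrite addr_ge0// ltW.
    move=> n; rewrite ellD (le_trans (le_sabsD _ _))//.
    have [nM|/MP vn] := ltnP n M.
      by rewrite lerD ?v'M// (le_trans (coord_le v n))// le_max lexx.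
    by rewrite addrC lerD// (le_trans (coord_le v' n))// le_max lexx orbT.
  apply: (@le_trans _ _ ((mx + eta) `^ s)).
    by rewrite powR_le_root ?qnorm_ge0 ?addr_ge0// ltW.
  apply: le_trans (CP _ _ mx0 (ltW eta0)) _; rewrite lerD//.
    rewrite ler_wpM2l ?(ltW e1)// /mx; case: (leP (qnorm v)) => _.
      by rewrite lerDr powR_ge0.
    by rewrite lerDl powR_ge0.
  apply: le_trans (ler_wpM2l C0 etaP) _.
  by rewrite mulrA ler_pdivrMr ?ltr_wpDl// mulrC ler_wpM2l ?(ltW e0)// lerDl.
have [M MP] := tail_small v ps s0 (divr_gt0 d0 (ltr0Sn R 1)).
have M1 : 0 < M%:R + 1 :> R by rewrite ltr_wpDl.
have [eta eta0 etaP] := powR_small s0 (divr_gt0 (divr_gt0 d0 (ltr0Sn R 1)) M1).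
exists M, eta => // v' v'M; apply/(qnorm_powP _ _ ps s0) => L.
pose m n := if (n < M)%N then sabs (v' n) `^ s else sabs (v n) `^ s.
apply: (@le_trans _ _ ((1 + e) * (psec s L v + psec s L v') + C * \sum_(n < L) m n)).
  rewrite /psec -big_split !mulr_sumr -big_split; apply: ler_sum => n _ /=.
  apply: (@le_trans _ _ ((sabs (v n) + sabs (v' n)) `^ s)).
    by rewrite powR_le_root ?sabs_ge0 ?addr_ge0 ?sabs_ge0//; exact: le_sabsD.
  rewrite /m; case: ifP => _.
    apply: le_trans (CP _ _ (sabs_ge0 _) (sabs_ge0 _)) _.
    by rewrite lerD2r ler_wpM2l ?(ltW e1)// lerDl powR_ge0.
  rewrite [sabs (v n) + _]addrC; apply: le_trans (CP _ _ (sabs_ge0 _) (sabs_ge0 _)) _.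
  by rewrite lerD2r ler_wpM2l ?(ltW e1)// lerDr powR_ge0.
rewrite lerD//; first by rewrite ler_wpM2l ?(ltW e1)// lerD// psec_qnorm.
have mL : \sum_(n < L) m n <= e / (C + 1).
  rewrite [leRHS]splitr.
  apply: le_trans (@sum_mixed_le p s v M (fun n => sabs (v' n) `^ s) _ L ps s0 (powR_ge0 eta s) _) _.
    by move=> n nM; rewrite powR_le_root ?sabs_ge0 ?v'M// ltW.
  rewrite lerD//; apply: (@le_trans _ _ ((M%:R + 1) * eta `^ s)).
    by rewrite ler_wpM2r ?powR_ge0// lerDl.
  by rewrite mulrC -ler_pdivlMr.
apply: le_trans (ler_wpM2l C0 mL) _.
by rewrite mulrA ler_pdivrMr ?ltr_wpDl// mulrC ler_wpM2l ?(ltW e0)// lerDl.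
Qed.

(** At each coordinate one of [w] and [w'] is negligible, so the other is compared with the total.
    The extra [t] makes room for the cross terms that appear when humps are added. *)
Lemma bl_lower (p : exponent R) r (w : ell k p) e : 0 < r -> val p = r%:E ->
  0 < e -> exists M, exists2 eta, 0 < eta & forall w' t, null M eta w' -> qnorm t <= eta ->
  qnorm w `^ r + qnorm w' `^ r <= (1 + e) * qnorm (w + w' + t) `^ r + e.
Proof.
move=> r0 pr e0; have [C C0 CP] := powR_addle r0 e0.
have [D D0 DP] := powR_addle r0 (@ltr01 R).
have e1 : 0 < 1 + e by rewrite addr_gt0.
(* [C] is the price of removing a perturbation y + t, [2 + D] that of separating the powers of y and
   t, and the final 1 returns the small term of the pair. *)
pose B := C * (2 + D) + 1; have B0 : 0 < B by rewrite ltr_wpDl// mulr_ge0// addr_ge0.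
have d0 : 0 < e / B / 2 by rewrite !divr_gt0.
have [M MP] := tail_small w pr r0 d0.
have M1 : 0 < M%:R + 1 :> R by rewrite ltr_wpDl.
have [eta eta0 etaP] := powR_small r0 (divr_gt0 d0 M1).
exists M, eta => // w' t w'M tM; set tot := w + w' + t.
pose m n := if (n < M)%N then sabs (w' n) `^ r else sabs (w n) `^ r.
have step L : psec r L w + psec r L w' <= (1 + e) * psec r L tot + B * (\sum_(n < L) m n + psec r L t).
  rewrite /psec -!big_split !mulr_sumr -!big_split; apply: ler_sum => n _.
  rewrite -[leLHS]/(sabs (w n) `^ r + sabs (w' n) `^ r).
  rewrite -[leRHS]/((1 + e) * sabs (w n + w' n + t n) `^ r + B * (m n + sabs (t n) `^ r)).
  have aux x y : sabs x `^ r <= (1 + e) * sabs (x + y + t n) `^ r + C * ((2 + D) * (sabs y `^ r + sabs (t n) `^ r)).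
    apply: (@le_trans _ _ ((sabs (x + y + t n) + (sabs y + sabs (t n))) `^ r)).
      rewrite powR_le_root ?addr_ge0 ?sabs_ge0//.
      rewrite -{1}[x](addrK (y + t n)) addrA (le_trans (le_sabsD _ _))// lerD2l sabsN.
      exact: le_sabsD.
    apply: le_trans (CP _ _ (sabs_ge0 _) (addr_ge0 (sabs_ge0 _) (sabs_ge0 _))) _.
    rewrite lerD2l ler_wpM2l//; apply: le_trans (DP _ _ (sabs_ge0 _) (sabs_ge0 _)) _.
    have y0 := powR_ge0 (sabs y) r; have z0 := powR_ge0 (sabs (t n)) r.
    have h1 := mulr_ge0 D0 y0; have h2 := mulr_ge0 D0 z0; nra.
  have t0 := powR_ge0 (sabs (t n)) r.
  rewrite /m; case: ifP => _.
    have := aux (w n) (w' n); set X := sabs (w n) `^ r; set Y := sabs (w' n) `^ r; rewrite /B.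
    set Z := C * (2 + D); move=> h; rewrite -/Z mulrA -/Z in h *; nra.
  have := aux (w' n) (w n); rewrite [w' n + w n]addrC.
  set X := sabs (w n) `^ r; set Y := sabs (w' n) `^ r; rewrite /B.
  set Z := C * (2 + D); move=> h; rewrite -/Z mulrA -/Z in h *; nra.
have main L : psec r L w + psec r L w' <= (1 + e) * qnorm tot `^ r + e.
  apply: le_trans (step L) _; rewrite lerD//; first by rewrite ler_wpM2l ?(ltW e1)// psec_qnorm.
  rewrite mulrC -ler_pdivlMr//.
  have mL : \sum_(n < L) m n <= M%:R * eta `^ r + (qnorm w `^ r - psec r M w).
    apply: (@sum_mixed_le p r w M (fun n => sabs (w' n) `^ r)) => //; first exact: powR_ge0.
    by move=> n nM; rewrite powR_le_root ?sabs_ge0 ?w'M// ltW.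
  have tL : psec r L t <= eta `^ r.
    by apply: le_trans (psec_qnorm t L pr r0) _; rewrite powR_le_root ?qnorm_ge0// ltW.
  have eP : (M%:R + 1) * eta `^ r <= e / B / 2 by rewrite mulrC -ler_pdivlMr.
  have -> : e / B = e / B / 2 + e / B / 2 by rewrite -splitr.
  move: mL tL eP MP; rewrite mulrDl mul1r; set X := M%:R * _; set Y := eta `^ r.
  by set Z := e / B / 2; set W := qnorm w `^ r - _; lra.
rewrite -lerBrDr; apply/(qnorm_powP _ _ pr r0) => L1.
rewrite lerBrDr -lerBrDl; apply/(qnorm_powP _ _ pr r0) => L2.
rewrite lerBrDl; apply: le_trans (main (maxn L1 L2)).
by rewrite lerD// psec_le// ?leq_maxl ?leq_maxr.
Qed.

End AlmostDisjoint.

(** * Rademacher chaos of order two *)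

Section Signs.
Context {R : realType}.
Implicit Types (F G : (nat -> bool) -> R) (e : nat -> bool).

Definition sg (b : bool) : R := (-1) ^+ b.

Definition upd e m b := fun i : nat => if i == m then b else e i.

(** Expectation over independent uniform signs at the indices below [n]; the values of [e] at the
    other indices are kept. *)
Fixpoint mean n F e : R :=
  if n is m.+1 then (mean m F (upd e m true) + mean m F (upd e m false)) / 2 else F e.

Lemma mean_le n F G e : (forall e, F e <= G e) -> mean n F e <= mean n G e.
Proof.
by move=> FG; elim: n e => //= n IH e; rewrite ler_pM2r ?invr_gt0// lerD.
Qed.

Lemma mean_lin n (a : R) F G e : mean n (fun e => a * F e + G e) e = a * mean n F e + mean n G e.
Proof. by elim: n e => //= n IH e; rewrite !IH; field. Qed.

Lemma mean_cst n c e : mean n (fun=> c) e = c.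
Proof. by elim: n e => //= n IH e; rewrite !IH; field. Qed.

Lemma meanZ n a F e : mean n (fun e => a * F e) e = a * mean n F e.
Proof.
by rewrite -[RHS]addr0 -(mean_cst n 0 e) -mean_lin; congr mean; apply/funext => ?; rewrite addr0.
Qed.

Lemma meanD n F G e : mean n (fun e => F e + G e) e = mean n F e + mean n G e.
Proof.
by rewrite -[X in X + _]mul1r -mean_lin; congr mean; apply/funext => ?; rewrite mul1r.
Qed.

Lemma mean_sum n M (F : nat -> (nat -> bool) -> R) e :
  mean n (fun e => \sum_(m < M) F m e) e = \sum_(m < M) mean n (F m) e.
Proof.
elim: M => [|M IH].
  by rewrite big_ord0 -[RHS](mean_cst n 0 e); congr mean; apply/funext => ?; rewrite big_ord0.
by rewrite big_ord_recr /= -IH -meanD; congr mean; apply/funext => ?; rewrite big_ord_recr.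
Qed.

Lemma mean_ext n F G e : (forall e', (forall i, (n <= i)%N -> e' i = e i) -> F e' = G e') ->
  mean n F e = mean n G e.
Proof.
elim: n e => [|n IH] e /= FG; first exact: FG.
have h b : mean n F (upd e n b) = mean n G (upd e n b).
  apply: IH => e' ee'; apply: FG => i ni; rewrite ee' ?(ltnW ni)// /upd gtn_eqF//.
by rewrite !h.
Qed.

Definition indep n F := forall e e', (forall i, (i < n)%N -> e i = e' i) -> F e = F e'.

Lemma mean_indep n F e e' : indep n F -> mean n F e = mean n F e'.
Proof.
suff H m f f' : (forall i, (m <= i < n)%N -> f i = f' i) -> indep n F -> mean m F f = mean m F f'.
  by apply: H => i /andP[ni /(leq_ltn_trans ni)]; rewrite ltnn.
elim: m f f' => [|m IH] f f' ff' FI /=; first by apply: FI => i ?; apply: ff'.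
have h b : mean m F (upd f m b) = mean m F (upd f' m b).
  apply: IH => // i /andP[mi ni]; rewrite /upd; case: eqVneq => // im.
  by rewrite ff'// ni andbT ltn_neqAle eq_sym im.
by rewrite !h.
Qed.

(** Conditioning on the sign of largest index: the induction step for every moment below, with [f] a
    power or the identity. *)
Lemma mean_step n (f : R -> R) F G e : indep n F -> indep n G ->
  mean n.+1 (fun e => f (F e + sg (e n) * G e)) e =
  mean n (fun e => (f (F e + G e) + f (F e - G e)) / 2) e.
Proof.
move=> FI GI /=.
have h b : mean n (fun e => f (F e + sg (e n) * G e)) (upd e n b) =
    mean n (fun e => f (F e + sg b * G e)) e.
  rewrite -(@mean_indep n (fun e => f (F e + sg b * G e)) (upd e n b)); last first.
    by move=> f1 f2 f12; rewrite (FI _ _ f12) (GI _ _ f12).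
  by apply: mean_ext => e' /(_ n (leqnn n)) ->; rewrite /upd eqxx.
rewrite !h /sg /= mulrC -meanD -meanZ; congr mean; apply/funext => f1.
by rewrite mul1r expr1 mulN1r addrC mulrC.
Qed.

Lemma mean_CS n F G e :
  mean n (fun e => F e * G e) e ^+ 2 <= mean n (fun e => F e ^+ 2) e * mean n (fun e => G e ^+ 2) e.
Proof.
set a := mean n (fun e => F e ^+ 2) e; set c := mean n (fun e => G e ^+ 2) e.
set b := mean n _ e.
have disc t : 0 <= a - 2 * t * b + t ^+ 2 * c.
  rewrite -(mean_cst n 0 e); apply: (@le_trans _ _ (mean n (fun e => (F e - t * G e) ^+ 2) e)).
    by apply: mean_le => f; exact: sqr_ge0.
  rewrite le_eqVlt; apply/orP; left; apply/eqP.
  transitivity (mean n (fun e => (- 2 * t) * (F e * G e) + (t ^+ 2 * G e ^+ 2 + F e ^+ 2)) e).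
    by congr mean; apply/funext => f; ring.
  by rewrite mean_lin mean_lin -/a -/b -/c; ring.
have c0 : 0 <= c by rewrite -(mean_cst n 0 e); apply: mean_le => f; exact: sqr_ge0.
have [cz|cz] := eqVneq c 0.
  (* For c = 0 the quadratic is affine in t, and at this t it equals -1 unless b = 0. *)
  rewrite cz mulr0; have := disc ((a + 1) / (2 * b)); rewrite cz mulr0 addr0.
  have [->|bz] := eqVneq b 0; first by rewrite expr0n.
  by have -> : 2 * ((a + 1) / (2 * b)) * b = a + 1; [field|lra].
have cp : 0 < c by rewrite lt_neqAle eq_sym cz.
have := disc (b / c).
have -> : a - 2 * (b / c) * b + (b / c) ^+ 2 * c = (a * c - b ^+ 2) / c by field.
by rewrite ler_pdivlMr// mul0r subr_ge0.
Qed.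

Definition lform n (d : nat -> R) e : R := \sum_(i < n) sg (e i) * d i.

Definition qform n (c : nat -> nat -> R) e : R := \sum_(i < n) \sum_(j < n) sg (e i) * sg (e j) * c i j.

Lemma lform_indep n d : indep n (lform n d).
Proof. by move=> e e' ee'; apply: eq_bigr => i _; rewrite ee'. Qed.

Lemma qform_indep n c : indep n (qform n c).
Proof. by move=> e e' ee'; apply: eq_bigr => i _; apply: eq_bigr => j _; rewrite !ee'. Qed.

Lemma sg2 b : sg b * sg b = 1.
Proof. by rewrite /sg; case: b; rewrite ?expr1 ?expr0 ?mulrNN mulr1. Qed.

(** Squares of signs are 1, so the form is affine in its last sign and the diagonal entry becomes a
    constant. *)
Lemma qformS n c e : qform n.+1 c e =
  qform n c e + c n n + sg (e n) * lform n (fun i => c i n + c n i) e.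
Proof.
rewrite /qform /lform big_ord_recr /= big_ord_recr /= sg2 mul1r.
under eq_bigr do rewrite big_ord_recr /=.
rewrite big_split /= mulr_sumr.
have -> : \sum_(i < n) sg (e n) * (sg (e i) * (c i n + c n i)) =
    \sum_(i < n) sg (e i) * sg (e n) * c i n + \sum_(i < n) sg (e n) * sg (e i) * c n i.
  by rewrite -big_split /=; apply: eq_bigr => i _; ring.
set a := \sum_(i < n) \sum_(j < n) _; set b := \sum_(i < n) _; set d := \sum_(i < n) _.
ring.
Qed.

(** Khinchine's inequality with the Gaussian constant 3. With x the second moment and y the square
    of the new coefficient, the induction needs $3x^2+6xy+y^2\le3(x+y)^2$. *)
Lemma lform_moment4 n d e :
  mean n (fun e => lform n d e ^+ 4) e <= 3 * mean n (fun e => lform n d e ^+ 2) e ^+ 2.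
Proof.
elim: n => [|n IH]; first by rewrite /= /lform big_ord0 !expr0n/= mulr0.
have dI : indep n (fun=> d n) by [].
have lE : lform n.+1 d = fun e => lform n d e + sg (e n) * d n.
  by apply/funext => f; rewrite /lform big_ord_recr.
rewrite lE (mean_step (fun x => x ^+ 4) e (lform_indep d) dI).
rewrite (mean_step (fun x => x ^+ 2) e (lform_indep d) dI).
set x := mean n (fun e => lform n d e ^+ 2) e in IH.
have -> : mean n (fun e => ((lform n d e + d n) ^+ 2 + (lform n d e - d n) ^+ 2) / 2) e = x + d n ^+ 2.
  rewrite -[d n ^+ 2](mean_cst n _ e) -meanD; congr mean; apply/funext => f; by field.
have -> : mean n (fun e => ((lform n d e + d n) ^+ 4 + (lform n d e - d n) ^+ 4) / 2) e =
    mean n (fun e => lform n d e ^+ 4) e + (6 * d n ^+ 2 * x + d n ^+ 4).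
  rewrite -[d n ^+ 4](mean_cst n _ e) -meanZ -!meanD; congr mean; apply/funext => f; by field.
have x0 : 0 <= x by rewrite -(mean_cst n 0 e); apply: mean_le => f; exact: sqr_ge0.
have y0 := sqr_ge0 (d n); rewrite (_ : d n ^+ 4 = (d n ^+ 2) ^+ 2); last by rewrite -exprM.
set y := d n ^+ 2 in y0 *; nra.
Qed.

(* Bonami's hypercontractive estimate for chaos of order two, L4 against L2. *)
Lemma qform_moment4 n c a e :
  mean n (fun e => (qform n c e + a) ^+ 4) e <= 81 * mean n (fun e => (qform n c e + a) ^+ 2) e ^+ 2.
Proof.
elim: n a => [|n IH] a.
  rewrite /= /qform big_ord0 add0r; have := sqr_ge0 (a ^+ 2).
  by rewrite -!exprM => ?; lra.
(* The diagonal entry joins the constant [a]; this is why the induction carries a constant term. *)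
pose g f := qform n c f + (c n n + a); pose d i := c i n + c n i.
have gI : indep n g by move=> f f' ff'; rewrite /g (qform_indep c ff').
have lI : indep n (lform n d) := lform_indep d.
have qE : (fun e => qform n.+1 c e + a) = fun e => g e + sg (e n) * lform n d e.
  by apply/funext => f; rewrite qformS /g /d; ring.
have [-> ->] : (fun e => (qform n.+1 c e + a) ^+ 4) = (fun e => (g e + sg (e n) * lform n d e) ^+ 4) /\
    (fun e => (qform n.+1 c e + a) ^+ 2) = (fun e => (g e + sg (e n) * lform n d e) ^+ 2).
  by split; apply/funext => f; have -> := congr1 (fun h => h f) qE.
rewrite (mean_step (fun x => x ^+ 4) e gI lI) (mean_step (fun x => x ^+ 2) e gI lI).
have := IH (c n n + a); rewrite -/g.
have := lform_moment4 n d e.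
set x := mean n (fun e => (qform n c e + (c n n + a)) ^+ 2) e.
set y := mean n (fun e => lform n d e ^+ 2) e => L4 G4.
have -> : mean n (fun e => ((g e + lform n d e) ^+ 2 + (g e - lform n d e) ^+ 2) / 2) e = x + y.
  by rewrite -meanD; congr mean; apply/funext => f; rewrite /g; by field.
have -> : mean n (fun e => ((g e + lform n d e) ^+ 4 + (g e - lform n d e) ^+ 4) / 2) e =
    mean n (fun e => g e ^+ 4) e + (6 * mean n (fun e => g e ^+ 2 * lform n d e ^+ 2) e +
    mean n (fun e => lform n d e ^+ 4) e).
  by rewrite -meanZ -!meanD; congr mean; apply/funext => f; by field.
have x0 : 0 <= x by rewrite -(mean_cst n 0 e); apply: mean_le => f; exact: sqr_ge0.
have y0 : 0 <= y by rewrite -(mean_cst n 0 e); apply: mean_le => f; exact: sqr_ge0.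
have := mean_CS n (fun e => g e ^+ 2) (fun e => lform n d e ^+ 2) e.
have -> : mean n (fun e => (g e ^+ 2) ^+ 2) e = mean n (fun e => g e ^+ 4) e.
  by congr mean; apply/funext => f; rewrite -exprM.
have -> : mean n (fun e => (lform n d e ^+ 2) ^+ 2) e = mean n (fun e => lform n d e ^+ 4) e.
  by congr mean; apply/funext => f; rewrite -exprM.
move: G4 L4; rewrite -/g; set X := mean n (fun e => g e ^+ 4) e; set Y := mean n (fun e => lform n d e ^+ 4) e.
set Z := mean n _ e => G4 L4 CS.
have X0 : 0 <= X by rewrite -(mean_cst n 0 e); apply: mean_le => f; rewrite exprn_even_ge0.
have Y0 : 0 <= Y by rewrite -(mean_cst n 0 e); apply: mean_le => f; rewrite exprn_even_ge0.
(* By Cauchy-Schwarz $Z^2\le 81\cdot3\,x^2y^2$, and 243 is at most $16^2$. The fourth moment is then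
   at most $81x^2+96xy+3y^2$, within $81(x+y)^2$. *)
have Z1 : Z <= 16 * x * y.
  have h1 : X * Y <= (81 * x ^+ 2) * (3 * y ^+ 2) by rewrite ler_pM.
  have h2 : Z ^+ 2 <= (16 * x * y) ^+ 2.
    apply: le_trans CS _; apply: le_trans h1 _; rewrite !exprMn.
    have := mulr_ge0 (sqr_ge0 x) (sqr_ge0 y); set w := x ^+ 2 * y ^+ 2 => w0.
    have -> : 81 * x ^+ 2 * (3 * y ^+ 2) = 243 * w by rewrite /w; ring.
    by have -> : 16 ^+ 2 * x ^+ 2 * y ^+ 2 = 256 * w; [rewrite /w; ring|lra].
  have z0 : 0 <= 16 * x * y by rewrite !mulr_ge0.
  have Z0 : 0 <= Z.
    by rewrite -(mean_cst n 0 e); apply: mean_le => f; rewrite mulr_ge0 ?sqr_ge0.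
  by rewrite -ler_sqr ?nnegrE.
have := mulr_ge0 x0 y0; have := sqr_ge0 y; nra.
Qed.

Lemma mean_qform n c a e : mean n (fun e => qform n c e + a) e = \sum_(i < n) c i i + a.
Proof.
elim: n a => [|n IH] a; first by rewrite /= /qform !big_ord0.
pose g f := qform n c f + (c n n + a); pose d i := c i n + c n i.
have gI : indep n g by move=> f f' ff'; rewrite /g (qform_indep c ff').
have -> : (fun e => qform n.+1 c e + a) = fun e => g e + sg (e n) * lform n d e.
  by apply/funext => f; rewrite qformS /g /d; ring.
rewrite (mean_step id e gI (lform_indep d)) big_ord_recr /= -addrA -IH.
by congr mean; apply/funext => f; rewrite /g; by field.
Qed.

(** The trace is the mean of the form, since distinct signs are uncorrelated. For q at least 1 a
    linear minorant of the power bounds the q-th moment from below; for q < 1 the fourth moment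
    prevents the mass of the square from concentrating on large values. *)
Lemma real_chaos (q : R) : 0 < q -> exists2 C, 0 <= C & forall n (c : nat -> nat -> R) e,
  `|\sum_(i < n) c i i| `^ q <= C * mean n (fun e => `|qform n c e| `^ q) e.
Proof.
have [B B0 BE] : exists2 B : R, 0 <= B & B = 324 by exists 324; rewrite ?ler0n.
move=> q0; exists (2 `^ q + B) => [|n c e]; first by rewrite addr_ge0 ?powR_ge0.
set A := mean n _ e; set mu := `|_|.
have A0 : 0 <= A by rewrite -(mean_cst n 0 e); apply: mean_le => f; exact: powR_ge0.
have [mu0|mup] := leP mu 0.
  have -> : mu = 0 by apply/eqP; rewrite eq_le mu0 normr_ge0.
  by rewrite powR0 ?gt_eqF// mulr_ge0// addr_ge0 ?powR_ge0.
have mean0 : mean n (qform n c) e = \sum_(i < n) c i i.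
  rewrite -[RHS]addr0 -(mean_qform n c 0 e); congr mean; apply/funext => f; rewrite addr0//.
have mean_abs : mu <= mean n (fun e => `|qform n c e|) e.
  rewrite /mu -mean0 ler_norml -[X in X <= _ <= _]mulN1r -meanZ; apply/andP; split.
    by apply: mean_le => f; rewrite mulN1r lerNl ler_normr lexx orbT.
  by apply: mean_le => f; exact: ler_norm.
have [q1|q1] := leP 1 q.
  pose l := mu / 2; have l0 : 0 < l by rewrite divr_gt0.
  (* Taking means in this affine minorant with $l=\mu/2$ leaves $l^{q-1}(\mu-l)=l^q$ on the left. *)
  have pw t : 0 <= t -> l `^ (q - 1) * t + - (l `^ (q - 1) * l) <= t `^ q.
    move=> t0; rewrite -mulrBr; have [tl|lt] := leP t l.
      by apply: le_trans (powR_ge0 t q); rewrite mulr_ge0_le0 ?powR_ge0// subr_le0.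
    rewrite -(mulr_powRB1 t0 q0) mulrC.
    apply: (@le_trans _ _ (t * l `^ (q - 1))).
      by rewrite ler_wpM2r ?powR_ge0// gerBl ltW.
    rewrite ler_wpM2l// ge0_ler_powR ?nnegrE ?subr_ge0 ?(ltW l0)//; exact: ltW.
  have lA : l `^ q <= A.
    apply: (@le_trans _ _ (mean n (fun e => l `^ (q - 1) * `|qform n c e| + - (l `^ (q - 1) * l)) e)); last first.
      by apply: mean_le => f; exact: pw.
    rewrite mean_lin mean_cst -mulrBr -(mulr_powRB1 (ltW l0) q0) mulrC ler_wpM2l ?powR_ge0//.
    by rewrite lerBrDr; apply: le_trans mean_abs; rewrite /l -splitr.
  have -> : mu = 2 * l by rewrite /l mulrC divfK.
  rewrite powRM ?(ltW l0)//; apply: (@le_trans _ _ (2 `^ q * A)); first by rewrite ler_wpM2l ?powR_ge0.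
  by rewrite ler_wpM2r// lerDl.
pose s2 := mean n (fun e => qform n c e ^+ 2) e.
have mus : mu ^+ 2 <= s2.
  have := mean_CS n (qform n c) (fun=> 1) e; rewrite /= (mean_cst n (1 ^+ 2)) expr1n mulr1 /mu real_normK ?num_real// -mean0.
  apply: le_trans; rewrite le_eqVlt; apply/orP; left; apply/eqP; congr (_ ^+ 2).
  by congr mean; apply/funext => f; rewrite mulr1.
have s20 : 0 < s2 by apply: lt_le_trans mus; rewrite exprn_gt0.
(* The factor 162 is twice 81: in $t^2\le l^{2-q}|t|^q+l^{-2}t^4$ the fourth moment then contributes
   at most half of [s2]. What remains gives $l^2\le324\,l^{2-q}A$, the origin of the constant
   324. *)
have [l l0 l2] : exists2 l : R, 0 < l & l ^+ 2 = 162 * s2.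
  have h : 0 < 162 * s2 by lra.
  by exists (Num.sqrt (162 * s2)); [rewrite sqrtr_gt0|rewrite sqr_sqrtr ?(ltW h)].
have pwE t : 0 < t -> t `^ (2 - q) * t `^ q = t ^+ 2.
  by move=> t0; rewrite -powRD ?subrK ?powR_mulrn// ?(ltW t0)// (gt_eqF t0) implybT.
have pw t : t ^+ 2 <= l `^ (2 - q) * `|t| `^ q + (l ^+ 2)^-1 * t ^+ 4.
  have t4 : 0 <= t ^+ 4 by rewrite exprn_even_ge0.
  have li : 0 <= (l ^+ 2)^-1 by rewrite invr_ge0 exprn_ge0// ltW.
  have [tl|lt] := leP `|t| l; last first.
    apply: (@le_trans _ _ ((l ^+ 2)^-1 * t ^+ 4)); last by rewrite lerDr mulr_ge0 ?powR_ge0.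
    rewrite ler_pdivlMl ?exprn_gt0// -[t ^+ 4]/(t ^+ (2 + 2)) exprD ler_wpM2r ?sqr_ge0//.
    by rewrite -[t ^+ 2]real_normK ?num_real// lerXn2r ?nnegrE ?(ltW l0)// ltW.
  apply: (@le_trans _ _ (l `^ (2 - q) * `|t| `^ q)); last by rewrite lerDl mulr_ge0.
  have [->|tz] := eqVneq t 0; first by rewrite expr0n mulr_ge0 ?powR_ge0.
  rewrite -[t ^+ 2]real_normK ?num_real// -pwE ?normr_gt0// ler_wpM2r ?powR_ge0//.
  by rewrite ge0_ler_powR ?nnegrE ?(ltW l0)// subr_ge0; lra.
have key : s2 / 2 <= l `^ (2 - q) * A.
  have : s2 <= l `^ (2 - q) * A + (l ^+ 2)^-1 * mean n (fun e => qform n c e ^+ 4) e.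
    by rewrite /A -[X in _ + X]meanZ -mean_lin; apply: mean_le => f; exact: pw.
  have := qform_moment4 n c 0 e.
  have -> : (fun e => (qform n c e + 0) ^+ 4) = (fun e => qform n c e ^+ 4).
    by apply/funext => f; rewrite addr0.
  have -> : (fun e => (qform n c e + 0) ^+ 2) = (fun e => qform n c e ^+ 2).
    by apply/funext => f; rewrite addr0.
  rewrite -/s2 l2 => h4 h.
  have h5 : (162 * s2)^-1 * mean n (fun e => qform n c e ^+ 4) e <= s2 / 2.
    by rewrite ler_pdivrMl ?mulr_gt0//; lra.
  lra.
have mul : mu <= l.
  rewrite -ler_sqr ?nnegrE ?(ltW mup) ?(ltW l0)// l2; lra.
have lA : l `^ q <= B * A.
  rewrite BE -(ler_pM2l (powR_gt0 (2 - q) l0)) pwE// l2 mulrCA; lra.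
apply: (@le_trans _ _ (l `^ q)); first by rewrite ge0_ler_powR ?nnegrE ?(ltW q0) ?(ltW mup) ?(ltW l0).
by apply: le_trans lA _; rewrite ler_wpM2r// lerDr powR_ge0.
Qed.

End Signs.

Section Chaos.
Context {R : realType} {k : scalar_kind}.

Definition ssg (e : nat -> bool) i : scalar R k := rscal (sg (e i)).

Lemma sabs_ssg e i : sabs (ssg e i) = 1.
Proof. by rewrite /ssg sabs_rscal /sg normrX normrN1 expr1n. Qed.

(** The diagonal terms are included: they are independent of the signs and are the ones to be
    recovered. *)
Definition chaos (V : lmodType (scalar R k)) n (y : nat -> nat -> V) e : V :=
  \sum_(i < n) \sum_(j < n) (ssg e i * ssg e j) *: y i j.

Lemma scalar_chaos (q : R) : 0 < q -> exists2 C, 0 <= C &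
  forall n (c : nat -> nat -> (scalar R k)^o) e,
  sabs (\sum_(i < n) c i i) `^ q <= C * mean n (fun e => sabs (chaos n c e) `^ q) e.
Proof.
move=> q0; have [C C0 CP] := @real_chaos R q q0.
have [D D0 DP] := powR_addle q0 (@ltr01 R).
exists ((2 + D) * C) => [|n c e]; first by rewrite mulr_ge0// addr_ge0.
pose S := \sum_(i < n) c i i.
have SE : sabs S <= `|sre S| + `|sim S|.
  by have := sabs_le_smk S 0 0; rewrite !subr0 (_ : smk 0 0 = 0) ?subr0// /smk; case: k.
have re e' : sre (chaos n c e') = qform n (fun i j => sre (c i j)) e'.
  rewrite /chaos sre_sum; apply: eq_bigr => i _; rewrite sre_sum; apply: eq_bigr => j _.
  by rewrite -[_ *: _]/(ssg e' i * ssg e' j * c i j) -rscalM sreM.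
have im e' : sim (chaos n c e') = qform n (fun i j => sim (c i j)) e'.
  rewrite /chaos sim_sum; apply: eq_bigr => i _; rewrite sim_sum; apply: eq_bigr => j _.
  by rewrite -[_ *: _]/(ssg e' i * ssg e' j * c i j) -rscalM simM.
set A := mean n _ e.
have A1 : `|sre S| `^ q <= C * A.
  rewrite /S sre_sum; apply: le_trans (CP n (fun i j => sre (c i j)) e) _.
  rewrite ler_wpM2l//; apply: mean_le => f; rewrite -re powR_le_root ?sabs_ge0//; exact: sre_le.
have A2 : `|sim S| `^ q <= C * A.
  rewrite /S sim_sum; apply: le_trans (CP n (fun i j => sim (c i j)) e) _.
  rewrite ler_wpM2l//; apply: mean_le => f; rewrite -im powR_le_root ?sabs_ge0//; exact: sim_le.
apply: (@le_trans _ _ ((`|sre S| + `|sim S|) `^ q)); first by rewrite powR_le_root ?sabs_ge0 ?addr_ge0.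
apply: le_trans (DP _ _ (normr_ge0 _) (normr_ge0 _)) _.
by have := ler_wpM2l D0 A2; move: A1; nra.
Qed.

Lemma ell_sum (p : exponent R) (I : Type) (s : seq I) (y : I -> ell k p) m :
  (\sum_(i <- s) y i) m = \sum_(i <- s) (y i m : (scalar R k)^o).
Proof. by elim: s => [|i s IH]; rewrite ?big_nil// !big_cons -IH. Qed.

(** The scalar inequality is used at each coordinate with the exponent of the space itself, so that
    the mean and the sum over coordinates may be exchanged. For c_0 the exponent 1 is used
    coordinate by coordinate. *)
Lemma ell_chaos (p : exponent R) : exists2 C, 0 <= C & forall n (y : nat -> nat -> ell k p) c,
  0 <= c -> (forall e, qnorm (chaos n y e) <= c) -> qnorm (\sum_(i < n) y i i) <= C * c.
Proof.
pose e0 : nat -> bool := fun=> true.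
have coordE n (y : nat -> nat -> ell k p) m e :
    (chaos n y e) m = chaos n (fun i j => y i j m : (scalar R k)^o) e.
  by rewrite /chaos ell_sum; apply: eq_bigr => i _; rewrite ell_sum.
have [[r r0 pr]|pi] := exponentP p.
  have [C C0 CP] := scalar_chaos r0; exists (C `^ r^-1) => [|n y c c0 yc]; first exact: powR_ge0.
  apply/(qnorm_finP _ pr r0); first by rewrite mulr_ge0 ?powR_ge0.
  move=> M; rewrite powRM ?powR_ge0// -powRrM mulVf ?gt_eqF// powRr1//.
  apply: (@le_trans _ _ (\sum_(m < M) C * mean n (fun e => sabs (chaos n (fun i j => y i j m : (scalar R k)^o) e) `^ r) e0)).
    by apply: ler_sum => m _; rewrite ell_sum; exact: (CP n (fun i j => y i j m)).
  rewrite -mulr_sumr ler_wpM2l//.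
  rewrite -(mean_sum n M (fun m e => sabs (chaos n (fun i j => y i j m : (scalar R k)^o) e) `^ r)).
  rewrite -[leRHS](mean_cst n _ e0); apply: mean_le => e.
  have := (qnorm_finP (chaos n y e) pr r0 c0).1 (yc e) M; apply: le_trans.
  by apply: ler_sum => m _; rewrite coordE.
have [C C0 CP] := scalar_chaos (@ltr01 R); exists C => // n y c c0 yc.
apply/(qnorm_infP _ pi); first by rewrite mulr_ge0.
move=> m; rewrite ell_sum; have := CP n (fun i j => y i j m : (scalar R k)^o) e0.
rewrite powRr1 ?sabs_ge0// => /le_trans; apply; rewrite ler_wpM2l//.
rewrite -[leRHS](mean_cst n _ e0); apply: mean_le => e; rewrite powRr1 ?sabs_ge0// -coordE.
exact: (qnorm_infP (chaos n y e) pi c0).1 (yc e) m.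
Qed.

End Chaos.

Lemma nat_pairing : exists (pr : nat -> nat * nat) (un : nat * nat -> nat),
  cancel pr un /\ cancel un pr.
Proof.
have /card_set_bijP[f [_ finj fsurj]] := card_nat2.
have /choice[g gP] : forall n, exists x, f x = n.
  by move=> n; have [x _ xn] := fsurj n I; exists x.
exists g, f; split=> [n|x]; first exact: gP.
by apply: finj; rewrite ?inE//; exact: gP.
Qed.

(** * The isomorphism of l_p(l_p) with l_p *)

Section Gluing.
Context {R : realType} {k : scalar_kind} (p : exponent R).
Variables (pr : nat -> nat * nat) (un : nat * nat -> nat).
Hypotheses (prK : cancel pr un) (unK : cancel un pr).
Implicit Types (t u : ell k p) (g : nat -> ell k p).

Lemma col_pinj n : pinj (fun m => Some (un (n, m))).
Proof. by move=> m m' i [<-] [] /(can_inj unK)[->]. Qed.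

Definition col n t : ell k p := reix (col_pinj (n := n)) t.

Lemma colE n t m : col n t m = t (un (n, m)).
Proof. by []. Qed.

Lemma col_inj t u : (forall n, col n t = col n u) -> t = u.
Proof.
move=> tu; apply: ellP => i; have := congr1 (fun z : ell k p => z (pr i).2) (tu (pr i).1).
by rewrite !colE -surjective_pairing prK.
Qed.

(** Encoding the norms of the columns as a scalar sequence lets membership in $\ell_p(\ell_p)$ be
    stated inside $\ell_p$. *)
Definition norms g (n : nat) : (scalar R k)^o := rscal (qnorm (g n)).

Lemma sabs_norms g n : sabs (norms g n) = qnorm (g n).
Proof. by rewrite /norms sabs_rscal ger0_norm ?qnorm_ge0. Qed.

Lemma cols_psec r t L : val p = r%:E -> 0 < r ->
  psec r L (norms (fun n => col n t)) <= qnorm t `^ r.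
Proof.
move=> pr_ r0; apply/ler_addgt0Pr => e e0.
have L1 : 0 < L%:R + 1 :> R by rewrite ltr_wpDl.
have /choice[Mf MfP] := fun n => tail_small (col n t) pr_ r0 (divr_gt0 e0 L1).
pose M := \max_(n < L) Mf n.
have h n : (n < L)%N -> qnorm (col n t) `^ r <= psec r M (col n t) + e / (L%:R + 1).
  move=> nL; rewrite -lerBlDl; apply: le_trans (MfP n); rewrite lerB//.
  apply: psec_le; exact: (leq_bigmax (Ordinal nL)).
apply: (@le_trans _ _ (\sum_(n < L) (psec r M (col n t) + e / (L%:R + 1)))).
  by apply: ler_sum => n _; rewrite sabs_norms h.
rewrite big_split; apply: lerD; last first.
  by rewrite sumr_const card_ord -[leLHS]mulr_natr mulrAC ler_pdivrMr// ler_wpM2l ?(ltW e0)// lerDl.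
pose s := [seq un (n, m) | n <- index_iota 0 L, m <- index_iota 0 M].
have -> : \sum_(n < L) psec r M (col n t) = \sum_(i <- s) sabs (t i) `^ r.
  rewrite /s big_allpairs_dep big_mkord.
  by apply: eq_bigr => n _; rewrite big_mkord.
apply: le_trans (psec_qnorm t (\max_(i <- s) i.+1) pr_ r0).
rewrite /psec -(big_mkord xpredT (fun i => sabs (t i) `^ r)).
apply: uniq_sub_ler_sum.
- apply: allpairs_uniq; rewrite ?iota_uniq// => -[n m] [n' m'] _ _ /= /(can_inj unK).
  exact.
- exact: iota_uniq.
- move=> i is_; rewrite mem_index_iota /=.
  exact: (@leq_bigmax_seq _ _ xpredT (fun n => n.+1)).
- by move=> i; exact: powR_ge0.
Qed.

Lemma cols_in_ell t : norms (fun n => col n t) \in in_ell p.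
Proof.
have [[r r0 pr_]|pi] := exponentP p.
  by apply/(in_ell_fin _ pr_); exists (qnorm t `^ r) => L; exact: cols_psec.
apply/(in_ell_inf _ pi) => e e0; have [N NP] := (in_ell_inf t pi).1 (ell_seqP t) _ e0.
exists (\max_(i < N) (pr i).1.+1) => n Nn; rewrite sabs_norms.
apply/(qnorm_infP _ pi (ltW e0)) => m; rewrite colE.
have [iN|/NP//] := ltnP (un (n, m)) N.
have := @leq_bigmax _ (fun i : 'I_N => (pr i).1.+1) (Ordinal iN).
by rewrite /= unK /= => /leq_trans/(_ Nn); rewrite ltnn.
Qed.

Definition colnorms t : ell k p := Ell (cols_in_ell t).

Lemma colnormsE t n : sabs (colnorms t n) = qnorm (col n t).
Proof. exact: sabs_norms. Qed.

Lemma qnorm_colnorms t : qnorm (colnorms t) <= qnorm t.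
Proof.
have t0 := qnorm_ge0 t; have [[r r0 pr_]|pi] := exponentP p.
  by apply/(qnorm_finP _ pr_ r0 t0) => L; exact: cols_psec.
by apply/(qnorm_infP _ pi t0) => n; rewrite colnormsE; exact: qnorm_reix.
Qed.

Definition gluing g (i : nat) : (scalar R k)^o := g (pr i).1 (pr i).2.

Lemma gluing_psec r g M : val p = r%:E -> 0 < r ->
  exists L, psec r M (gluing g) <= psec r L (norms g).
Proof.
move=> pr_ r0; pose s := [seq pr i | i <- index_iota 0 M].
pose L := \max_(x <- s) x.1.+1; pose K := \max_(x <- s) x.2.+1; exists L.
pose F (x : nat * nat) := sabs (g x.1 x.2) `^ r.
have -> : psec r M (gluing g) = \sum_(x <- s) F x by rewrite /s big_map big_mkord.
apply: (@le_trans _ _ (\sum_(x <- [seq (n, m) | n <- index_iota 0 L, m <- index_iota 0 K]) F x)).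
  apply: uniq_sub_ler_sum.
  - by rewrite map_inj_uniq ?iota_uniq//; exact: can_inj prK.
  - by apply: allpairs_uniq; rewrite ?iota_uniq// => -[n m] [n' m'].
  - move=> x xs; rewrite [x]surjective_pairing; apply: allpairs_f; rewrite mem_index_iota /=.
      exact: (@leq_bigmax_seq _ _ xpredT (fun x : nat * nat => x.1.+1)).
    exact: (@leq_bigmax_seq _ _ xpredT (fun x : nat * nat => x.2.+1)).
  - by move=> x; exact: powR_ge0.
rewrite big_allpairs big_mkord; apply: ler_sum => n _; rewrite sabs_norms big_mkord.
exact: (psec_qnorm (g n) K pr_ r0).
Qed.

Lemma gluing_in_ell g : norms g \in in_ell p -> gluing g \in in_ell p.
Proof.
move=> gp; have [[r r0 pr_]|pi] := exponentP p.
  have [c gc] := (in_ell_fin _ pr_).1 gp; apply/(in_ell_fin _ pr_); exists c => M.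
  by have [L /le_trans] := gluing_psec g M pr_ r0; apply; exact: gc.
apply/(in_ell_inf _ pi) => e e0; have [N NP] := (in_ell_inf _ pi).1 gp _ e0.
have /choice[Mf MfP] := fun n => (in_ell_inf _ pi).1 (ell_seqP (g n)) _ e0.
exists (\max_(n < N) \max_(m < Mf n) (un (n : nat, m : nat)).+1) => i Ni; rewrite /gluing.
have [nN|/NP] := ltnP (pr i).1 N; last first.
  by rewrite sabs_norms; apply: le_trans; exact: coord_le.
have [mM|/MfP//] := ltnP (pr i).2 (Mf (pr i).1).
have h1 := @leq_bigmax _ (fun m : 'I_(Mf (pr i).1) => (un ((pr i).1, m : nat)).+1) (Ordinal mM).
have h2 := @leq_bigmax _ (fun n : 'I_N => \max_(m < Mf n) (un (n : nat, m : nat)).+1) (Ordinal nN).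
by have := leq_trans h1 (leq_trans h2 Ni); rewrite /= -surjective_pairing prK ltnn.
Qed.

(** This is how operators into $\ell_p(\ell_p)$ are built: it suffices to prescribe the columns and
    to dominate their norms by one element of $\ell_p$. *)
Lemma glue_dom g (b : ell k p) : (forall n, qnorm (g n) <= sabs (b n)) ->
  exists z, (forall n, col n z = g n) /\ qnorm z <= qnorm b.
Proof.
move=> gb; have gp : norms g \in in_ell p.
  by apply: (in_ell_dom (ell_seqP b)) => n; rewrite sabs_norms.
exists (Ell (gluing_in_ell gp)); split=> [n|].
  by apply: ellP => m; rewrite colE /= /gluing unK.
have b0 := qnorm_ge0 b; have [[r r0 pr_]|pi] := exponentP p.
  apply/(qnorm_finP _ pr_ r0 b0) => M; have [L /le_trans] := gluing_psec g M pr_ r0; apply.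
  apply: le_trans (psec_qnorm b L pr_ r0); apply: ler_sum => n _.
  by rewrite powR_le_root ?sabs_ge0// sabs_norms.
apply/(qnorm_infP _ pi b0) => i; rewrite /= /gluing.
by apply: le_trans (coord_le _ _) _; apply: le_trans (gb _) _; exact: coord_le.
Qed.

End Gluing.

(** * Pelczynski decomposition *)

Section BoundedMaps.
Context {R : realType} {k : scalar_kind}.
Implicit Types (U V W : quasiNormedType R k).

Definition bnd V W (T : V -> W) := exists2 K : R, 0 <= K & forall u, qnorm (T u) <= K * qnorm u.

Lemma bnd_contraction V W (T : V -> W) : (forall u, qnorm (T u) <= qnorm u) -> bnd T.
Proof. by move=> T1; exists 1 => // u; rewrite mul1r. Qed.

Lemma bnd_id V : bnd (@id V).
Proof. exact: bnd_contraction. Qed.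

Lemma bnd_comp U V W (S : V -> W) (T : U -> V) : bnd S -> bnd T -> bnd (S \o T).
Proof.
move=> [K K0 SK] [L L0 TL]; exists (K * L) => [|u]; first by rewrite mulr_ge0.
by rewrite (le_trans (SK _))// -mulrA ler_wpM2l.
Qed.

Lemma bndD V W (S T : V -> W) : bnd S -> bnd T -> bnd (fun u => S u + T u).
Proof.
move=> [K K0 SK] [L L0 TL]; exists (kap W * (K + L)) => [|u].
  by rewrite mulr_ge0 ?kap_ge0// addr_ge0.
by rewrite (le_trans (qnormDk _ _))// -mulrA ler_wpM2l ?kap_ge0// mulrDl lerD.
Qed.

Lemma bndN V W (T : V -> W) : bnd T -> bnd (fun u => - T u).
Proof. by move=> [L L0 TL]; exists L => // u; rewrite qnormN. Qed.

Lemma lin_comp U V W (S : V -> W) (T : U -> V) : linear S -> linear T -> linear (S \o T).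
Proof. by move=> lS lT a u v /=; rewrite lT lS. Qed.

Lemma linfD V W (S T : V -> W) : linear S -> linear T -> linear (fun u => S u + T u).
Proof. by move=> lS lT a u v; rewrite lS lT scalerDr addrACA. Qed.

Lemma linfN V W (T : V -> W) : linear T -> linear (fun u => - T u).
Proof. by move=> lT a u v; rewrite lT opprD scalerN. Qed.

Lemma rscalD (r s : R) : rscal (r + s) = rscal r + rscal s :> scalar R k.
Proof. by rewrite /rscal; case: k => //=; rewrite rmorphD. Qed.

Lemma rscal0 : rscal 0 = 0 :> scalar R k.
Proof. by rewrite /rscal; case: k. Qed.

End BoundedMaps.

(* Pelczynski's decomposition method.  With P = A B, the map
   (y, s_0, s_1, ...) |-> (A y + (1 - P) s_0, P s_0 + (1 - P) s_1, ...) identifies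
   Y + l_p(l_p) with l_p(l_p), and y, s |-> y - C D y + C (D y, s) identifies
   Y + l_p(l_p) with Y; the two maps below compose these isomorphisms. *)
Section Pelczynski.
Context {R : realType} {k : scalar_kind} (p : exponent R) (V : quasiNormedType R k).
Local Notation L := (ell k p).
Variables (A D : V -> L) (B C : L -> V) (Y : set V).
Hypotheses (lA : linear A) (lB : linear B) (lC : linear C) (lD : linear D).
Hypotheses (bA : bnd A) (bB : bnd B) (bC : bnd C) (bD : bnd D).
Hypotheses (YB : forall a, Y (B a)) (YC : forall a, Y (C a)).
Hypothesis Ylin : forall (c : scalar R k) y z, Y y -> Y z -> Y (c *: y + z).
Hypothesis BA : forall y, Y y -> B (A y) = y.
Hypothesis DC : forall a, D (C a) = a.

Let YD y z : Y y -> Y z -> Y (y + z).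
Proof. by move=> Yy Yz; rewrite -[y]scale1r; exact: Ylin. Qed.

Let YN y z : Y y -> Y z -> Y (y - z).
Proof. by move=> Yy Yz; rewrite addrC -scaleN1r; exact: Ylin. Qed.

Lemma pelczynski : exists (T : L -> V) (T' : V -> L),
  [/\ linear T, linear T', bnd T & bnd T'] /\
  [/\ forall a, T' (T a) = a, forall a, Y (T a) & forall y, Y y -> T (T' y) = y].
Proof.
have [pr [un [prK unK]]] := nat_pairing.
pose cl n (t : L) := col unK n t.
have clinj t u : (forall n, cl n t = cl n u) -> t = u by exact: col_inj prK _ _ _.
have cllin n : linear (cl n) by exact: reix_lin.
have clle n t : qnorm (cl n t) <= qnorm t by exact: qnorm_reix.
have clb n : bnd (cl n) by apply: bnd_contraction => t; exact: clle.
pose P := A \o B; have lP : linear P by exact: lin_comp.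
have bP : bnd P by exact: bnd_comp.
have PA y : Y y -> P (A y) = A y by move=> Yy; rewrite /P /= BA.
have BP a : B (P a) = B a by rewrite /P /= BA.
have PP a : P (P a) = P a by rewrite {2}/P /= PA.
pose w (t : L) := colnorms unK t.
have wE t n : w t n = rscal (qnorm (cl n t)) by [].
have wle t : qnorm (w t) <= qnorm t by exact: qnorm_colnorms.
have [K3 K30 PK3] := bP; have k0 := kap_ge0 (L : quasiNormedType R k).
pose Ke := kap L * (kap L * (1 + K3) + K3).
have Ke0 : 0 <= Ke by rewrite /Ke mulr_ge0// addr_ge0// mulr_ge0// addr_ge0.
have cutK u v : qnorm (u - P u + P v) <= Ke * (qnorm u + qnorm v).
  apply: le_trans (qnormDk _ _) _; rewrite -mulrA ler_wpM2l//.
  have u0 := qnorm_ge0 u; have v0 := qnorm_ge0 v.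
  have h1 : qnorm (u - P u) <= kap L * (1 + K3) * qnorm u.
    apply: le_trans (qnormBk _ _) _; rewrite -mulrA ler_wpM2l// mulrDl mul1r lerD2l; exact: PK3.
  have h2 := PK3 v; have c0 : 0 <= kap L * (1 + K3) by rewrite mulr_ge0// addr_ge0.
  by rewrite mulrDl lerD// ?(le_trans h1)// ?(le_trans h2)// ler_wpM2l// ?lerDl ?lerDr.
have [K1 K10 DBK] : bnd (D \o B) by exact: bnd_comp.
(* Inverting the first isomorphism sends $(t_m)$ to $y=Bt_0$ and $s_m=(1-P)t_m+Pt_{m+1}$. The
   columns here are those of $(Dy,s)$, to which the second isomorphism applies C. *)
pose fwd n t := if n is m.+1 then cl m t - P (cl m t) + P (cl m.+1 t) else D (B (cl 0%N t)).
have prev_inj : pinj (fun n => if n is m.+1 then Some m else None).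
  by move=> [|m] [|m'] n //= [->] [->].
have [Kz Zex] : exists Kz, forall t, exists z, (forall n, cl n z = fwd n t) /\ qnorm z <= Kz * qnorm t.
  exists ((K1 + Ke) * (kap L * 2)) => t.
  (* Column n involves only the columns n - 1 and n of [t], so two copies of the column norms, one
     of them shifted, dominate. *)
  pose b := rscal (K1 + Ke) *: (reix prev_inj (w t) + w t).
  have KK : 0 <= K1 + Ke by rewrite addr_ge0.
  have bE n : sabs (b n) = (K1 + Ke) * ((if n is m.+1 then qnorm (cl m t) else 0) + qnorm (cl n t)).
    rewrite /b ellZ ellD reixE sabsM sabs_rscal ger0_norm// wE; congr (_ * _).
    have -> : oapp (w t) 0 (if n is m.+1 then Some m else None) =
        rscal (if n is m.+1 then qnorm (cl m t) else 0) :> scalar R k.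
      by case: n => //=; rewrite rscal0.
    rewrite -rscalD sabs_rscal ger0_norm// addr_ge0 ?qnorm_ge0//.
    by case: n => // n; exact: qnorm_ge0.
  have [|z [z1 z2]] := @glue_dom _ _ _ _ _ prK unK (fwd^~ t) b.
    move=> [|n]; rewrite bE /=.
      by rewrite add0r; apply: le_trans (DBK _) _; rewrite ler_wpM2r ?qnorm_ge0// lerDl.
    by apply: le_trans (cutK _ _) _; rewrite ler_wpM2r ?addr_ge0 ?qnorm_ge0// lerDr.
  exists z; split=> //; apply: le_trans z2 _.
  rewrite /b qnormZ sabs_rscal ger0_norm// -!mulrA ler_wpM2l// (le_trans (qnormDk _ _))//.
  rewrite ler_wpM2l// mulr_natl mulr2n lerD//.
  exact: le_trans (qnorm_reix _ _) (wle t).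
have {Zex}/choice[Z ZP] := Zex.
have Zcol t n : cl n (Z t) = fwd n t := (ZP t).1 n.
have flin n : linear (fwd n).
  case: n => [|n]; first exact: lin_comp lD (lin_comp lB (cllin 0%N)).
  exact: linfD (linfD (cllin n) (linfN (lin_comp lP (cllin n)))) (lin_comp lP (cllin n.+1)).
have lZ : linear Z by move=> c t u; apply: clinj => n; rewrite cllin !Zcol flin.
have bZ : bnd Z.
  exists (Num.max 0 Kz) => [|t]; first by rewrite le_max lexx.
  by apply: le_trans (ZP t).2 _; rewrite ler_wpM2r ?qnorm_ge0// le_max lexx orbT.
(* The inverse of the second isomorphism: [y0 y] is its component in Y, and the columns of [D y]
   from 1 on are its sequence $(s_m)$. *)
pose y0 y := y - C (D y) + C (cl 0%N (D y)).
have ly0 : linear y0.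
  by apply: linfD (lin_comp lC (lin_comp (cllin 0%N) lD)) => c u v; rewrite lD lC scalerBr opprD addrACA.
have by0 : bnd y0.
  apply: bndD (bnd_comp bC (bnd_comp (clb 0%N) bD)).
  exact: bndD (bnd_id V) (bndN (bnd_comp bC bD)).
(* The first isomorphism applied to the pair just recovered. *)
pose bwd n y := if n is m.+1 then P (cl m.+1 (D y)) + (cl m.+2 (D y) - P (cl m.+2 (D y)))
  else A (y0 y) + (cl 1%N (D y) - P (cl 1%N (D y))).
have blin n : linear (bwd n).
  have h m : linear (fun y => cl m (D y) - P (cl m (D y))).
    exact: linfD (lin_comp (cllin m) lD) (linfN (lin_comp lP (lin_comp (cllin m) lD))).
  case: n => [|n]; first exact: linfD (lin_comp lA ly0) (h 1%N).
  exact: linfD (lin_comp lP (lin_comp (cllin n.+1) lD)) (h n.+2).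
have cutD n y : bwd n.+1 y = cl n.+2 (D y) - P (cl n.+2 (D y)) + P (cl n.+1 (D y)).
  by rewrite /= addrC.
have [K2 K20 b0K] : bnd (bwd 0%N).
  apply: bndD (bnd_comp bA by0) _; apply: bndD (bnd_comp (clb 1%N) bD) _.
  exact: bndN (bnd_comp bP (bnd_comp (clb 1%N) bD)).
have [KD KD0 DK] := bD.
have next_inj : pinj (fun n => Some n.+1) by move=> m m' n [<-] [].
have [Kw Wex] : exists Kw, forall y, exists z, (forall n, cl n z = bwd n y) /\ qnorm z <= Kw * qnorm y.
  exists (kap L * (K2 + Ke * (kap L * (KD + KD)))) => y.
  pose b1 := rscal Ke *: (w (D y) + reix next_inj (w (D y))).
  (* Column 0 contains [A (y0 y)], whose bound is in terms of [qnorm y] rather than of nearby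
     columns; the unit vector accounts for it. *)
  pose b := rscal (K2 * qnorm y) *: unitv p 0%N + b1.
  have b1E n : b1 n = rscal (Ke * (qnorm (cl n (D y)) + qnorm (cl n.+1 (D y)))).
    by rewrite rscalM rscalD.
  have b10 n : 0 <= Ke * (qnorm (cl n (D y)) + qnorm (cl n.+1 (D y))).
    by rewrite mulr_ge0// addr_ge0 ?qnorm_ge0.
  have y00 : 0 <= K2 * qnorm y by rewrite mulr_ge0 ?qnorm_ge0.
  have [|z [z1 z2]] := @glue_dom _ _ _ _ _ prK unK (bwd^~ y) b.
    move=> [|n]; rewrite /b ellD ellZ b1E unitvE.
      by rewrite eqxx mulr1 -rscalD sabs_rscal ger0_norm ?addr_ge0// (le_trans (b0K _))// lerDl.
    rewrite mulr0 add0r sabs_rscal ger0_norm// cutD (le_trans (cutK _ _))// addrC.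
    by [].
  have b1K : qnorm b1 <= Ke * (kap L * (KD + KD)) * qnorm y.
    rewrite /b1 qnormZ sabs_rscal ger0_norm// -mulrA ler_wpM2l// (le_trans (qnormDk _ _))//.
    rewrite -mulrA ler_wpM2l// mulrDl lerD//; first exact: le_trans (wle _) (DK y).
    by apply: le_trans (qnorm_reix _ _) _; exact: le_trans (wle _) (DK y).
  exists z; split=> //; apply: le_trans z2 _; rewrite (le_trans (qnormDk _ _))//.
  rewrite -mulrA ler_wpM2l// mulrDl lerD//.
  by rewrite qnormZ sabs_rscal ger0_norm// ler_piMr// qnorm_unitv.
have {Wex}/choice[W WP] := Wex.
have Wcol y n : cl n (W y) = bwd n y := (WP y).1 n.
have lW : linear W by move=> c t u; apply: clinj => n; rewrite cllin !Wcol blin.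
pose T t := B (cl 0%N t) - C (D (B (cl 0%N t))) + C (Z t).
have YT t : Y (T t) by apply: YD => //; apply: YN.
have DT t : D (T t) = Z t.
  by rewrite /T (lin_D lD) (lin_B lD) !DC subrr add0r.
exists T, W; split; split.
- apply: linfD (lin_comp lC lZ); apply: linfD (lin_comp lB (cllin 0%N)) _.
  exact: linfN (lin_comp lC (lin_comp lD (lin_comp lB (cllin 0%N)))).
- exact: lW.
- apply: bndD (bnd_comp bC bZ); apply: bndD (bnd_comp bB (clb 0%N)) _.
  exact: bndN (bnd_comp bC (bnd_comp bD (bnd_comp bB (clb 0%N)))).
- exists (Num.max 0 Kw) => [|t]; first by rewrite le_max lexx.
  by apply: le_trans (WP t).2 _; rewrite ler_wpM2r ?qnorm_ge0// le_max lexx orbT.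
- move=> t; apply: clinj => n; rewrite Wcol /bwd DT.
  have y0T : y0 (T t) = B (cl 0%N t).
    by rewrite /y0 DT Zcol /= {1}/T addrK subrK.
  have cut u v : P (u - P u + P v) = P v.
    by rewrite (lin_D lP) (lin_B lP) !PP subrr add0r.
  have half u v : u - P u + P v - P (u - P u + P v) = u - P u by rewrite cut addrK.
  case: n => [|n].
    by rewrite y0T Zcol /= half -/(P (cl 0%N t)) addrC subrK.
  by rewrite !Zcol /= half cut addrC subrK.
- by [].
move=> y Yy; have y0Y : Y (y0 y) by apply: YD => //; apply: YN.
have BW : B (cl 0%N (W y)) = y0 y.
  by rewrite Wcol /= (lin_D lB) (lin_B lB) BP subrr addr0 BA.
have ZW : Z (W y) = D y.
  apply: clinj => n; rewrite Zcol; case: n => [|n] /=.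
    by rewrite BW /y0 (lin_D lD) (lin_B lD) !DC subrr add0r.
  have cut m : P (cl m.+1 (W y)) = P (cl m.+1 (D y)).
    by rewrite Wcol /= (lin_D lP) (lin_B lP) !PP subrr addr0.
  rewrite cut; case: n => [|n].
    rewrite !Wcol /= (lin_D lP) (PA _ y0Y) (lin_B lP) PP subrr addr0.
    by rewrite [X in X + _]addrAC subrr add0r subrK.
  by rewrite cut Wcol /= [X in X + _]addrAC subrr add0r subrK.
by rewrite /T BW ZW /y0 (lin_D lD) (lin_B lD) !DC subrr add0r addrK subrK.
Qed.

End Pelczynski.

(** * Direct sums of l_p spaces *)

Section DirectSums.
Context {R : realType} {k : scalar_kind} {I : finType} (pe : I -> exponent R).
Local Notation X := (dsum (fun i : I => ell k (pe i))).
Implicit Types (f g : X).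

Lemma qnorm_dsumE f : qnorm f = \big[Num.max/0]_(i : I) qnorm (f i).
Proof. by []. Qed.

Lemma qnorm_comp f i : qnorm (f i) <= qnorm f.
Proof. exact: (le_bigmax _ (fun i => qnorm (f i))). Qed.

Lemma qnorm_dsum_le f c : 0 <= c -> (forall i, qnorm (f i) <= c) -> qnorm f <= c.
Proof. by move=> c0 fc; rewrite qnorm_dsumE; apply: bigmax_le. Qed.

Definition inj i (v : ell k (pe i)) : X := dfwith (fun j => 0 : ell k (pe j)) i v.

Lemma injE i v : inj v i = v.
Proof. exact: dfwithin. Qed.

Lemma injN i j (v : ell k (pe i)) : i != j -> inj v j = 0.
Proof. exact: dfwithout. Qed.

Lemma inj_lin i : linear (@inj i).
Proof.
move=> a u v; apply/functional_extensionality_dep => j.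
rewrite -[RHS]/(a *: inj u j + inj v j); have [<-|ij] := eqVneq i j; first by rewrite !injE.
by rewrite !injN// scaler0 addr0.
Qed.

Lemma qnorm_inj i (v : ell k (pe i)) : qnorm (inj v) <= qnorm v.
Proof.
apply: qnorm_dsum_le (qnorm_ge0 v) _ => j; have [<-|ij] := eqVneq i j; first by rewrite injE.
by rewrite injN// qnorm00 qnorm_ge0.
Qed.

Lemma comp_lin i : linear (fun f : X => f i).
Proof. by []. Qed.

Lemma dsum_sum (J : Type) (s : seq J) (P : pred J) (F : J -> X) i :
  (\sum_(j <- s | P j) F j) i = \sum_(j <- s | P j) F j i.
Proof. exact: (lin_sum (@comp_lin i)). Qed.

Lemma sum_inj f : \sum_(i : I) inj (f i) = f.
Proof.
apply/functional_extensionality_dep => j; rewrite dsum_sum (bigD1 j)//= injE big1 ?addr0// => i ij.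
by rewrite injN.
Qed.

Lemma dsum_complete : qcomplete (X : quasiNormedType R k).
Proof.
move=> u uC.
have lex i : exists l, qcvg (fun n => u n i) l.
  apply: (@ell_complete R k (pe i)) => e /uC[N NP]; exists N => m n Nm Nn.
  exact: le_trans (qnorm_comp (u m - u n) i) (NP m n Nm Nn).
pose l : X := fun i => projT1 (cid (lex i)).
have lP i : qcvg (fun n => u n i) (l i) by rewrite /l; case: cid.
exists l => e e0; have /choice[N NP] := fun i => lP i e e0.
exists (\max_(i : I) N i) => n Nn; apply: (qnorm_dsum_le (ltW e0)) => i.
by apply: NP; apply: leq_trans Nn; exact: leq_bigmax.
Qed.

Lemma dsum_chaos : exists2 C, 0 <= C & forall n (y : nat -> nat -> X) c,
  0 <= c -> (forall e, qnorm (chaos n y e) <= c) -> qnorm (\sum_(i < n) y i i) <= C * c.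
Proof.
have /choice[C CP] : forall i, exists C : R, 0 <= C /\ forall n (y : nat -> nat -> ell k (pe i)) c,
    0 <= c -> (forall e, qnorm (chaos n y e) <= c) -> qnorm (\sum_(i < n) y i i) <= C * c.
  by move=> i; have [C C0 CP] := @ell_chaos R k (pe i); exists C.
exists (\big[Num.max/0]_i C i) => [|n y c c0 yc]; first exact: bigmax_ge_id.
apply: qnorm_dsum_le => [|i]; first by rewrite mulr_ge0// bigmax_ge_id.
apply: (@le_trans _ _ (C i * c)); last by rewrite ler_wpM2r// le_bigmax.
rewrite dsum_sum; apply: ((CP i).2 n (fun j l => y j l i)) => // e.
apply: le_trans (yc e); apply: le_trans (qnorm_comp _ i); rewrite le_eqVlt; apply/orP; left; apply/eqP.
congr (qnorm _); rewrite /chaos dsum_sum; apply: eq_bigr => j _; rewrite dsum_sum.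
by apply: eq_bigr.
Qed.

End DirectSums.

(** * Pigeonhole selection and truncation of multipliers *)

Definition unbdd (S : set nat) := forall M, exists2 s, (M <= s)%N & S s.

Section Pigeonhole.
Context {R : realType} {k : scalar_kind}.

Lemma pigeonhole1 (phi : nat -> scalar R k) C (S : set nat) eta : 0 < eta ->
  (forall n, sabs (phi n) <= C) -> unbdd S -> exists2 S', unbdd S' & S' `<=` S /\
  forall s t, S' s -> S' t -> sabs (phi s - phi t) <= eta.
Proof.
move=> eta0 phiC Sinf; have C0 : 0 < C + 1 by rewrite ltr_wpDl// (le_trans _ (phiC 0%N))// sabs_ge0.
have e0 : 0 < eta / 2 / (C + 1) by rewrite !divr_gt0.
have [G GP] := @disc_net R k _ e0.
have /choice[g gP] : forall n, exists h, h \in G /\ sabs (rscal (C + 1)^-1 * phi n - h) <= eta / 2 / (C + 1).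
  move=> n; have [|h hG hP] := GP (rscal (C + 1)^-1 * phi n); last by exists h.
  rewrite sabsM sabs_rscal gtr0_norm ?invr_gt0// ler_pdivrMl// mulr1.
  by rewrite (le_trans (phiC n))// lerDl.
have [h hinf] : exists h, unbdd [set n | S n /\ g n = h].
  apply: contrapT => /forallNP noh.
  have /choice[M MP] : forall h, exists M, forall s, (M <= s)%N -> S s -> g s <> h.
    move=> h; have /existsNP[M MP] := noh h; exists M => s Ms Ss gs.
    by apply: MP; exists s.
  have [s sM Ss] := Sinf (\max_(h <- G) M h).
  apply: (MP (g s) s) => //; apply: leq_trans sM.
  exact: (@leq_bigmax_seq _ _ xpredT M _ (gP s).1).
exists [set n | S n /\ g n = h] => //; split=> [n []//|s t [_ gs] [_ gt]].
have -> : phi s - phi t = rscal (C + 1) * ((rscal (C + 1)^-1 * phi s - h) - (rscal (C + 1)^-1 * phi t - h)).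
  rewrite opprB addrA subrK mulrBr !mulrA -rscalM mulfV ?gt_eqF// rscal1 !mul1r//.
rewrite sabsM sabs_rscal gtr0_norm// mulrC -ler_pdivlMr//.
rewrite (le_trans (le_sabsD _ _))// sabsN.
have -> : eta / (C + 1) = eta / 2 / (C + 1) + eta / 2 / (C + 1) by rewrite -mulrDl -splitr.
by apply: lerD; [rewrite -gs|rewrite -gt]; exact: (gP _).2.
Qed.

(** Differences of two selected terms are almost annihilated by the first d functionals: a
    substitute for weakly null sequences that needs no duality. *)
Lemma pigeonhole d (phi : nat -> nat -> scalar R k) (S : set nat) eta : 0 < eta ->
  (forall i, exists C, forall n, sabs (phi i n) <= C) -> unbdd S ->
  exists2 S', unbdd S' & S' `<=` S /\
  forall i s t, (i < d)%N -> S' s -> S' t -> sabs (phi i s - phi i t) <= eta.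
Proof.
move=> eta0 phib Sinf; elim: d => [|d [S1 S1inf [S1S S1P]]]; first by exists S => //; split=> // i s t; rewrite ltn0.
have [C CP] := phib d; have [S2 S2inf [S2S S2P]] := pigeonhole1 eta0 CP S1inf.
exists S2 => //; split=> [n /S2S/S1S//|i s t].
rewrite ltnS leq_eqVlt => /predU1P[->|id]; first exact: S2P.
by move=> /S2S ss /S2S st; exact: S1P.
Qed.

Lemma unbddT : unbdd setT.
Proof. by move=> M; exists M. Qed.

End Pigeonhole.

Section SystemFacts.
Context {R : realType} {k : scalar_kind} {V : quasiNormedType R k} (ms : multsys V).
Implicit Types (a b : nat -> scalar R k) (f : V).
Local Notation E := (msE ms).
Local Notation c := (msc ms).
Local Notation K := (msK ms).

Definition supp_ge a N := forall i, (i < N)%N -> a i = 0.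
Definition supp_lt a N := forall i, (N <= i)%N -> a i = 0.

Lemma msK_gt0 : 0 < K.
Proof. exact: lt_le_trans ltr01 (msK_ge1 ms). Qed.

Lemma mscD f g i : c (f + g) i = c f i + c g i.
Proof. by rewrite -[f]scale1r msc_lin mul1r scale1r. Qed.

Lemma mscB f g i : c (f - g) i = c f i - c g i.
Proof. by rewrite addrC -scaleN1r msc_lin mulN1r addrC. Qed.

Lemma msc_bound i : exists2 C : R, 0 <= C & forall f, sabs (c f i) <= C * qnorm f.
Proof.
have K0 := msK_gt0; have [ri|ri] := boolP (msreal ms i); last first.
  by exists 0 => // f; rewrite msc_dummy// sabs0 mul0r.
have xi : 0 < qnorm (msx ms i).
  rewrite lt_neqAle qnorm_ge0 andbT eq_sym; apply/eqP => /qnorm0_eq0 x0.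
  have := msc_delta ms i i; rewrite x0 eqxx ri /= => c0.
  have := msc_lin ms 1 0 0 i; rewrite scaler0 addr0 mul1r c0 => /eqP.
  by rewrite -subr_eq0 opprD addrA subrr sub0r oppr_eq0 oner_eq0.
exists (K / qnorm (msx ms i)) => [|f]; first by rewrite divr_ge0 ?(ltW K0)// ltW.
by rewrite mulrAC ler_pdivlMr// msc_le.
Qed.

(** A multiplier supported below [M] depends on finitely many coefficients only, so small
    coefficients force a small image, uniformly in the symbol. *)
Lemma msE_small M e : 0 < e -> exists2 eta : R, 0 < eta & forall a f, sball a -> supp_lt a M ->
  (forall i, (i < M)%N -> sabs (c f i) <= eta) -> qnorm (E a f) <= e.
Proof.
move=> e0; pose B := kap V ^+ size (index_enum 'I_M) * \sum_(i < M) qnorm (msx ms i).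
have B0 : 0 <= B.
  by rewrite mulr_ge0 ?exprn_ge0 ?kap_ge0// sumr_ge0// => i _; exact: qnorm_ge0.
have B1 : 0 < B + 1 by rewrite ltr_wpDl.
have eta0 : 0 < e / (B + 1) by rewrite divr_gt0.
exists (e / (B + 1)) => // a f a1 aM cf; rewrite (msE_fin _ _ a1 aM).
apply: le_trans (qnorm_sum_seq _ _ _) _; apply: (@le_trans _ _ (B * (e / (B + 1)))).
  rewrite -mulrA ler_wpM2l ?exprn_ge0 ?kap_ge0// mulr_suml; apply: ler_sum => i _.
  rewrite !qnormZ mulrA [leRHS]mulrC ler_wpM2r ?qnorm_ge0//.
  by rewrite -[leRHS]mul1r ler_pM ?sabs_ge0// cf.
by rewrite mulrA ler_pdivrMr// mulrC ler_wpM2l ?(ltW e0)// lerDl.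
Qed.

Lemma sball0 : sball (fun=> 0 : scalar R k).
Proof. by move=> i; rewrite sabs0. Qed.

Lemma msE0 f : E (fun=> 0) f = 0.
Proof. by rewrite (@msE_fin _ _ _ _ _ 0%N) ?big_ord0//; exact: sball0. Qed.

Lemma supp_ge_le a M N : (M <= N)%N -> supp_ge a N -> supp_ge a M.
Proof. by move=> MN aN i iM; apply: aN; exact: leq_trans MN. Qed.

Lemma sball_disj a b M : sball a -> sball b -> supp_lt a M -> supp_ge b M ->
  sball (fun i => a i + b i).
Proof.
move=> a1 b1 aM bM i; have [iM|Mi] := ltnP i M; first by rewrite bM// addr0.
by rewrite aM// add0r.
Qed.

Definition cut n a i := if (i < n)%N then a i else 0.

Lemma sball_cut n a : sball a -> sball (cut n a).
Proof. by move=> a1 i; rewrite /cut; case: ifP; rewrite ?sabs0. Qed.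

Lemma supp_lt_cut n a : supp_lt (cut n a) n.
Proof. by move=> i ni; rewrite /cut ltnNge ni. Qed.

Lemma supp_ge_cut N n a : supp_ge a N -> supp_ge (cut n a) N.
Proof. by move=> aN i iN; rewrite /cut aN//; case: ifP. Qed.

Lemma msE_cut a f e : sball a -> 0 < e -> exists n0, forall n, (n0 <= n)%N ->
  qnorm (E a f - E (cut n a) f) <= e.
Proof.
move=> a1 /(msE_tail ms f)[N NP]; exists N => n Nn.
pose b i := if (i < n)%N then 0 else a i.
have b1 : sball b by move=> i; rewrite /b; case: ifP; rewrite ?sabs0.
have -> : E a f = E (cut n a) f + E b f.
  rewrite -msE_add//; first 1 last.
  - exact: sball_cut.
  - by move=> i; rewrite /cut /b; case: ifP; rewrite ?addr0 ?add0r.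
  by congr E; apply/funext => i; rewrite /cut /b; case: ifP; rewrite ?addr0 ?add0r.
rewrite addrAC subrr add0r; apply: NP => // i iN; rewrite /b (leq_trans iN)//.
Qed.

End SystemFacts.

(** The choice of [e] makes $e(m(D+1)+D+1)=1$, so the total error in one induction step is at most
    1. *)
Lemma upper_step (R : realFieldType) (m D a b w : R) (e := (m * (D + 1) + D + 1)^-1) :
  0 <= m -> 0 <= D -> a <= m * (D + 1) -> w <= (1 + e) * (a + b) + e -> b <= D ->
  w <= (m + 1) * (D + 1).
Proof.
move=> m0 D0 am we bD; have S0 : 0 < m * (D + 1) + D + 1.
  by rewrite ltr_wpDl// addr_ge0// mulr_ge0// addr_ge0.
have e0 : 0 <= e by rewrite invr_ge0 ltW.
apply: le_trans we _; apply: (@le_trans _ _ ((1 + e) * (m * (D + 1) + D) + e)).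
  by rewrite lerD2r ler_wpM2l ?addr_ge0// lerD.
have : e * (m * (D + 1) + D + 1) = 1 by rewrite mulVf// gt_eqF.
by move: e {e0} => e; lra.
Qed.

(** A new hump brings 2c; the choice of [e] makes $e((m+1)c+1)=c$, so the errors consume at most c
    of it. *)
Lemma lower_step (R : realFieldType) (m c a b w : R) (e := c / ((m + 1) * c + 1)) :
  0 <= m -> 0 < c -> m * c <= a -> a + b <= (1 + e) * w + e -> 2 * c <= b ->
  (m + 1) * c <= w.
Proof.
move=> m0 c0 ma abw cb; have S0 : 0 < (m + 1) * c + 1.
  by rewrite ltr_wpDl// mulr_ge0 ?addr_ge0// ltW.
have e0 : 0 < 1 + e by rewrite addr_gt0// divr_gt0.
have eS : e * ((m + 1) * c + 1) = c by rewrite divfK// gt_eqF.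
rewrite -(ler_pM2l e0); move: e abw eS {e0 S0} => e abw eS; lra.
Qed.

(** * The gliding hump *)

Section Hump.
Context {R : realType} {k : scalar_kind} {I : finType} (pe : I -> exponent R).
Local Notation X := (dsum (fun i : I => ell k (pe i))).
Variable ms : multsys X.
Implicit Types (a b : nat -> scalar R k) (f : X).
Local Notation E := (msE ms).
Local Notation c := (msc ms).
Local Notation K := (msK ms).
Variables (p q : I).
Hypothesis pq : (val (pe p) < val (pe q))%E.
Local Notation Lp := (ell k (pe p)).
Local Notation Lq := (ell k (pe q)).

Definition block a (v : Lq) : Lp := E a (inj v) p.

Let kX := kap X.
Let kX0 : 0 < kX. Proof. exact: kap_gt0. Qed.
Let K0 : 0 < K. Proof. exact: msK_gt0. Qed.

Lemma block_le a v : qnorm (block a v) <= K * qnorm v.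
Proof.
apply: le_trans (qnorm_comp _ _) _; apply: le_trans (msE_le ms _ _) _.
by rewrite ler_wpM2l ?(ltW K0)// qnorm_inj.
Qed.

Lemma block_lin a : linear (block a).
Proof. by move=> s u v; rewrite /block (inj_lin s u v) msE_lin. Qed.

Lemma block_add a b v : sball a -> sball b -> sball (fun i => a i + b i) ->
  block (fun i => a i + b i) v = block a v + block b v.
Proof. by move=> a1 b1 ab1; rewrite /block msE_add. Qed.

Definition sandwich a b v : X := E b (inj (block a v)).

Lemma sandwich_lin a b : linear (sandwich a b).
Proof. by move=> s u v; rewrite /sandwich block_lin inj_lin msE_lin. Qed.

Lemma sandwich_le a b v : qnorm (sandwich a b v) <= K * qnorm (block a v).
Proof. by apply: le_trans (msE_le ms _ _) _; rewrite ler_wpM2l ?(ltW K0)// qnorm_inj. Qed.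

(** Small coordinates serve [bl_upper] in $\ell_q$; small basis coefficients serve [msE_small].
    Neither smallness implies the other quantitatively, so both are carried along. *)
Definition cnull M (eta : R) (v : Lq) := null M eta v /\ forall n, (n < M)%N -> sabs (c (inj v) n) <= eta.

Definition bad (d : R) := forall N, exists a b f, [/\ sball a, sball b, supp_ge a N, supp_ge b N &
  d * qnorm f < qnorm (E b (inj (E a (inj (f q)) p)))].

Lemma qnorm_subl (V : quasiNormedType R k) (u w : V) : (qnorm u) / kap V - qnorm w <= qnorm (u - w).
Proof.
rewrite lerBlDr ler_pdivrMr ?kap_gt0// mulrC -{1}[u](subrK w).
exact: qnormDk.
Qed.

(** Besides normalizing the vector, the inner symbol is cut to finite support; half of $d/\kappa$
    pays for the cut. *)
Lemma bad_normalized d : 0 < d -> bad d -> exists2 d1 : R, 0 < d1 & forall N, exists a b v n,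
  [/\ sball a, sball b, supp_ge a N, supp_ge b N & supp_lt a n] /\
  (qnorm v <= 1 /\ d1 <= qnorm (sandwich a b v)).
Proof.
move=> d0 bd; exists (d / kX / 2) => [|N]; first by rewrite !divr_gt0.
have [a [b [f [a1 b1 aN bN df]]]] := bd N.
have fp : 0 < qnorm f.
  rewrite lt_neqAle qnorm_ge0 andbT eq_sym; apply/eqP => f0.
  move: df; rewrite (qnorm0_eq0 _ f0) (_ : (0 : X) q = 0)// (lin_0 (@inj_lin _ _ _ _ _)).
  by rewrite (lin_0 (msE_lin ms a)) (_ : (0 : X) p = 0)// (lin_0 (@inj_lin _ _ _ _ _)) (lin_0 (msE_lin ms b)) !qnorm00 mulr0 ltxx.
pose v : Lq := rscal (qnorm f)^-1 *: f q.
have v1 : qnorm v <= 1.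
  rewrite /v qnormZ sabs_rscal gtr0_norm ?invr_gt0// ler_pdivrMl// mulr1.
  exact: qnorm_comp.
have sv : d < qnorm (sandwich a b v).
  rewrite /v (lin_Z (sandwich_lin a b)) qnormZ sabs_rscal gtr0_norm ?invr_gt0//.
  by rewrite ltr_pdivlMl// mulrC.
have e0 : 0 < d / kX / 2 / K by rewrite !divr_gt0.
have [n nP] := msE_cut ms (inj v) a1 e0; have := nP n (leqnn n) => {}nP.
exists (cut n a), b, v, n; split; [split => //|split => //].
- exact: sball_cut.
- exact: supp_ge_cut.
- exact: supp_lt_cut.
have h1 : qnorm (sandwich a b v - sandwich (cut n a) b v) <= d / kX / 2.
  rewrite /sandwich -(lin_B (msE_lin ms b)) -(lin_B (@inj_lin _ _ _ _ _)).
  apply: le_trans (msE_le ms _ _) _; rewrite mulrC -ler_pdivlMr//.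
  apply: le_trans (qnorm_inj _) _; apply: le_trans nP.
  exact: (qnorm_comp (E a (inj v) - E (cut n a) (inj v)) p).
have h2 := qnorm_subl (sandwich a b v) (sandwich a b v - sandwich (cut n a) b v).
have h3 : d / kX <= qnorm (sandwich a b v) / kX by rewrite ler_wpM2r ?invr_ge0 ?(ltW kX0)// ltW.
move: h2; rewrite subKr -/kX; have := splitr (d / kX); lra.
Qed.

(* Differences of humps almost agreeing on finitely many functionals. *)
Lemma bad_null d : 0 < d -> bad d -> exists2 d2 : R, 0 < d2 & exists C, forall M eta, 0 < eta ->
  exists a b v n, [/\ sball a, sball b, supp_ge a M, supp_ge b M & supp_lt a n] /\
    [/\ cnull M eta v, qnorm v <= C & d2 <= qnorm (sandwich a b v)].
Proof.
move=> d0 /(bad_normalized d0)[d1 d10 bd].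
exists (d1 / kX / 2); first by rewrite !divr_gt0.
exists (kap Lq * (1 + 1)) => M eta eta0.
have /choice[T TP] : forall N, exists abvn : (nat -> scalar R k) * (nat -> scalar R k) * Lq * nat,
    [/\ sball abvn.1.1.1, sball abvn.1.1.2, supp_ge abvn.1.1.1 N, supp_ge abvn.1.1.2 N & supp_lt abvn.1.1.1 abvn.2] /\
    (qnorm abvn.1.2 <= 1 /\ d1 <= qnorm (sandwich abvn.1.1.1 abvn.1.1.2 abvn.1.2)).
  by move=> N; have [a [b [v [n h]]]] := bd N; exists (a, b, v, n).
pose a N := (T N).1.1.1; pose b N := (T N).1.1.2; pose v N := (T N).1.2; pose n N := (T N).2.
have v1 N : qnorm (v N) <= 1 := (TP N).2.1.
have vb i : exists C, forall N, sabs (v N i) <= C.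
  by exists 1 => N; exact: le_trans (coord_le (v N) i) (v1 N).
have [S1 S1inf [_ S1P]] := @pigeonhole R k M (fun i N => v N i) setT eta eta0 vb unbddT.
have cb i : exists C, forall N, sabs (c (inj (v N)) i) <= C.
  have [C C0 CP] := msc_bound ms i; exists C => N; apply: le_trans (CP _) _.
  by rewrite -[leRHS]mulr1 ler_wpM2l// (le_trans (qnorm_inj _)).
have [S2 S2inf [S2S S2P]] := @pigeonhole R k M (fun i N => c (inj (v N)) i) S1 eta eta0 cb S1inf.
(* [t] is fixed first and [s] taken far beyond it: the symbol [a s] then starts so late that it
   nearly annihilates [v t], and subtracting [v t] does not destroy the hump. *)
have [t _ S2t] := S2inf 0%N.
have e0 : 0 < d1 / kX / 2 / K by rewrite !divr_gt0.
have [N NP] := msE_tail ms (inj (v t)) e0.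
have [s sN S2s] := S2inf (maxn M N).
have [[a1 b1 aM bM an] [_ ds]] := TP s.
have sM : (M <= s)%N := leq_trans (leq_maxl _ _) sN.
exists (a s), (b s), (v s - v t), (n s); split; split => //.
- exact: supp_ge_le aM.
- exact: supp_ge_le bM.
- split=> i iM; first exact: S1P iM (S2S _ S2s) (S2S _ S2t).
  by rewrite (lin_B (@inj_lin _ _ _ _ _)) mscB; exact: S2P.
- by apply: le_trans (qnormBk _ _) _; rewrite ler_wpM2l ?kap_ge0// lerD.
have h1 : qnorm (sandwich (a s) (b s) (v t)) <= d1 / kX / 2.
  apply: le_trans (sandwich_le _ _ _) _; rewrite mulrC -ler_pdivlMr//.
  apply: le_trans (qnorm_comp _ _) _; apply: NP => // i iN; apply: aM.
  by apply: leq_trans iN _; exact: leq_trans (leq_maxr _ _) sN.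
rewrite (lin_B (sandwich_lin (a s) (b s))).
have h2 := qnorm_subl (sandwich (a s) (b s) (v s)) (sandwich (a s) (b s) (v t)).
have h3 : d1 / kX <= qnorm (sandwich (a s) (b s) (v s)) / kX by rewrite ler_wpM2r ?invr_ge0 ?(ltW kX0).
move: h2; rewrite -/kX; have := splitr (d1 / kX); lra.
Qed.

(** The lower estimate in $\ell_p$ also wants the image to be small on its first coordinates, which
    a second difference of humps provides. The outer symbol has then done its work, namely to
    certify that the image is not small, and is dropped. *)
Lemma bad_block d : 0 < d -> bad d -> exists2 d3 : R, 0 < d3 & exists2 C : R, 0 <= C & forall M eta, 0 < eta ->
  exists a v n, [/\ sball a, supp_ge a M, supp_lt a n & cnull M eta v] /\
    [/\ qnorm v <= C, null M eta (block a v) & d3 <= qnorm (block a v)].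
Proof.
move=> d0 /(bad_null d0)[d2 d20 [C0 bd]]; have kp0 := kap_gt0 Lp.
have C00 : 0 <= C0.
  by have [a [b [v [n [_ [_ vC _]]]]]] := bd 0%N 1 ltr01; apply: le_trans vC; exact: qnorm_ge0.
exists (d2 / 2 / (kX * K)); first by rewrite !divr_gt0// mulr_gt0.
exists (kap Lq * (C0 + C0)); first by rewrite mulr_ge0 ?kap_ge0// addr_ge0.
move=> M eta eta0.
have [e e0 [e1 e2]] : exists2 e : R, 0 < e & kap Lp * (e + e) <= eta / 2 /\
    kX * (kX * (e + K * (kap Lp * (e + e)))) <= d2 / 2.
  have D0 : 0 < kX * (kX * (1 + K * (kap Lp * 2))) by rewrite !mulr_gt0// addr_gt0// !mulr_gt0.
  exists (Num.min (eta / 2 / (kap Lp * 2)) (d2 / 2 / (kX * (kX * (1 + K * (kap Lp * 2)))))).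
    by rewrite lt_min !divr_gt0// mulr_gt0.
  set e := Num.min _ _; split.
    have -> : kap Lp * (e + e) = e * (kap Lp * 2) by ring.
    by rewrite -ler_pdivlMr ?mulr_gt0// /e ge_min lexx.
  have -> : kX * (kX * (e + K * (kap Lp * (e + e)))) = e * (kX * (kX * (1 + K * (kap Lp * 2)))) by ring.
  by rewrite -ler_pdivlMr// /e ge_min lexx orbT.
pose et j : R := Num.min (eta / 2) j.+1%:R^-1.
have et0 j : 0 < et j by rewrite lt_min invr_gt0 ltr0Sn divr_gt0.
have /choice[T TP] : forall j, exists abvn : (nat -> scalar R k) * (nat -> scalar R k) * Lq * nat,
    [/\ sball abvn.1.1.1, sball abvn.1.1.2, supp_ge abvn.1.1.1 (maxn M j), supp_ge abvn.1.1.2 (maxn M j) &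
      supp_lt abvn.1.1.1 abvn.2] /\
    [/\ cnull (maxn M j) (et j) abvn.1.2, qnorm abvn.1.2 <= C0 &
      d2 <= qnorm (sandwich abvn.1.1.1 abvn.1.1.2 abvn.1.2)].
  by move=> j; have [a [b [v [n h]]]] := bd (maxn M j) _ (et0 j); exists (a, b, v, n).
pose a N := (T N).1.1.1; pose b N := (T N).1.1.2; pose v N := (T N).1.2; pose n N := (T N).2.
pose w j := block (a j) (v j).
have vC j : qnorm (v j) <= C0 by have [_ []] := TP j.
have wb i : exists C, forall j, sabs (w j i) <= C.
  exists (K * C0) => j; apply: le_trans (coord_le _ _) _; apply: le_trans (block_le _ _) _.
  by rewrite ler_wpM2l ?(ltW K0).
have eta2 : 0 < eta / 2 by rewrite divr_gt0.
have [S Sinf [_ SP]] := @pigeonhole R k M (fun i j => w j i) setT _ eta2 wb unbddT.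
have [t _ St] := Sinf 0%N.
have [[at1 _ atM _ atn] [vtnull _ _]] := TP t; rewrite -/(a t) -/(v t) -/(n t) in at1 atM atn vtnull.
have [eta1 eta10 small] := msE_small ms (n t) e0.
have [N1 N1P] := msE_tail ms (inj (v t)) e0.
have [N2 N2P] := msE_tail ms (inj (w t) : X) e0.
have [s sN Ss] := Sinf (maxn (maxn (n t) N1) (maxn N2 (Num.bound eta1^-1))).
move: sN; rewrite !geq_max => /andP[/andP[snt sN1] /andP[sN2 sB]].
have [[as1 bs1 asM bsM asn] [vsnull _ ds]] := TP s.
rewrite -/(a s) -/(v s) -/(b s) -/(n s) in as1 bs1 asM bsM asn vsnull ds.
have smax := leq_maxr M s.
have ets : et s <= eta1.
  rewrite /et ge_min; apply/orP; right; rewrite invf_ple ?posrE ?ltr0Sn//.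
  apply: le_trans (_ : s%:R <= _); last by rewrite ler_nat.
  apply: le_trans (ltW (archi_boundP _)) _; first by rewrite invr_ge0 ltW.
  by rewrite ler_nat.
have r1 : qnorm (block (a t) (v s)) <= e.
  apply: le_trans (qnorm_comp _ _) _; apply: small => // i int; apply: le_trans ets.
  by apply: vsnull.2; apply: leq_trans int _; exact: leq_trans smax.
have r2 : qnorm (block (a s) (v t)) <= e.
  apply: le_trans (qnorm_comp _ _) _; apply: N1P => // i iN; apply: asM.
  by apply: leq_trans iN _; exact: leq_trans smax.
have r3 : qnorm (E (b s) (inj (w t))) <= e.
  apply: N2P => // i iN; apply: bsM.
  by apply: leq_trans iN _; exact: leq_trans smax.
pose r := block (a t) (v s) - block (a s) (v t).
have rle : qnorm r <= kap Lp * (e + e).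
  by apply: le_trans (qnormBk _ _) _; rewrite ler_wpM2l ?(ltW kp0)// lerD.
have asnt : supp_ge (a s) (n t) by apply: supp_ge_le asM; exact: leq_trans smax.
(* The two symbols have disjoint supports, so their sum is admissible. It acts on [v s - v t] as
   [w s - w t] up to the cross terms collected in [r]. *)
pose A i := a t i + a s i.
have A1 : sball A by exact: sball_disj atn asnt.
have blockA : block A (v s - v t) = (w s - w t) + r.
  rewrite /A block_add// !(lin_B (block_lin _)) addrC /r /w.
  by rewrite addrACA [RHS]addrACA [X in _ + X = _]addrC.
exists A, (v s - v t), (maxn (n t) (n s)); split; split => //.
- by move=> i iM; rewrite /A atM ?asM ?addr0// (leq_trans iM)// leq_maxl.
- by move=> i; rewrite geq_max => /andP[i1 i2]; rewrite /A atn// asn// addr0.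
- have ett j : et j <= eta / 2 by rewrite ge_min lexx.
  split=> i iM; [rewrite ellB|rewrite (lin_B (@inj_lin _ _ _ _ _)) mscB].
    rewrite (le_trans (le_sabsD _ _))// sabsN [leRHS]splitr lerD//.
      by apply: le_trans (ett s); apply: vsnull.1; rewrite leq_max iM.
    by apply: le_trans (ett t); apply: vtnull.1; rewrite leq_max iM.
  rewrite (le_trans (le_sabsD _ _))// sabsN [leRHS]splitr lerD//.
    by apply: le_trans (ett s); apply: vsnull.2; rewrite leq_max iM.
  by apply: le_trans (ett t); apply: vtnull.2; rewrite leq_max iM.
- by apply: le_trans (qnormBk _ _) _; rewrite ler_wpM2l ?kap_ge0// lerD.
- move=> i iM; rewrite blockA ellD ellB (le_trans (le_sabsD _ _))// [leRHS]splitr lerD//.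
    exact: SP.
  by apply: le_trans (coord_le _ _) _; exact: le_trans e1.
rewrite ler_pdivrMr ?mulr_gt0//.
(* Applying the outer symbol of [s] to [w s]: it nearly annihilates [w t], and [r] is small, so the
   block of the difference has to carry the lower bound [d2]. *)
pose S' (z : Lp) := E (b s) (inj z) : X.
have lS : linear S' by exact: lin_comp (msE_lin ms (b s)) (@inj_lin _ _ _ _ _).
have Sle z : qnorm (S' z) <= K * qnorm z.
  by apply: le_trans (msE_le ms _ _) _; rewrite ler_wpM2l ?(ltW K0)// qnorm_inj.
have wsE : w s = block A (v s - v t) + (w t - r).
  by rewrite blockA addrACA subrr addr0 subrK.
have h1 : qnorm (S' (w t - r)) <= kX * (e + K * (kap Lp * (e + e))).
  rewrite (lin_B lS) (le_trans (qnormBk _ _))// ler_wpM2l ?(ltW kX0)// lerD//.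
  by apply: le_trans (Sle _) _; rewrite ler_wpM2l ?(ltW K0).
have h2 : qnorm (S' (w s)) <= kX * (K * qnorm (block A (v s - v t)) + kX * (e + K * (kap Lp * (e + e)))).
  rewrite wsE (lin_D lS) (le_trans (qnormDk _ _))// ler_wpM2l ?(ltW kX0)// lerD//.
have h3 : d2 <= qnorm (S' (w s)) := ds.
move: h2; rewrite mulrDr => h2; have := splitr d2.
have -> : qnorm (block A (v s - v t)) * (kX * K) = kX * (K * qnorm (block A (v s - v t))) by ring.
by move: h2; set Z := kX * (K * _); lra.
Qed.

(** Each new hump is chosen after the current sum, so that both the vectors and their images are
    almost disjoint from what was built. The errors are adapted to m, so each step changes the two
    powers by fixed amounts. *)
Lemma bad_sums d r s : 0 < d -> bad d -> 0 < r -> 0 < s -> val (pe p) = r%:E ->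
  val (pe q) = s%:E \/ val (pe q) = +oo%E ->
  exists C4 c4 : R, [/\ 0 <= C4, 0 < c4 & forall m, exists a v n, [/\ sball a, supp_lt a n,
    qnorm v `^ s <= m%:R * C4 & m%:R * c4 <= qnorm (block a v) `^ r]].
Proof.
move=> d0 /(bad_block d0)[d3 d30 [C C0 bd]] r0 s0 pr qs.
have kp0 := kap_gt0 Lp.
pose D := C `^ s; have D0 : 0 <= D by exact: powR_ge0.
pose c4 := d3 `^ r / 2; have c40 : 0 < c4 by rewrite divr_gt0// powR_gt0.
exists (D + 1), c4; split => [||m]; [by rewrite addr_ge0|exact: c40|].
elim: m => [|m [a [v [n [a1 an vs wr]]]]].
  exists (fun=> 0), 0, 0%N; split => //; first exact: sball0.
    by rewrite qnorm00 powR0 ?mul0r// gt_eqF.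
  by rewrite mul0r powR_ge0.
have mR0 : 0 <= m%:R :> R by rewrite ler0n.
have e10 : 0 < (m%:R * (D + 1) + D + 1)^-1.
  by rewrite invr_gt0 ltr_wpDl// addr_ge0// mulr_ge0// addr_ge0.
have e20 : 0 < c4 / ((m%:R + 1) * c4 + 1).
  by rewrite divr_gt0// ltr_wpDl// mulr_ge0 ?addr_ge0// ltW.
have [M1 [eta1 eta10 up]] := bl_upper v s0 qs e10.
have [M2 [eta2 eta20 low]] := bl_lower (block a v) r0 pr e20.
have e30 : 0 < eta2 / (kap Lp * 2) by rewrite divr_gt0// mulr_gt0.
have [eta3 eta30 small] := msE_small ms n e30.
have [N NP] := msE_tail ms (inj v) e30.
pose M := maxn (maxn M1 M2) (maxn n N); pose eta := Num.min (Num.min eta1 eta2) eta3.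
have eta0 : 0 < eta by rewrite !lt_min eta10 eta20 eta30.
have [a' [v' [n' [[a'1 a'M a'n v'null] [v'C w'null w'd]]]]] := bd M eta eta0.
have [M1M M2M] : (M1 <= M)%N /\ (M2 <= M)%N by rewrite /M !leq_max !leqnn !orbT.
have [nM NM] : (n <= M)%N /\ (N <= M)%N by rewrite /M !leq_max !leqnn !orbT.
have eta_1 : eta <= eta1 by rewrite /eta !ge_min lexx.
have eta_2 : eta <= eta2 by rewrite /eta !ge_min lexx orbT.
have eta_3 : eta <= eta3 by rewrite /eta !ge_min lexx !orbT.
have a'ge : supp_ge a' n by exact: supp_ge_le nM a'M.
pose A i := a i + a' i; have A1 : sball A by exact: sball_disj an a'ge.
(* The cross terms: the old symbol meets tiny coefficients of [v'], and the new symbol lies in the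
   tail for [v]. *)
pose t := block a v' + block a' v.
have tle : qnorm t <= eta2.
  apply: le_trans (qnormDk _ _) _; rewrite -[leRHS](half_kap (Lp : quasiNormedType R k)).
  rewrite ler_wpM2l ?(ltW kp0)// lerD//.
    apply: le_trans (qnorm_comp _ _) _; apply: small => // i i_n; apply: le_trans eta_3.
    by apply: v'null.2; exact: leq_trans nM.
  by apply: le_trans (qnorm_comp _ _) _; apply: NP => //; exact: supp_ge_le NM a'M.
have blockA : block A (v + v') = block a v + block a' v' + t.
  by rewrite /A block_add// !(lin_D (block_lin _)) /t [X in _ + X = _]addrC addrACA.
exists A, (v + v'), (maxn n n'); split.
- exact: A1.
- by move=> i; rewrite geq_max => /andP[i1 i2]; rewrite /A an// a'n// addr0.
- have := up v' (fun i iM => le_trans (v'null.1 i (leq_trans iM M1M)) eta_1).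
  move=> /(upper_step mR0 D0 vs); rewrite natr1; apply.
  by rewrite powR_le_root ?qnorm_ge0.
- have := low (block a' v') t (fun i iM => le_trans (w'null i (leq_trans iM M2M)) eta_2) tle.
  rewrite -blockA => /(lower_step mR0 c40 wr); rewrite natr1; apply.
  rewrite [X in X <= _](_ : _ = d3 `^ r); last by rewrite /c4 mulrC divfK// pnatr_eq0.
  by rewrite powR_le_root ?qnorm_ge0// ltW.
Qed.

(* For p < q, l_q-sums of n blocks have norm of order n^(1/q) while their images
   contain l_p-sums, of norm of order n^(1/p). *)
Lemma sandwich_small d : 0 < d -> exists N, forall a b f, sball a -> sball b ->
  supp_ge a N -> supp_ge b N -> qnorm (E b (inj (E a (inj (f q)) p))) <= d * qnorm f.
Proof.
move=> d0; apply: contrapT => /forallNP nb.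
have bd : bad d.
  move=> N; apply: contrapT => H; apply: (nb N) => a b f a1 b1 aN bN.
  by rewrite leNgt; apply/negP => df; apply: H; exists a, b, f.
(* For c_0 any finite s > r may replace the infinite exponent, by the corresponding case of
   [bl_upper]. *)
have [r [s [r0 s0 rs [pr qs]]]] : exists r s : R, [/\ 0 < r, 0 < s, r < s &
    val (pe p) = r%:E /\ (val (pe q) = s%:E \/ val (pe q) = +oo%E)].
  move: pq; have [[r r0 ->]|->] := exponentP (pe p); last by rewrite ltNge leey.
  have [[s s0 ->]|->] := exponentP (pe q); first by rewrite lte_fin => rs; exists r, s; split => //; split => //; left.
  by move=> _; exists r, (r + 1); split; rewrite ?addr_gt0 ?ltrDl//; split => //; right.
have [C4 [c4 [C40 c40 H]]] := bad_sums d0 bd r0 s0 pr qs.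
(* The growth rates give $m\,c_4\le G\,m^{\theta}$ with $\theta=r/s<1$, which fails for large m. *)
pose th := r / s; have th1 : 0 < 1 - th by rewrite subr_gt0 ltr_pdivrMr// mul1r.
pose G := K `^ r * C4 `^ th.
have G0 : 0 <= G by rewrite mulr_ge0 ?powR_ge0.
have main m : m%:R * c4 <= G * m%:R `^ th.
  have [a [v [n [a1 an vs wr]]]] := H m; apply: le_trans wr _.
  apply: (@le_trans _ _ ((K * qnorm v) `^ r)).
    by rewrite powR_le_root ?qnorm_ge0 ?mulr_ge0 ?(ltW K0) ?qnorm_ge0// block_le.
  rewrite powRM ?(ltW K0) ?qnorm_ge0// /G -mulrA ler_wpM2l ?powR_ge0//.
  have -> : r = s * th by rewrite /th mulrC divfK// gt_eqF.
  rewrite [s * th]mulrC -/th [th * s]mulrC powRrM.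
  apply: (@le_trans _ _ ((m%:R * C4) `^ th)).
    by rewrite powR_le_root ?powR_ge0 ?mulr_ge0// divr_gt0.
  by rewrite powRM// mulrC.
pose B := G / c4 + 1; have B0 : 0 < B by rewrite ltr_wpDl// divr_ge0// ltW.
pose m := (Num.bound (B `^ (1 - th)^-1)).+1.
have Bm : B `^ (1 - th)^-1 <= m%:R.
  by apply: le_trans (ltW (archi_boundP _)) _; rewrite ?powR_ge0// ler_nat.
have Bm' : B <= m%:R `^ (1 - th).
  have -> : B = (B `^ (1 - th)^-1) `^ (1 - th) by rewrite -powRrM mulVf ?gt_eqF// powRr1// ltW.
  by rewrite powR_le_root ?powR_ge0.
have m0 : 0 < m%:R :> R by rewrite ltr0Sn.
have := main m.
have mE : m%:R = m%:R `^ (1 - th) * m%:R `^ th :> R.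
  by rewrite -powRD ?subrK ?powRr1// ?ltW// gt_eqF// implybT.
rewrite {1}mE mulrAC ler_pM2r ?powR_gt0// -ler_pdivlMr// => /(le_trans Bm').
by rewrite /B gerDl leNgt ltr01.
Qed.

End Hump.

(** * Splitting the basis *)

Section Splitting.
Context {R : realType} {k : scalar_kind} {I : finType} (pe : I -> exponent R).
Hypothesis pe_inj : injective pe.
Local Notation X := (dsum (fun i : I => ell k (pe i))).
Variable ms : multsys X.
Implicit Types (a b : nat -> scalar R k) (f : X).
Local Notation E := (msE ms).
Local Notation c := (msc ms).
Local Notation x := (msx ms).
Local Notation K := (msK ms).

Definition proj (i : I) f : X := inj (f i).

Lemma proj_lin i : linear (proj i).
Proof. exact: lin_comp (@inj_lin _ _ _ _ i) (@comp_lin _ _ _ _ i). Qed.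

Lemma qnorm_proj i f : qnorm (proj i f) <= qnorm f.
Proof. exact: le_trans (qnorm_inj _) (qnorm_comp f i). Qed.

Lemma sum_proj f : \sum_i proj i f = f.
Proof. exact: sum_inj. Qed.

Lemma E_bnd a : bnd (E a).
Proof. by exists K => [|f]; [exact: ltW (msK_gt0 ms)|exact: msE_le]. Qed.

Lemma msc_sum n (F : nat -> X) j : c (\sum_(i < n) F i) j = \sum_(i < n) c (F i) j.
Proof.
elim: n => [|n IH]; last by rewrite !big_ord_recr /= mscD IH.
rewrite !big_ord0; have := mscD ms (0 : X) 0 j; rewrite addr0 => /eqP.
by rewrite -subr_eq0 opprD addrA subrr sub0r oppr_eq0 => /eqP.
Qed.

Lemma mscZ s f j : c (s *: f) j = s * c f j.
Proof.
have := msc_lin ms s f 0 j; rewrite addr0 => ->.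
by have := msc_sum 0 (fun=> 0) j; rewrite !big_ord0 => ->; rewrite addr0.
Qed.

Definition diag p i : scalar R k := c (proj p (x i)) i.

Lemma sum_diag i : msreal ms i -> \sum_p diag p i = 1.
Proof.
move=> ri; have cl : forall (s : seq I), \sum_(p <- s) diag p i = c (\sum_(p <- s) proj p (x i)) i.
  elim=> [|p s IH]; last by rewrite !big_cons mscD IH.
  by rewrite !big_nil; have := msc_sum 0 (fun=> 0) i; rewrite !big_ord0.
by rewrite cl sum_proj msc_delta eqxx ri.
Qed.

Definition nI : R := #|I|%:R.

(* [label i = Some p] means i \in J_p. *)
Definition label i : option I := if msreal ms i then [pick p | nI^-1 <= sabs (diag p i)] else None.

Lemma label_diag i p : label i = Some p -> nI^-1 <= sabs (diag p i).
Proof. by rewrite /label; case: ifP => // _; case: pickP => // q h [<-]. Qed.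

Lemma label_real i : (label i != None) = msreal ms i.
Proof.
rewrite /label; case: ifP => // ri; case: pickP => // none.
have : (1 : R) <= \sum_p sabs (diag p i).
  rewrite -(@sabs1 R k) -(sum_diag ri); elim/big_rec2 : _ => [|p y z _ yz]; first by rewrite sabs0.
  by apply: le_trans (le_sabsD _ _) _; rewrite lerD2l.
case: (pickP (@predT I)) => [p _|I0]; last by rewrite big_pred0// ler10.
have n0 : 0 < nI by rewrite /nI ltr0n; apply/card_gt0P; exists p.
move=> h; have : \sum_(p : I) sabs (diag p i) < \sum_(p : I) nI^-1.
  apply: ltr_sum => [|q _]; last by rewrite ltNge none.
  by apply/hasP; exists p; rewrite ?mem_index_enum.
rewrite sumr_const -[X in _ < X]mulr_natr mulVf ?gt_eqF// => /(le_lt_trans h).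
by rewrite ltxx.
Qed.

Definition chi p N i : scalar R k := if (label i == Some p) && (N <= i)%N then 1 else 0.

Lemma chiE p N i : chi p N i = if (label i == Some p) && (N <= i)%N then 1 else 0.
Proof. by []. Qed.

Lemma sball_chi p N : sball (chi p N).
Proof. by move=> i; rewrite /chi; case: ifP; rewrite ?sabs1 ?sabs0. Qed.

Lemma supp_chi p N : supp_ge (chi p N) N.
Proof. by move=> i iN; rewrite /chi leqNgt iN andbF. Qed.

Lemma chi_idem p N f : E (chi p N) (E (chi p N) f) = E (chi p N) f.
Proof.
rewrite msE_mul; [|exact: sball_chi..].
by congr E; apply/funext => i; rewrite /chi; case: ifP; rewrite ?mulr1 ?mulr0.
Qed.

Lemma chi_split p N f : E (chi p 0) f = E (cut N (chi p 0)) f + E (chi p N) f.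
Proof.
have c1 := sball_cut N (sball_chi p 0); have cN := @supp_lt_cut _ _ N (chi p 0).
rewrite -msE_add//; first 1 last.
- exact: sball_chi.
- exact: sball_disj c1 (@sball_chi p N) cN (@supp_chi p N).
congr E; apply/funext => i; rewrite /cut /chi leq0n andbT.
by case: leqP; rewrite ?andbF ?andbT ?addr0 ?add0r.
Qed.

(* The weight is scaled by 1/#|I| to have modulus at most 1. *)
Definition weight p N i : scalar R k := if (label i == Some p) && (N <= i)%N then (rscal nI * diag p i)^-1 else 0.

Lemma weightE p N i : weight p N i * diag p i = rscal nI^-1 * chi p N i.
Proof.
rewrite /weight /chi; case: ifP => [/andP[/eqP ip _]|]; last by rewrite mul0r mulr0.
have n0 : 0 < nI by rewrite /nI ltr0n; apply/card_gt0P; exists p.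
have d0 : diag p i != 0.
  apply/eqP => d0; have := label_diag ip; rewrite d0 sabs0 leNgt invr_gt0 n0//.
rewrite mulr1 invfM mulrAC -mulrA divff// mulr1.
have : rscal nI^-1 * rscal nI = 1 :> scalar R k by rewrite -rscalM mulVf ?gt_eqF// rscal1.
move=> h; have rn : rscal nI != 0 :> scalar R k.
  by apply/eqP => rn; move: h; rewrite rn mulr0 => /eqP; rewrite eq_sym oner_eq0.
by apply: (mulIf rn); rewrite h mulVf.
Qed.

Lemma sball_weight p N : sball (weight p N).
Proof.
move=> i; rewrite /weight; case: ifP => [/andP[/eqP ip _]|]; last by rewrite sabs0.
have n0 : 0 < nI by rewrite /nI ltr0n; apply/card_gt0P; exists p.
have nd : 1 <= sabs (rscal nI * diag p i).
  by rewrite sabsM sabs_rscal gtr0_norm// -ler_pdivrMl// mulr1 label_diag.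
have z : rscal nI * diag p i != 0.
  by apply/eqP => z; move: nd; rewrite z sabs0 ler10.
by rewrite sabsV// invf_le1// (lt_le_trans ltr01).
Qed.

Lemma sandwich_proj p q d : (val (pe p) < val (pe q))%E -> 0 < d -> exists N, forall a b f,
  sball a -> sball b -> supp_ge a N -> supp_ge b N ->
  qnorm (E b (proj p (E a (proj q f)))) <= d * qnorm f.
Proof. by move=> pq d0; have [N NP] := sandwich_small ms pq d0; exists N => a b f; exact: NP. Qed.

(** Going from q to p and back to q passes once from the larger exponent to the smaller. That
    passage is small by [sandwich_proj]; the remaining factors are merely bounded. *)
Lemma signed_sandwich p q d : p != q -> 0 < d -> exists N, forall a b e f,
  sball a -> sball b -> sball e -> supp_ge a N -> supp_ge b N -> supp_ge e N ->
  qnorm (E b (proj q (E a (proj p (E e (proj q f)))))) <= d * qnorm f.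
Proof.
move=> pq d0; have K0 := msK_gt0 ms; have dK0 : 0 < d / K by rewrite divr_gt0.
have : (val (pe p) < val (pe q))%E || (val (pe q) < val (pe p))%E.
  by rewrite -neq_lt; apply: contra_neq pq => /val_inj/pe_inj.
move=> /orP[pq'|qp]; [have [N NP] := sandwich_proj pq' dK0|have [N NP] := sandwich_proj qp dK0].
  exists N => a b e f a1 b1 e1 aN bN eN.
  apply: le_trans (msE_le ms _ _) _; rewrite mulrC -ler_pdivlMr// mulrAC.
  by apply: le_trans (qnorm_proj _ _) _; exact: NP.
exists N => a b e f a1 b1 e1 aN bN eN.
apply: le_trans (NP _ _ _ a1 b1 aN bN) _; rewrite mulrAC ler_pdivrMr// -mulrA ler_wpM2l ?(ltW d0)//.
by apply: le_trans (msE_le ms _ _) _; rewrite mulrC ler_wpM2r ?(ltW K0)// qnorm_proj.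
Qed.

(* The diagonal part of e |-> E_(w e) P_p E_e is E_(w d_p); the chaos estimate
   bounds it by the supremum over signs e, and w d_p = chi_p / n. *)
Lemma diagonal_small p q d : p != q -> 0 < d -> exists N, forall M b f, (N <= M)%N ->
  sball b -> supp_ge b N -> qnorm (E b (proj q (E (chi p M) (proj q f)))) <= d * qnorm f.
Proof.
move=> pq d0; have K0 := msK_gt0 ms; have k0 := kap_gt0 X.
have n0 : 0 < nI by rewrite /nI ltr0n; apply/card_gt0P; exists p.
have [C C0 CP] := @dsum_chaos R k I pe.
pose D := kap X * (nI * (C + 1)); have D0 : 0 < D by rewrite !mulr_gt0// ltr_wpDl.
have [N NP] := signed_sandwich pq (divr_gt0 d0 D0); exists N => M b f NM b1 bN.
have f0 := qnorm_ge0 f.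
have fin m : qnorm (E b (proj q (E (cut m (chi p M)) (proj q f)))) <= nI * (C + 1) * (d / D * qnorm f).
  (* Expanding both finite multipliers: i runs over the inner one, restricted to indices from [M]
     on, and j over the weighted outer one. On the diagonal [weightE] turns weight times [diag] into
     the indicator divided by [nI]. *)
  pose y i j : X := (cut m (weight p M) j * c (proj p (x i)) j * (if (M <= i)%N then c (proj q f) i else 0)) *: E b (proj q (x j)).
  have ch e : qnorm (chaos m y e) <= d / D * qnorm f.
    pose w j := cut m (weight p M) j * ssg e j.
    pose s i : scalar R k := if ((i < m) && (M <= i))%N then ssg e i else 0.
    have w1 : sball w by move=> j; rewrite /w sabsM sabs_ssg mulr1; exact/sball_cut/sball_weight.
    have s1 : sball s by move=> j; rewrite /s; case: ifP; rewrite ?sabs_ssg ?sabs0.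
    have wN : supp_ge w N.
      move=> j jN; rewrite /w /cut /weight; case: ifP; rewrite ?mul0r// => _.
      by rewrite leqNgt (leq_trans jN NM) andbF mul0r.
    have sN : supp_ge s N by move=> j jN; rewrite /s [(M <= j)%N]leqNgt (leq_trans jN NM) andbF.
    have wm : supp_lt w m by move=> j mj; rewrite /w /cut ltnNge mj mul0r.
    have sm : supp_lt s m by move=> j mj; rewrite /s ltnNge mj.
    have -> : chaos m y e = E b (proj q (E w (proj p (E s (proj q f))))); last exact: NP.
    rewrite (msE_fin _ _ s1 sm) (lin_sum (proj_lin p)) (msE_fin _ _ w1 wm).
    rewrite (lin_sum (proj_lin q)) (lin_sum (msE_lin ms b)) /chaos exchange_big /=.
    apply: eq_bigr => j _; rewrite (lin_Z (proj_lin q)) (lin_Z (msE_lin ms b)).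
    rewrite (lin_Z (proj_lin q)) (lin_Z (msE_lin ms b)) scalerA.
    rewrite (msc_sum m (fun i => proj p (s i *: (c (proj q f) i *: x i)))) mulr_sumr scaler_suml.
    apply: eq_bigr => i _; rewrite !(lin_Z (proj_lin p)) !mscZ /y scalerA /w /s ltn_ord /=.
    congr (_ *: _); case: ifP => _; last by rewrite mul0r !mulr0.
    ring.
  have c0 : 0 <= d / D * qnorm f by rewrite mulr_ge0// divr_ge0// ltW.
  have := CP m y _ c0 ch.
  have -> : \sum_(i < m) y i i = rscal nI^-1 *: E b (proj q (E (cut m (chi p M)) (proj q f))).
    rewrite (msE_fin _ _ (sball_cut m (sball_chi p M)) (@supp_lt_cut _ _ m (chi p M))).
    rewrite (lin_sum (proj_lin q)) (lin_sum (msE_lin ms b)) scaler_sumr; apply: eq_bigr => i _.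
    rewrite !(lin_Z (proj_lin q)) !(lin_Z (msE_lin ms b)) !scalerA /y; congr (_ *: _).
    rewrite /cut ltn_ord -/(diag p i) weightE /chi.
    by case: (leqP M i) => Mi; rewrite ?andbT ?andbF ?mulr0 ?mul0r//; ring.
  rewrite qnormZ sabs_rscal gtr0_norm ?invr_gt0// ler_pdivrMl// => /le_trans; apply.
  by rewrite -[leRHS]mulrA ler_wpM2l ?(ltW n0)// ler_wpM2r// lerDl.
(* The finite estimate is uniform in the cut [m], so the tail of the multiplier costs only an
   arbitrary [e]. *)
apply/ler_addgt0Pr => e e0.
have eK : 0 < e / kap X / K by rewrite !divr_gt0.
have [m mP] := msE_cut ms (proj q f) (sball_chi p M) eK.
have h1 : qnorm (E b (proj q (E (chi p M) (proj q f) - E (cut m (chi p M)) (proj q f)))) <= e / kap X.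
  apply: le_trans (msE_le ms _ _) _; rewrite mulrC -ler_pdivlMr//.
  by apply: le_trans (qnorm_proj _ _) _; exact: mP.
rewrite -[E (chi p M) (proj q f)](subrK (E (cut m (chi p M)) (proj q f))) (lin_D (proj_lin q)) (lin_D (msE_lin ms b)).
apply: le_trans (qnormDk _ _) _; rewrite mulrDr addrC lerD//; last by rewrite mulrC -ler_pdivlMr.
apply: le_trans (ler_wpM2l (ltW k0) (fin m)) _.
have -> : kap X * (nI * (C + 1) * (d / D * qnorm f)) = d * qnorm f * (D / D) by rewrite /D; ring.
by rewrite divff ?gt_eqF// mulr1.
Qed.

(** Equal exponents are covered by the chaos estimate, q < q' by the gliding hump. Passages to a
    strictly larger exponent stay uncontrolled, which leaves a strictly triangular system. *)
Lemma star p q q' d : q != p -> (val (pe q) <= val (pe q'))%E -> 0 < d -> exists N, forall M f, (N <= M)%N ->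
  qnorm (E (chi p M) (proj q (E (chi p M) (proj q' f)))) <= d * qnorm f.
Proof.
move=> qp qq' d0; move: qq'; rewrite le_eqVlt => /orP[/eqP/val_inj/pe_inj <-|qq].
  have pq : p != q by rewrite eq_sym.
  have [N NP] := diagonal_small pq d0; exists N => M f NM.
  apply: NP => //; first exact: sball_chi.
  exact: supp_ge_le NM (@supp_chi p M).
have [N NP] := sandwich_proj qq d0; exists N => M f NM.
by apply: NP; (exact: sball_chi) || exact: supp_ge_le NM (@supp_chi p M).
Qed.

End Splitting.

(** * Complementation of the summands *)

Section BoundedSums.
Context {R : realType} {k : scalar_kind} {V W : quasiNormedType R k}.

Lemma bnd_sum n (T : nat -> V -> W) : (forall i, bnd (T i)) -> bnd (fun u => \sum_(i < n) T i u).
Proof.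
move=> bT; elim: n => [|n [C C0 CP]].
  by exists 0 => // u; rewrite big_ord0 qnorm00 mul0r.
have [D D0 DP] := bndD (ex_intro2 _ _ C C0 CP) (bT n).
by exists D => // u; rewrite big_ord_recr; exact: DP.
Qed.

Lemma linf_sum n (T : nat -> V -> W) : (forall i, linear (T i)) -> linear (fun u => \sum_(i < n) T i u).
Proof.
move=> lT a u v; rewrite scaler_sumr -big_split /=.
by apply: eq_bigr => i _; rewrite lT.
Qed.

Lemma bnd_rank1 (phi : V -> scalar R k) C (w : W) : 0 <= C -> (forall u, sabs (phi u) <= C * qnorm u) ->
  bnd (fun u => phi u *: w).
Proof.
move=> C0 phiC; exists (C * qnorm w) => [|u]; first by rewrite mulr_ge0// qnorm_ge0.
by rewrite qnormZ mulrAC ler_wpM2r// qnorm_ge0.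
Qed.

Lemma lin_rank1 (phi : V -> scalar R k) (w : W) : (forall a u v, phi (a *: u + v) = a * phi u + phi v) ->
  linear (fun u => phi u *: w).
Proof. by move=> lphi a u v; rewrite lphi scalerDl scalerA. Qed.

End BoundedSums.

Lemma small_sum (R : realType) (k : scalar_kind) (V : quasiNormedType R k) (I : finType) (d : R) :
  0 < d -> exists2 e : R, 0 < e & forall (A : pred I) (F : I -> V) s, 0 <= s ->
    (forall i, A i -> qnorm (F i) <= e * s) -> qnorm (\sum_(i | A i) F i) <= d * s.
Proof.
move=> d0; pose D := kap V ^+ size (index_enum I) * (size (index_enum I))%:R.
have D0 : 0 <= D by rewrite mulr_ge0// exprn_ge0// kap_ge0.
have D1 : 0 < D + 1 by rewrite ltr_wpDl.
have e0 : 0 < d / (D + 1) by rewrite divr_gt0.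
exists (d / (D + 1)) => // A F s s0 Fs.
apply: le_trans (qnorm_sum_le _ (mulr_ge0 (ltW e0) s0) Fs) _; rewrite -/D mulrA ler_wpM2r//.
by rewrite mulrA ler_pdivrMr// mulrC ler_wpM2l ?(ltW d0)// lerDl.
Qed.

Section RangeComplemented.
Context {R : realType} {k : scalar_kind} {I : finType} (pe : I -> exponent R).
Hypothesis pe_inj : injective pe.
Local Notation X := (dsum (fun i : I => ell k (pe i))).
Variables (ms : multsys X) (p : I).
Implicit Types (a b : nat -> scalar R k) (f : X).
Local Notation E := (msE ms).
Local Notation c := (msc ms).
Local Notation x := (msx ms).
Local Notation K := (msK ms).
Local Notation chi := (chi ms p).

(** On the range of [E (chi N)] this is the difference between y and [E (chi N) (proj p y)]; y is
    recovered from its component p once 1 minus this operator has a left inverse. *)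
Definition defect N f : X := E (chi N) (f - proj p f).

Lemma defectE N f : defect N f = \sum_(q | q != p) E (chi N) (proj q f).
Proof.
rewrite -(lin_sum (msE_lin ms (chi N))); congr E.
by rewrite -[X in X - _](@sum_proj _ _ _ pe f) (bigD1 p)//= addrAC subrr add0r.
Qed.

Lemma defect_lin N : linear (defect N).
Proof.
move=> a f g; rewrite /defect -(msE_lin ms); congr E.
by rewrite (proj_lin (pe := pe) p) scalerBr opprD addrACA.
Qed.

Lemma iter_defect_lin N i : linear (iter i (defect N)).
Proof. by elim: i => [|i IH]//=; exact: lin_comp (defect_lin N) IH. Qed.

Lemma iter_defect_le i : exists2 B : R, 0 < B & forall N f, qnorm (iter i (defect N) f) <= B * qnorm f.
Proof.
have K0 := msK_gt0 ms; have k0 := kap_gt0 X.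
exists ((K * (kap X * 2)) ^+ i) => [|N f]; first by rewrite exprn_gt0// !mulr_gt0.
elim: i => [|i IH]; first by rewrite expr0 mul1r.
rewrite iterS exprS -mulrA -[leRHS]mulrA; set g := iter _ _ _ in IH *.
apply: le_trans (msE_le ms _ _) _; rewrite ler_wpM2l ?(ltW K0)//.
apply: le_trans (qnormBk _ _) _; rewrite -mulrA ler_wpM2l ?(ltW k0)// mulr_natl mulr2n.
by rewrite lerD//; apply: le_trans IH; exact: qnorm_proj.
Qed.

Lemma star_unif d : 0 < d -> exists N, forall q q' M f, q != p -> (val (pe q) <= val (pe q'))%E ->
  (N <= M)%N -> qnorm (E (chi M) (proj q (E (chi M) (proj q' f)))) <= d * qnorm f.
Proof.
move=> d0.
have /choice[N NP] : forall qq : I * I, exists N, forall M f, qq.1 != p ->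
    (val (pe qq.1) <= val (pe qq.2))%E -> (N <= M)%N ->
    qnorm (E (chi M) (proj qq.1 (E (chi M) (proj qq.2 f)))) <= d * qnorm f.
  move=> [q q'] /=; have [qp|] := pselect (q != p); last by exists 0%N.
  have [qq'|] := pselect (val (pe q) <= val (pe q'))%E; last by exists 0%N.
  by have [N NP] := star pe_inj ms qp qq' d0; exists N => M f _ _; exact: NP.
exists (\max_qq N qq) => q q' M f qp qq' NM; apply: (NP (q, q')) => //.
by apply: leq_trans NM; exact: leq_bigmax.
Qed.

Definition rank q := #|[pred q' | (val (pe q') < val (pe q))%E]|.

Lemma rank_lt q q' : (val (pe q') < val (pe q))%E -> (rank q' < rank q)%N.
Proof.
move=> qq; apply: proper_card; apply/properP; split.
  by apply/fintype.subsetP => r; rewrite !inE => /lt_trans; apply.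
by exists q'; rewrite !inE ?ltxx.
Qed.

Lemma rank_card q : (rank q < #|I|)%N.
Proof.
apply: proper_card; apply/properP; split; first exact/fintype.subsetP.
by exists q; rewrite !inE ?ltxx.
Qed.

(* By induction on i, the component q of [iter i defect] is small once fewer than i exponents lie
   below that of q: components q' >= q contribute little by [star_unif], and for
   q' < q the induction hypothesis applies to i - 1. *)
Lemma iter_small i d : 0 < d -> exists N, forall M q f, (N <= M)%N -> q != p -> (rank q < i)%N ->
  qnorm (E (chi M) (proj q (iter i (defect M) f))) <= d * qnorm f.
Proof.
have K0 := msK_gt0 ms; have k0 := kap_gt0 X.
elim: i d => [|i IH] d d0; first by exists 0%N.
have [e e0 sumP] := small_sum X I d0; have [B B0 BP] := iter_defect_le i.
have [N1 N1P] := star_unif (divr_gt0 e0 B0); have [N2 N2P] := IH _ (divr_gt0 e0 K0).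
exists (maxn N1 N2) => M q f; rewrite geq_max => /andP[M1 M2] qp; rewrite ltnS => qi.
rewrite iterS defectE (lin_sum (proj_lin q)) (lin_sum (msE_lin ms _)).
set g := iter _ _ _; apply: sumP => [|q' q'p]; first exact: qnorm_ge0.
have [qq'|q'q] := leP (val (pe q)) (val (pe q')).
  apply: le_trans (N1P _ _ _ _ qp qq' M1) _.
  by rewrite -[leLHS]mulrA ler_wpM2l ?(ltW e0)// ler_pdivrMl//; exact: BP.
apply: le_trans (msE_le ms _ _) _; rewrite mulrC -ler_pdivlMr//.
apply: le_trans (qnorm_proj _ _) _; rewrite [leRHS]mulrAC.
by apply: N2P => //; exact: leq_trans (rank_lt q'q) qi.
Qed.

(** Every rank is below [#|I|], so after that many iterations all components q other than p are
    small under [E (chi N)]; one more application of [defect] sums them. *)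
Lemma defect_nilpotent d : 0 < d -> exists N, forall f,
  qnorm (iter #|I|.+1 (defect N) f) <= d * qnorm f.
Proof.
move=> d0; have [e e0 sumP] := small_sum X I d0.
have [N NP] := iter_small #|I| e0; exists N => f; rewrite iterS defectE.
apply: sumP => [|q qp]; first exact: qnorm_ge0.
by apply: NP => //; exact: rank_card.
Qed.

(** With U the defect and $n=|I|+1$, only $U^n$ is small. A left inverse of $1-U^n$ composed with
    $\sum_{i<n}U^i$ is one of $1-U$, by telescoping. *)
Lemma tail_retract : exists N (B : ell k (pe p) -> X), [/\ linear B, bnd B &
  forall y, E (chi N) y = y -> B (y p) = y].
Proof.
have k0 := kap_gt0 X; have t0 : 0 < (2 * kap X)^-1 by rewrite invr_gt0 mulr_gt0.
have [N NP] := defect_nilpotent t0; have tk : kap X * (2 * kap X)^-1 <= 2^-1.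
  by rewrite invfM mulrCA divff ?mulr1// gt_eqF.
have [S [lS bS SP]] := neumann (@dsum_complete _ _ _ pe) (iter_defect_lin N _) (ltW t0) tk NP.
pose n := #|I|.+1; pose L g := S (\sum_(i < n) iter i (defect N) g).
have bS' : bnd S by exists (2 * kap X ^+ 2) => //; rewrite mulr_ge0// exprn_ge0// ltW.
have bR i : bnd (iter i (defect N)) by have [C /ltW C0 CP] := iter_defect_le i; exists C.
have L_lin : linear L := lin_comp lS (linf_sum n (iter_defect_lin N)).
have L_bnd : bnd L := bnd_comp bS' (bnd_sum n bR).
have LP g : L (g - defect N g) = g.
  have tele m : \sum_(i < m) iter i (defect N) (g - defect N g) = g - iter m (defect N) g.
    elim: m => [|m IH]; first by rewrite big_ord0 subrr.
    by rewrite big_ord_recr /= IH (lin_B (iter_defect_lin N m)) -iterSr addrA subrK.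
  by rewrite -[RHS]SP /L tele.
exists N, (fun v : ell k (pe p) => L (E (chi N) (inj v))); split.
- exact: lin_comp L_lin (lin_comp (msE_lin ms (chi N)) (@inj_lin R k I pe p)).
- apply: (bnd_comp L_bnd (bnd_comp (E_bnd ms (chi N)) _)).
  exact/bnd_contraction/qnorm_inj.
move=> y yE; rewrite -{2}[y]LP /=; congr L.
by rewrite /defect (lin_B (msE_lin ms _)) yE opprB addrC subrK.
Qed.

Lemma pinj_up N : pinj (fun m => if (N <= m)%N then Some (m - N)%N else None).
Proof. by move=> m m' n; case: ifP => // Nm [<-]; case: ifP => // Nm' [/eqP]; rewrite eqn_sub2rE// => /eqP. Qed.

Lemma pinj_down N : pinj (fun m => Some (N + m)%N).
Proof. by move=> m m' n [<-] [/eqP]; rewrite eqn_add2l => /eqP. Qed.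

(* The first N coefficients are stored in the first N coordinates of l_p, the others
   being shifted by N. *)
Lemma range_retract : exists (A : X -> ell k (pe p)) (B : ell k (pe p) -> X),
  [/\ linear A, bnd A, linear B, bnd B & forall y, E (chi 0) y = y -> B (A y) = y].
Proof.
have [N [B [B_lin B_bnd BP]]] := tail_retract.
pose up := reix (p := pe p) (k := k) (pinj_up (N := N)).
pose down := reix (p := pe p) (k := k) (pinj_down (N := N)).
exists (fun y => trunc (pe p) N (c y) + up (E (chi N) y p)).
exists (fun g : ell k (pe p) => \sum_(n < N) g n *: (chi 0 n *: x n) + B (down g)).
have c_lin n : linear (fun y => c y n *: unitv (pe p) n) by apply: lin_rank1 => *; exact: msc_lin.
have c_bnd n : bnd (fun y => c y n *: unitv (pe p) n).
  by have [C C0 CP] := msc_bound ms n; exact: bnd_rank1 C0 CP.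
have g_lin n : linear (fun g : ell k (pe p) => g n *: (chi 0 n *: x n)).
  by apply: lin_rank1 => a u v; rewrite ellD ellZ.
have g_bnd n : bnd (fun g : ell k (pe p) => g n *: (chi 0 n *: x n)).
  by apply: (bnd_rank1 _ ler01) => u; rewrite mul1r coord_le.
have up_bnd : bnd up by exact/bnd_contraction/qnorm_reix.
have down_bnd : bnd down by exact/bnd_contraction/qnorm_reix.
have comp_bnd : bnd (fun f : X => f p) by apply: bnd_contraction => u; exact: qnorm_comp.
split.
- move=> a u v; rewrite !trunc_sum.
  exact: (linfD (linf_sum N c_lin) (lin_comp (reix_lin (pinj_up (N := N))) (lin_comp (@comp_lin _ _ _ pe p) (msE_lin ms (chi N))))).
- have [C C0 CP] := bndD (bnd_sum N c_bnd) (bnd_comp up_bnd (bnd_comp comp_bnd (E_bnd ms (chi N)))).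
  by exists C => [|u]; [exact: C0|have := CP u; rewrite -trunc_sum].
- exact: (linfD (linf_sum N g_lin) (lin_comp B_lin (reix_lin (pinj_down (N := N))))).
- exact: (bndD (bnd_sum N g_bnd) (bnd_comp B_bnd down_bnd)).
move=> y yE; set g := _ + up _.
have gE m : g m = (if (m < N)%N then c y m else 0) + oapp (E (chi N) y p) 0 (if (N <= m)%N then Some (m - N)%N else None).
  by rewrite /g ellD truncE reixE.
have -> : down g = E (chi N) y p.
  by apply: ellP => m; rewrite reixE [LHS]gE ltnNge leq_addr add0r /= addKn.
rewrite BP ?chi_idem// -[RHS]yE (chi_split ms p N).
rewrite (msE_fin _ _ (sball_cut N (sball_chi ms p 0)) (@supp_lt_cut _ _ N (chi 0))).
congr (_ + _); apply: eq_bigr => n _.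
rewrite gE ltn_ord leqNgt ltn_ord /= addr0 !scalerA /cut ltn_ord.
by rewrite mulrC.
Qed.

End RangeComplemented.

(** * Complemented copies of the summands *)

Lemma pigeonhole_seq (R : realType) (k : scalar_kind) (T : eqType) (s : seq T) d
    (phi : T -> nat -> nat -> scalar R k) (S : set nat) eta : 0 < eta ->
  (forall t i, exists C, forall n, sabs (phi t i n) <= C) -> unbdd S ->
  exists2 S', unbdd S' & S' `<=` S /\
  forall t i m n, t \in s -> (i < d)%N -> S' m -> S' n -> sabs (phi t i m - phi t i n) <= eta.
Proof.
move=> eta0 phib Sinf; elim: s => [|t s [S1 S1inf [S1S S1P]]]; first by exists S => //; split=> // t i m n; rewrite in_nil.
have [S2 S2inf [S21 S2P]] := @pigeonhole _ _ d _ _ _ eta0 (phib t) S1inf.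
exists S2 => //; split=> [n /S21/S1S//|u i m n].
rewrite in_cons => /predU1P[->|us] id Sm Sn; first exact: S2P.
by apply: S1P => //; exact: S21.
Qed.

Lemma inj_pinv (g : nat -> nat) : injective g -> exists2 f, pinj f &
  (forall n, f (g n) = Some n) /\ forall m, (forall n, m <> g n) -> f m = None.
Proof.
move=> g_inj.
have /choice[f fP] : forall m, exists o : option nat,
    (forall n, m = g n -> o = Some n) /\ ((forall n, m <> g n) -> o = None).
  move=> m; have [[n ->]|none] := pselect (exists n, m = g n).
    by exists (Some n); split=> [n' /g_inj->//|/(_ n)].
  by exists None; split=> // n mn; case: none; exists n.
exists f; last by split=> [n|m]; [exact: (fP (g n)).1|exact: (fP m).2].
move=> m m' n fm fm'.
have im q : f q = Some n -> q = g n.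
  move=> fq; have [[n' qn]|none] := pselect (exists n', q = g n').
    by have := (fP q).1 _ qn; rewrite fq => -[->].
  have /(fP q).2 : forall n', q <> g n' by move=> n' qn; apply: none; exists n'.
  by rewrite fq.
by rewrite (im _ fm) (im _ fm').
Qed.

Section ComplementedCopy.
Context {R : realType} {k : scalar_kind} {I : finType} (pe : I -> exponent R).
Hypothesis pe_inj : injective pe.
Local Notation X := (dsum (fun i : I => ell k (pe i))).
Variables (ms : multsys X) (p : I).
Local Notation L := (ell k (pe p)).
Implicit Types (a b : nat -> scalar R k) (f : X) (v : L).
Local Notation E := (msE ms).
Local Notation c := (msc ms).
Local Notation x := (msx ms).
Local Notation K := (msK ms).
Local Notation chi := (chi ms).
Local Notation unit m := (unitv (pe p) m : L).

(** Labels exist only at real indices, so the indicators add up to 1 only there; this makes the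
    values at dummy indices immaterial in the resolution of the identity. *)
Lemma msE_real a b f : sball a -> sball b -> (forall i, msreal ms i -> a i = b i) -> E a f = E b f.
Proof.
move=> a1 b1 ab; apply/subr0_eq/qnorm_le0 => e e0.
have k0 := kap_gt0 X; have e2 : 0 < e / (kap X * 2) by rewrite divr_gt0// mulr_gt0.
have [N NP] := msE_cut ms f a1 e2; have [M MP] := msE_cut ms f b1 e2.
pose n := maxn N M; rewrite -[e](@half_kap _ _ X).
apply: le_trans (qnorm_tri (E (cut n a) f) _ _) _; rewrite ler_wpM2l ?(ltW k0)// lerD//.
  exact: NP (leq_maxl _ _).
have -> : E (cut n a) f = E (cut n b) f; last by rewrite qnormC; exact: MP (leq_maxr _ _).
rewrite (msE_fin _ _ (sball_cut n a1) (@supp_lt_cut _ _ n a)).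
rewrite (msE_fin _ _ (sball_cut n b1) (@supp_lt_cut _ _ n b)); apply: eq_bigr => i _.
have [ri|ri] := boolP (msreal ms i); first by rewrite /cut ltn_ord ab.
by rewrite msc_dummy// scale0r !scaler0.
Qed.

Lemma chi_resolution f : \sum_q E (chi q 0) f = f.
Proof.
pose a (s : seq I) i : scalar R k := if label ms i is Some q then (q \in s)%:R else 0.
have a1 s : sball (a s).
  by move=> i; rewrite /a; case: label => [q|]; rewrite ?sabs0//; case: (q \in s); rewrite ?sabs1 ?sabs0.
have sumE s : uniq s -> \sum_(q <- s) E (chi q 0) f = E (a s) f.
  elim: s => [_|q s IH /andP[qs us]].
    by rewrite big_nil -[LHS](msE0 ms f); congr E; apply/funext => i; rewrite /a; case: label.
  have aE : a (q :: s) = fun i => chi q 0 i + a s i.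
    apply/funext => i; rewrite chiE /a; case: label => [q'|] /=; last by rewrite addr0.
    rewrite in_cons andbT (inj_eq (@Some_inj _)).
    by case: eqP => [->|_] /=; rewrite ?(negbTE qs) ?addr0 ?add0r.
  rewrite big_cons IH// aE msE_add// -?aE//; exact: sball_chi.
rewrite (sumE _ (index_enum_uniq I)) -[RHS](msE_one ms); apply: msE_real => //.
  by move=> i; rewrite sabs1.
move=> i; rewrite -label_real /a; case: label => // q _.
by rewrite mem_index_enum.
Qed.

(** The identity outside and the indicator inside are each split at [N]. Terms with a head are small
    because the listed coefficients are; tail against tail is [diagonal_small] with label q and
    component p. *)
Lemma cross_small q d : q != p -> 0 < d -> exists N, exists2 eta, 0 < eta & forall v, qnorm v <= kap L * 2 ->
  (forall j, (j < N)%N -> sabs (c (inj v) j) <= eta /\ sabs (c (proj p (E (chi q 0) (inj v))) j) <= eta) ->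
  qnorm (proj p (E (chi q 0) (inj v))) <= d.
Proof.
move=> qp d0; have k0 := kap_gt0 X; have K0 := msK_gt0 ms.
pose e := d / (kap X * 2); have e0 : 0 < e by rewrite divr_gt0// mulr_gt0.
pose e' := e / (kap X * 2); have e'0 : 0 < e' by rewrite divr_gt0// mulr_gt0.
have kL : 0 < kap L * 2 by rewrite mulr_gt0// kap_gt0.
have [N NP] := diagonal_small pe_inj ms qp (divr_gt0 e'0 kL).
have [eta1 eta10 small1] := msE_small ms N e0.
have [eta2 eta20 small2] := msE_small ms N (divr_gt0 e'0 K0).
exists N, (Num.min eta1 eta2); first by rewrite lt_min eta10.
move=> v v2 cv; set f : X := inj v; set w := proj p _.
have fE : proj p f = f by rewrite /proj /f injE.
pose b i : scalar R k := if (i < N)%N then 0 else 1.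
have b1 : sball b by move=> i; rewrite /b; case: ifP; rewrite ?sabs0 ?sabs1.
have o1 : sball (fun=> 1 : scalar R k) by move=> i; rewrite sabs1.
have bN : supp_ge b N by move=> i iN; rewrite /b iN.
rewrite -[w](msE_one ms).
have -> : (fun=> 1) = fun i => cut N (fun=> 1) i + b i.
  by apply/funext => i; rewrite /cut /b; case: ifP; rewrite ?addr0 ?add0r.
rewrite msE_add//; first 1 last.
- exact: sball_cut.
- exact: sball_disj (sball_cut N o1) b1 (@supp_lt_cut _ _ N _) bN.
rewrite -[d](@half_kap _ _ X); apply: le_trans (qnormDk _ _) _.
rewrite ler_wpM2l ?(ltW k0)// lerD//.
  apply: small1; [exact: sball_cut|exact: supp_lt_cut|move=> i iN].
  by apply: le_trans (cv _ iN).2 _; rewrite ge_min lexx.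
rewrite /w (chi_split ms q N) (lin_D (proj_lin p)) (lin_D (msE_lin ms b)).
rewrite -/e -[e](@half_kap _ _ X); apply: le_trans (qnormDk _ _) _.
rewrite ler_wpM2l ?(ltW k0)// lerD//.
  apply: le_trans (msE_le ms _ _) _; rewrite mulrC -ler_pdivlMr//.
  apply: le_trans (qnorm_proj _ _) _; apply: small2; [exact/sball_cut/sball_chi|exact: supp_lt_cut|move=> i iN].
  by apply: le_trans (cv _ iN).1 _; rewrite ge_min lexx orbT.
rewrite -fE; apply: le_trans (NP _ _ _ (leqnn N) b1 bN) _.
rewrite -/e' mulrAC ler_pdivrMr// ler_wpM2l ?(ltW e'0)//.
by apply: le_trans v2; exact: qnorm_inj.
Qed.

(* Pigeonhole on the finitely many functionals of [cross_small]. *)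
Lemma good_pair M d : 0 < d -> exists mm : nat * nat, [/\ (M <= mm.1)%N, (mm.1 < mm.2)%N &
  qnorm (E (chi p 0) (inj (unit mm.1 - unit mm.2)) p - (unit mm.1 - unit mm.2)) <= d].
Proof.
move=> d0; have kL := kap_gt0 (L : quasiNormedType R k).
have [e e0 sumP] := small_sum (L : quasiNormedType R k) I d0.
have /choice[N /choice[eta NP]] : forall q, exists N, exists eta, 0 < eta /\ (q != p ->
    forall v, qnorm v <= kap L * 2 ->
    (forall j, (j < N)%N -> sabs (c (inj v) j) <= eta /\ sabs (c (proj p (E (chi q 0) (inj v))) j) <= eta) ->
    qnorm (proj p (E (chi q 0) (inj v))) <= e).
  move=> q; have [qp|] := pselect (q != p); last by exists 0%N, 1.
  by have [N [eta eta0 H]] := cross_small qp e0; exists N, eta.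
pose n := \max_q N q; pose h := \big[Num.min/1]_q eta q.
have h0 : 0 < h by rewrite /h; elim/big_rec : _ => // q y _ y0; rewrite lt_min (NP q).1.
(* [None] stands for the coefficients of the unit vector itself, [Some q] for those of its image
   under [E (chi q 0)] followed by the projection; [cross_small] asks for both. *)
pose phi (o : option I) j m : scalar R k :=
  if o is Some q then c (proj p (E (chi q 0) (inj (unit m)))) j else c (inj (unit m)) j.
have phib o j : exists C, forall m, sabs (phi o j m) <= C.
  have [C C0 CP] := msc_bound ms j; have K0 := msK_gt0 ms.
  have i1 m : qnorm (inj (unit m) : X) <= 1.
    by apply: le_trans (qnorm_inj _) _; exact: qnorm_unitv.
  case: o => [q|]; last by exists (C * 1) => m; apply: le_trans (CP _) _; apply: ler_wpM2l => //; exact: i1.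
  exists (C * (K * 1)) => m; apply: le_trans (CP _) _; rewrite ler_wpM2l//.
  apply: le_trans (qnorm_proj _ _) _; apply: le_trans (msE_le ms _ _) _.
  by apply: ler_wpM2l; [exact: ltW|exact: i1].
have [S Sinf [_ SP]] := pigeonhole_seq (index_enum (option I)) n h0 phib unbddT.
have [m mM Sm] := Sinf M; have [m' mm' Sm'] := Sinf m.+1.
exists (m, m'); split => //=; set v := unit m - unit m'.
have v2 : qnorm v <= kap L * 2.
  apply: le_trans (qnormBk _ _) _; rewrite ler_wpM2l ?(ltW kL)//.
  by rewrite -[2]/(1 + 1) lerD// qnorm_unitv.
have phiv o j : (j < n)%N -> sabs (phi o j m - phi o j m') <= h.
  by move=> jn; apply: SP => //; rewrite mem_index_enum.
(* As the multipliers of all labels sum to the identity, the error for label p is minus the total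
   contribution of the other labels. *)
have -> : E (chi p 0) (inj v) p - v = - \sum_(q | q != p) E (chi q 0) (inj v) p.
  have := congr1 (fun f : X => f p) (chi_resolution (inj v)).
  rewrite dsum_sum injE (bigD1 p)//= => resv.
  by rewrite -[X in _ - X]resv opprD addrA subrr sub0r.
rewrite qnormN -[d]mulr1; apply: sumP => // q qp; rewrite mulr1.
have pE : E (chi q 0) (inj v) p = proj p (E (chi q 0) (inj v)) p by rewrite /proj injE.
rewrite pE; apply: le_trans (qnorm_comp _ _) _.
apply: (NP q).2 => // j jN; have jn : (j < n)%N by apply: leq_trans jN _; exact: leq_bigmax.
have hq : h <= eta q by exact: bigmin_le.
have iB : inj v = inj (unit m) - inj (unit m') :> X by exact: lin_B (@inj_lin _ _ _ _ _) _ _.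
rewrite !iB (lin_B (msE_lin ms _)) (lin_B (proj_lin p)) !mscB; split.
  exact: le_trans (phiv None j jn) hq.
exact: le_trans (phiv (Some q) j jn) hq.
Qed.

(** Each pair starts beyond the previous one, so $g_n<g'_n<g_{n+1}$. With disjoint ranges, reading
    the coordinates $g_n$ ignores the subtracted unit vectors. *)
Lemma good_sequence (eta : nat -> R) : (forall n, 0 < eta n) -> exists g g' : nat -> nat,
  [/\ injective g, injective g', (forall i j, g i <> g' j) &
  forall n, qnorm (E (chi p 0) (inj (unit (g n) - unit (g' n))) p - (unit (g n) - unit (g' n))) <= eta n].
Proof.
move=> eta0; have /choice[pk pkP] : forall nM : nat * nat, exists mm : nat * nat,
    [/\ (nM.2 <= mm.1)%N, (mm.1 < mm.2)%N &
     qnorm (E (chi p 0) (inj (unit mm.1 - unit mm.2)) p - (unit mm.1 - unit mm.2)) <= eta nM.1].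
  by move=> [n M]; exact: good_pair.
pose lo := fix lo n := if n is n'.+1 then (pk (n', lo n')).2.+1 else 0%N.
have loS n : lo n.+1 = (pk (n, lo n)).2.+1 by [].
pose g n := (pk (n, lo n)).1; pose g' n := (pk (n, lo n)).2.
have log n : (lo n <= g n)%N by have [] := pkP (n, lo n).
have gg' n : (g n < g' n)%N by have [] := pkP (n, lo n).
have mono m n : (m <= n)%N -> (lo m <= lo n)%N.
  move=> mn; rewrite -(subnKC mn); elim: (n - m)%N => [|i IH]; first by rewrite addn0.
  rewrite addnS loS; apply: leq_trans IH _; apply: leq_trans (log _) _.
  by apply: leq_trans (ltnW (gg' _)) _.
have sep m n : (m < n)%N -> (g' m < g n)%N.
  by move=> /mono; rewrite loS => /leq_trans; apply.
exists g, g'; split.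
- move=> m n gmn; have [mn|nm|//] := ltngtP m n.
    by have := ltn_trans (gg' m) (sep _ _ mn); rewrite gmn ltnn.
  by have := ltn_trans (gg' n) (sep _ _ nm); rewrite gmn ltnn.
- move=> m n gmn; have [mn|nm|//] := ltngtP m n.
    by have := ltn_trans (sep _ _ mn) (gg' n); rewrite gmn ltnn.
  by have := ltn_trans (sep _ _ nm) (gg' m); rewrite gmn ltnn.
- move=> m n gmn; have [nm|mn] := ltnP n m; first by have := sep _ _ nm; rewrite gmn ltnn.
  have : (g m < g' n)%N.
    move: mn; rewrite leq_eqVlt => /predU1P[->//|mn].
    exact: ltn_trans (gg' m) (ltn_trans (sep _ _ mn) (gg' n)).
  by rewrite gmn ltnn.
by move=> n; have [] := pkP (n, lo n).
Qed.

(* [D' \o C] is a small perturbation of the identity, where C is induced by a sequence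
   of good pairs with rapidly decreasing errors and D' reads off the first coordinates. *)
Lemma complemented_copy : exists (C : L -> X) (D : X -> L),
  [/\ linear C, bnd C, linear D, bnd D & (forall v, E (chi p 0) (C v) = C v) /\ forall v, D (C v) = v].
Proof.
have k0 := kap_gt0 (L : quasiNormedType R k); pose kL := kap L.
pose t0 : R := (2 * kL)^-1; have t00 : 0 < t0 by rewrite invr_gt0 mulr_gt0.
(* Summing the errors costs $2\kappa$ in [qnorm_geo] and $\kappa$ in [qcvg_le]; since
   $2\kappa^2A=1/(2\kappa)=t_0$, the perturbation meets the hypothesis of [neumann]. *)
pose A : R := (4 * kL ^+ 3)^-1; have A0 : 0 < A by rewrite invr_gt0 mulr_gt0// exprn_gt0.
have [|g [g' [g_inj g'_inj gg' gP]]] := @good_sequence (fun n => A * t0 ^+ n).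
  by move=> n; rewrite mulr_gt0// exprn_gt0.
have [f1 f1_inj [f1g f1n]] := inj_pinv g_inj; have [f2 f2_inj [f2g f2n]] := inj_pinv g'_inj.
have h_inj : pinj (fun n => Some (g n)) by move=> m m' n [<-] [/g_inj].
pose Phi (v : L) : L := reix f1_inj v - reix f2_inj v.
have Phi_lin : linear Phi by exact: linfD (reix_lin f1_inj) (linfN (reix_lin f2_inj)).
have reix_bnd s (s_inj : pinj s) : bnd (reix s_inj : L -> L).
  exact/bnd_contraction/qnorm_reix.
have Phi_bnd : bnd Phi by exact: bndD (reix_bnd _ f1_inj) (bndN (reix_bnd _ f2_inj)).
have h_Phi v : reix h_inj (Phi v) = v.
  by apply: ellP => n; rewrite reixE -[LHS]/(Phi v (g n)) /Phi ellB !reixE f1g f2n ?subr0.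
have reix_unit s (s_inj : pinj s) n gn : s gn = Some n -> reix s_inj (unit n) = unit gn.
  move=> sgn; apply: ellP => m; rewrite reixE unitvE; have [->|mg] := eqVneq m gn.
    by rewrite sgn -[LHS]/(unit n n) unitvE eqxx.
  case sm : (s m) => [n'|//]; rewrite -[LHS]/(unit n n') unitvE; case: eqP => // nn.
  by case/eqP: mg; apply: (s_inj _ _ n); rewrite ?sm ?nn.
have Phi_unit n : Phi (unit n) = unit (g n) - unit (g' n).
  by rewrite /Phi (reix_unit _ _ _ _ (f1g n)) (reix_unit _ _ _ _ (f2g n)).
pose C v : X := E (chi p 0) (inj (Phi v)).
have inj_bnd : bnd (@inj R k I pe p) by exact/bnd_contraction/qnorm_inj.
have comp_bnd : bnd (fun f : X => f p) by apply: bnd_contraction => u; exact: qnorm_comp.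
have C_lin : linear C by exact: lin_comp (msE_lin ms (chi p 0)) (lin_comp (@inj_lin R k I pe p) Phi_lin).
have C_bnd : bnd C by exact: bnd_comp (E_bnd ms (chi p 0)) (bnd_comp inj_bnd Phi_bnd).
pose D' (f : X) : L := reix h_inj (f p).
have D'_lin : linear D' by exact: lin_comp (reix_lin h_inj) (@comp_lin R k I pe p).
have D'_bnd : bnd D' by exact: bnd_comp (reix_bnd _ h_inj) comp_bnd.
pose U v : L := v - D' (C v).
have U_lin : linear U by move=> a u v; rewrite /U C_lin D'_lin scalerBr opprD addrACA.
have [B B0 BP] : bnd U by exact: bndD (@bnd_id _ _ L) (bndN (bnd_comp D'_bnd C_bnd)).
have U_unit n : qnorm (U (unit n)) <= A * t0 ^+ n.
  rewrite /U qnormC -{2}[unit n]h_Phi Phi_unit /D' -(lin_B (reix_lin h_inj)).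
  by apply: le_trans (qnorm_reix _ _) _; rewrite /C Phi_unit.
have kt : kL * t0 <= 2^-1 by rewrite /t0 invfM mulrCA divff ?mulr1// gt_eqF.
have U_small v : qnorm (U v) <= t0 * qnorm v.
  have -> : t0 * qnorm v = kL * (2 * kL * (A * qnorm v)).
    by rewrite /t0 /A; field; rewrite gt_eqF.
  apply: qcvg_le (qcvg_lin U_lin BP (trunc_cvg v)) => M.
  rewrite trunc_sum (lin_sum U_lin); have v0 := qnorm_ge0 v.
  apply: (@qnorm_geo R k L (fun i => U (v i *: unit i)) (A * qnorm v) t0) => // [||i].
  - by rewrite mulr_ge0// ltW.
  - exact: ltW.
  rewrite (lin_Z U_lin) qnormZ [leRHS]mulrAC mulrC.
  by apply: ler_pM; rewrite ?qnorm_ge0 ?sabs_ge0// coord_le.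
have [S [S_lin S_bnd SP]] := neumann (@ell_complete R k (pe p)) U_lin (ltW t00) kt U_small.
exists C, (S \o D'); split=> //.
- exact: lin_comp S_lin D'_lin.
- apply: bnd_comp D'_bnd; exists (2 * kL ^+ 2) => //; rewrite mulr_ge0// exprn_ge0// ltW//.
split=> v; first exact: chi_idem.
by rewrite -[RHS]SP /= /U subKr.
Qed.

End ComplementedCopy.

(** * Closed spans of subfamilies *)

Section BasisSystem.
Context {R : realType} {k : scalar_kind} {V : quasiNormedType R k} {J : countType} (x : J -> V).

Lemma spread_scale (a : J -> scalar R k) :
  spread 0 (fun j => a j *: x j) = fun i => spread 0 a i *: spread 0 x i.
Proof.
by apply/funext => i; rewrite /spread; case: pickle_inv => //=; rewrite scaler0.
Qed.

Lemma spread_pickle (T : Type) (z : T) (u : J -> T) j : spread z u (cpickle j) = u j.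
Proof. by rewrite /spread pickleK_inv. Qed.

Lemma basis_system : qcomplete V -> unconditional_basis x -> exists ms : multsys V,
  msx ms = spread 0 x /\ msreal ms = (fun i => isSome (@pickle_inv J i)).
Proof.
move=> cV [x_basic x_span]; pose real (i : nat) := isSome (@pickle_inv J i).
have unspread (c : nat -> scalar R k) : (forall i, ~~ real i -> c i = 0) ->
    c = spread 0 (fun j : J => c (cpickle j)).
  move=> c0; apply/funext => i; rewrite /spread; have := c0 i; rewrite /real.
  have := @pickle_invK J i; case: pickle_inv => [j|] /=; first by move=> ->.
  by move=> _; apply.
have x0 i : ~~ real i -> spread 0 x i = 0 by rewrite /real /spread; case: pickle_inv.
have ex f : exists c : nat -> scalar R k,
    (forall i, ~~ real i -> c i = 0) /\ usum (fun i => c i *: spread 0 x i) f.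
  have [|a [af _]] := x_basic f; first by rewrite x_span.
  exists (spread 0 a); split=> [i|]; first by rewrite /real /spread; case: pickle_inv.
  by rewrite -spread_scale; exact: unconditional_usum.
have uniq f (c c' : nat -> scalar R k) :
    (forall i, ~~ real i -> c i = 0) -> (forall i, ~~ real i -> c' i = 0) ->
    usum (fun i => c i *: spread 0 x i) f -> usum (fun i => c' i *: spread 0 x i) f -> c = c'.
  move=> c0 c'0; rewrite (unspread c c0) (unspread c' c'0) -!spread_scale.
  move=> /usum_unconditional fc /usum_unconditional fc'.
  have [|a [_ aU]] := x_basic f; first by rewrite x_span.
  by rewrite -(aU _ fc) -(aU _ fc').
exact: (multsys_of_basis cV x0 ex uniq).
Qed.

End BasisSystem.

Section Spans.
Context {R : realType} {k : scalar_kind} {V : quasiNormedType R k} {J : countType} (x : J -> V).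
Variables (ms : multsys V) (a : nat -> scalar R k) (Q : pred nat).
Hypotheses (xE : msx ms = spread 0 x) (realE : msreal ms = (fun i => isSome (@pickle_inv J i))).
Hypotheses (Q_real : forall i, Q i -> msreal ms i) (aE : forall i, a i = (Q i)%:R).

Let a1 : sball a.
Proof. by move=> i; rewrite aE; case: (Q i); rewrite ?sabs1 ?sabs0. Qed.

Lemma msE_x b i : sball b -> msreal ms i -> msE ms b (msx ms i) = b i *: msx ms i.
Proof.
move=> b1 ri; apply/subr0_eq/qnorm_le0 => e e0.
have [N NP] := msE_cut ms (msx ms i) b1 e0; pose n := maxn N i.+1.
have iN : (i < n)%N by exact: leq_maxr.
have -> : b i *: msx ms i = msE ms (cut n b) (msx ms i); last exact: NP (leq_maxl _ _).
rewrite (msE_fin _ _ (sball_cut n b1) (@supp_lt_cut _ _ n b)) (bigD1 (Ordinal iN))//= big1.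
  by rewrite addr0 /cut iN msc_delta eqxx ri scale1r.
move=> j ji; rewrite msc_delta; case: eqP => [jE|_]; last by rewrite scale0r scaler0.
by case/eqP: ji; apply: val_inj.
Qed.

(** The multiplier fixes the generators and is bounded, hence fixes their closed span. Conversely a
    fixed vector is approximated by the cuts [msE ms (cut m a) f], which are finite combinations of
    generators. *)
Lemma closed_span_range : closed_span (x @` [set j | Q (cpickle j)]) = [set f | msE ms a f = f].
Proof.
have k0 := kap_gt0 V; have K0 := msK_gt0 ms; apply/seteqP; split=> f /=.
  move=> cf; apply/esym/subr0_eq/qnorm_le0 => e e0.
  have d0 : 0 < e / (kap V * (1 + msK ms)) by rewrite divr_gt0// mulr_gt0// addr_gt0.
  have /cf[_ [[n [b [v [vS ->]]]]]] : nbhs f [set y | qnorm (f - y) < e / (kap V * (1 + msK ms))].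
    by rewrite nbhs_qnorm; exists (e / (kap V * (1 + msK ms))).
  set y := \sum_(i < n) _ => /= fy.
  have yE : msE ms a y = y.
    rewrite (lin_sum (msE_lin ms a)); apply: eq_bigr => i _; rewrite (lin_Z (msE_lin ms a)).
    have [j Qj <-] := vS i; rewrite -(spread_pickle 0 x) -xE msE_x ?Q_real//.
    by rewrite aE Qj scale1r.
  have -> : f - msE ms a f = (f - y) - msE ms a (f - y).
    by rewrite (lin_B (msE_lin ms a)) yE opprB addrA subrK.
  apply: le_trans (qnormBk _ _) _.
  apply: (@le_trans _ _ (kap V * ((1 + msK ms) * qnorm (f - y)))).
    by rewrite ler_wpM2l ?(ltW k0)// mulrDl mul1r lerD2l msE_le.
  by rewrite mulrA mulrC -ler_pdivlMr ?ltW// mulr_gt0// addr_gt0.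
move=> fE B; rewrite nbhs_qnorm => -[e /= e0 eB].
have e2 : 0 < e / 2 by rewrite divr_gt0.
have [m mP] := msE_cut ms f a1 e2.
exists (msE ms (cut m a) f); split; last first.
  apply: eB => /=; rewrite -{1}fE; apply: le_lt_trans (mP m (leqnn m)) _.
  by rewrite ltr_pdivrMr// ltr_pMr// ltr1n.
pose s := [seq i <- iota 0 m | Q i].
exists (size s), (fun i => msc ms f (nth 0%N s i)), (fun i => msx ms (nth 0%N s i)); split.
  move=> i; have : nth 0%N s i \in s by exact: mem_nth.
  rewrite mem_filter => /andP[Qn _]; have := Q_real Qn; rewrite realE xE.
  have := @pickle_invK J (nth 0%N s i); rewrite /spread; case: pickle_inv => [j|//] /= jn _.
  by exists j => //=; rewrite jn.
rewrite (msE_fin _ _ (sball_cut m a1) (@supp_lt_cut _ _ m a)).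
transitivity (\sum_(i < m | Q i) msc ms f i *: msx ms i).
  rewrite [RHS]big_mkcond; apply: eq_bigr => i _; rewrite /cut ltn_ord aE.
  by case: (Q i); rewrite ?scale1r ?scale0r.
rewrite -(big_mkord Q (fun i => msc ms f i *: msx ms i)) -big_filter /index_iota subn0.
by rewrite (big_nth 0%N) big_mkord.
Qed.

End Spans.

Lemma bnd_continuous (R : realType) (k : scalar_kind) (V W : quasiNormedType R k) (T : V -> W) :
  linear T -> bnd T -> continuous T.
Proof.
move=> lT [C C0 TC] u B; rewrite nbhs_qnorm => -[e /= e0 eB].
have C1 : 0 < C + 1 by rewrite ltr_wpDl.
suff : nbhs u (T @^-1` B) by [].
rewrite nbhs_qnorm; exists (e / (C + 1)); first by rewrite /= divr_gt0.
move=> v /= uv; apply: eB => /=; rewrite -(lin_B lT); apply: le_lt_trans (TC _) _.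
apply: (@le_lt_trans _ _ ((C + 1) * qnorm (u - v))); first by rewrite ler_wpM2r ?qnorm_ge0// lerDl.
by rewrite mulrC -ltr_pdivlMr.
Qed.

Theorem theorem1p1 (R : realType) (k : scalar_kind) (A : {fset exponent R})
    (J : countType) (x : J -> dsum (fun p : A => ell k (val p))) :
  unconditional_basis x ->
  exists J_ : A -> set J,
    partition [set: A] J_ [set: J] /\
    forall p : A, isomorphic_to_subspace (ell k (val p)) (closed_span (x @` J_ p)).
Proof.
move=> x_basis; pose pe (p : A) := val p; have pe_inj : injective pe := val_inj.
have [ms [xE realE]] := basis_system (@dsum_complete R k A pe) x_basis.
pose Q p i := label ms i == Some p.
have Q_real p i : Q p i -> msreal ms i by rewrite -label_real => /eqP->.
have spanE p : closed_span (x @` [set j | Q p (cpickle j)]) = [set f | msE ms (chi ms p 0) f = f].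
  apply: (closed_span_range xE realE (@Q_real p)) => i.
  by rewrite /chi andbT -/(Q p i); case: (Q p i).
have iso p : exists (T : ell k (pe p) -> dsum (fun p : A => ell k (pe p))) T',
    [/\ linear T, linear T', bnd T & bnd T'] /\
    [/\ forall u, T' (T u) = u, forall u, msE ms (chi ms p 0) (T u) = T u &
      forall y, msE ms (chi ms p 0) y = y -> T (T' y) = y].
  have [A0 [B [lA bA lB bB BA]]] := range_retract pe_inj ms p.
  have [C [D [lC bC lD bD [YC DC]]]] := complemented_copy pe_inj ms p.
  have lEB := lin_comp (msE_lin ms (chi ms p 0)) lB.
  have bEB := bnd_comp (E_bnd ms (chi ms p 0)) bB.
  (* The map from [range_retract] need not take its values in the fixed space, so it is composed
     with the multiplier. *)
  apply: (pelczynski (Y := [set y | msE ms (chi ms p 0) y = y]) lA lEB lC lD bA bEB bC bD) => //=.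
  - by move=> u; exact: chi_idem.
  - by move=> c y z yE zE; rewrite msE_lin yE zE.
  - by move=> y yE; rewrite BA.
exists (fun p => [set j | Q p (cpickle j)]); split.
  split.
  - apply/seteqP; split=> // j _; have : msreal ms (cpickle j) by rewrite realE pickleK_inv.
    rewrite -label_real; case jp : (label ms (cpickle j)) => [p|//] _.
    by exists p => //=; rewrite /Q jp.
  - by move=> p q _ _ [j [/= /eqP jp /eqP]]; rewrite jp => -[].
  (* [partition] demands nonempty blocks. An empty one would make the multiplier, hence T, vanish,
     contradicting that [T'] recovers a unit vector. *)
  move=> p _; apply: contrapT => none; have [T [T' [[lT lT' _ _] [TK TY _]]]] := iso p.
  have chi0 : chi ms p 0 = fun=> 0.
    apply/funext => i; rewrite /chi andbT; case: ifP => // Qi; case: none.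
    have := Q_real _ _ Qi; rewrite realE; have := @pickle_invK J i.
    by case: pickle_inv => [j|//] /= ji _; exists j; rewrite /= /Q ji.
  have := congr1 (fun u : ell k (pe p) => u 0%N) (TK (unitv (pe p) 0%N)).
  rewrite -TY chi0 msE0 (lin_0 lT') unitvE => /esym/eqP.
  by rewrite oner_eq0.
move=> p; rewrite spanE; have [T [T' [[lT lT' bT bT'] [TK TY YT]]]] := iso p.
pose Tl : {linear ell k (val p) -> dsum (fun p : A => ell k (val p))} :=
  HB.pack T (GRing.isLinear.Build _ _ _ _ T lT).
exists Tl, T'; split.
- exact: TK.
- apply/seteqP; split=> [_ [u _ <-]|y yE]; first exact: TY.
  by exists (T' y) => //; exact: YT.
- exact: (bnd_continuous lT bT).
- by apply: continuous_subspaceT; exact: (bnd_continuous lT' bT').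
Qed.
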